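(* Let $n\ge 1$ and let $\phi$ be the Krattenthaler bijection from the set of $132$-avoiding permutations of $\{1,\dots,n\}$ to the set of Dyck paths of semilength $n$. Then $\phi$ restricts to a bijection between the set of $132$-avoiding permutations of $\{1,\dots,n\}$ that additionally avoid the patterns $4321$ and $4231$, and the set of shod Dyck paths of semilength $n$. Moreover, this bijection further restricts to a bijection between the set of $132$-avoiding permutations of $\{1,\dots,n\}$ that additionally avoid the pattern $321$, and the set of tilted Dyck paths of semilength $n$.
   Context: Algebras. $K$ is a field; algebras are finite-dimensional $K$-algebras and modules are finite-dimensional. An algebra $A$ is shod if every indecomposable $A$-module $X$ satisfies $\mathrm{pdim}\,X\le 1$ or $\mathrm{idim}\,X\le 1$. An algebra is tilted if it is isomorphic to the endomorphism algebra of a tilting module over a finite-dimensional hereditary algebra. Linear Nakayama algebras. A linear Nakayama algebra with $N$ simple modules is $A=KQ_N/I$, where $Q_N$ is the linear quiver $0\to 1\to\cdots\to N-1$ and $I$ is an admissible ideal. Its Kupisch series is $[c_0,\dots,c_{N-1}]$ with $c_i=\dim_K e_iA$ (the number of non-zero paths in $A$ starting at vertex $i$, including the trivial one). The Kupisch series determines $A$. Dyck paths. A Dyck path of semilength $n$ is a lattice path in $\mathbb{Z}^2$ from $(0,1)$ to $(n,1)$ consisting of up-steps $(0,1)$ and down-steps $(1,-1)$ that never goes below the line $y=1$. Its area sequence is $[c_0,\dots,c_n]$, where $c_i$ is the maximal number such that $(i,c_i)$ lies on the path. The map sending a linear Nakayama algebra with $n+1$ simple modules to the Dyck path of semilength $n$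 whose area sequence equals its Kupisch series is a bijection. A Dyck path is called shod (resp. tilted) if the corresponding linear Nakayama algebra is shod (resp. tilted). Patterns. A permutation $\pi=\pi_1\cdots\pi_n$ of $\{1,\dots,n\}$ avoids the pattern $\sigma=\sigma_1\cdots\sigma_m$ (a permutation of $\{1,\dots,m\}$) if there are no indices $i_1<\dots<i_m$ such that $\pi_{i_1}\cdots\pi_{i_m}$ and $\sigma_1\cdots\sigma_m$ have the same relative order. (If $m>n$, $\pi$ avoids $\sigma$.) Krattenthaler bijection. Let $\pi$ be a $132$-avoiding permutation of $\{1,\dots,n\}$. A left-to-right minimum of $\pi$ is an entry $\pi_i$ with $\pi_i<\pi_j$ for all $j<i$. Let $m_1,m_2,\dots,m_s$ be the left-to-right minima in order of appearance, and write $\pi=m_1w_1m_2w_2\cdots m_sw_s$, where $w_i$ is the (possibly empty) subword strictly between $m_i$ and $m_{i+1}$ (after $m_s$ for $i=s$). Put $m_0=n+1$. Then $\phi(\pi)$ is the Dyck path which, starting at $(0,1)$, for $i=s,s-1,\dots,1$ in this order performs $|w_i|+1$ up-steps followed by $m_{i-1}-m_i$ down-steps. This is a bijection from $132$-avoiding permutations of $\{1,\dots,n\}$ to Dyck paths of semilength $n$. *)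

(* Defs.v *)
From HB Require Import structures.
From mathcomp Require Import all_boot all_order all_fingroup all_algebra all_field.
From mathcomp Require Import classical_sets functions.

Set Implicit Arguments.
Unset Strict Implicit.
Unset Printing Implicit Defensive.

Import GRing.Theory.
Local Open Scope ring_scope.

(* Right modules, finite-dimensional over K: [ract m a] is m.a.               *)

Record rmodule (K : fieldType) (A : falgType K) := RModule {
  rmodule_sort :> vectType K;
  ract : rmodule_sort -> A -> rmodule_sort;
  ract_linearl : forall a k u v, ract (k *: u + v) a = k *: ract u a + ract v a;
  ract_linearr : forall u k a b, ract u (k *: a + b) = k *: ract u a + ract u b;
  ract1 : forall u, ract u 1 = u;
  ractM : forall u a b, ract u (a * b) = ract (ract u a) b
}.

Section Constructions.
Variables (K : fieldType) (A : falgType K).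
Implicit Types M N : rmodule A.

Fact regular_linearl (a : A) (k : K) (u v : A) :
  (k *: u + v) * a = k *: (u * a) + v * a.
Proof. by rewrite mulrDl scalerAl. Qed.

Fact regular_linearr (u : A) (k : K) (a b : A) :
  u * (k *: a + b) = k *: (u * a) + u * b.
Proof. by rewrite mulrDr scalerAr. Qed.

Definition regular_rmodule : rmodule A :=
  @RModule K A A (fun u a => u * a) regular_linearl regular_linearr
    (@mulr1 A) (@mulrA A).

Section DirectSum.
Variables M N : rmodule A.

Definition dsum_act (u : M * N) (a : A) : M * N := (ract u.1 a, ract u.2 a).

Fact dsum_linearl a k (u v : M * N) :
  dsum_act (k *: u + v) a = k *: dsum_act u a + dsum_act v a.
Proof. by rewrite /dsum_act /= !ract_linearl. Qed.

Fact dsum_linearr (u : M * N) (k : K) (a b : A) :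
  dsum_act u (k *: a + b) = k *: dsum_act u a + dsum_act u b.
Proof. by rewrite /dsum_act /= !ract_linearr. Qed.

Fact dsum1 (u : M * N) : dsum_act u 1 = u.
Proof. by case: u => x y; rewrite /dsum_act /= !ract1. Qed.

Fact dsumM (u : M * N) a b : dsum_act u (a * b) = dsum_act (dsum_act u a) b.
Proof. by rewrite /dsum_act /= !ractM. Qed.

Definition dsum_rmodule : rmodule A :=
  @RModule K A (M * N)%type dsum_act dsum_linearl dsum_linearr dsum1 dsumM.

End DirectSum.

Section Power.
Variables (M : rmodule A) (m : nat).

Definition power_act (u : {ffun 'I_m -> M}) (a : A) : {ffun 'I_m -> M} :=
  [ffun i => ract (u i) a].

Fact power_linearl a k (u v : {ffun 'I_m -> M}) :
  power_act (k *: u + v) a = k *: power_act u a + power_act v a.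
Proof. by apply/ffunP=> i; rewrite !ffunE ract_linearl. Qed.

Fact power_linearr (u : {ffun 'I_m -> M}) (k : K) (a b : A) :
  power_act u (k *: a + b) = k *: power_act u a + power_act u b.
Proof. by apply/ffunP=> i; rewrite !ffunE ract_linearr. Qed.

Fact power1 (u : {ffun 'I_m -> M}) : power_act u 1 = u.
Proof. by apply/ffunP=> i; rewrite !ffunE ract1. Qed.

Fact powerM (u : {ffun 'I_m -> M}) a b :
  power_act u (a * b) = power_act (power_act u a) b.
Proof. by apply/ffunP=> i; rewrite !ffunE ractM. Qed.

Definition power_rmodule : rmodule A :=
  @RModule K A {ffun 'I_m -> M} power_act power_linearl power_linearr
    power1 powerM.

End Power.
End Constructions.

Section Homological.
Variables (K : fieldType) (A : falgType K).
Implicit Types M N P Q T X Y Z E : rmodule A.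

Definition is_rhom M N (f : 'Hom(M, N)) : Prop :=
  forall u a, f (ract u a) = ract (f u) a.

Definition isomorphic M N : Prop :=
  exists f : 'Hom(M, N), [/\ is_rhom f, lker f = 0%VS & limg f = fullv].

Definition is_zero M : Prop := fullv = 0%VS :> {vspace M}.

Definition indecomposable X : Prop :=
  ~ is_zero X /\
  forall Y Z, isomorphic X (dsum_rmodule Y Z) -> is_zero Y \/ is_zero Z.

(* 0 -> M -f-> E -g-> N -> 0 is a short exact sequence of modules. *)
Definition short_exact M E N (f : 'Hom(M, E)) (g : 'Hom(E, N)) : Prop :=
  [/\ is_rhom f, is_rhom g, lker f = 0%VS, limg f = lker g & limg g = fullv].

Definition projective P : Prop :=
  forall M N (g : 'Hom(M, N)) (f : 'Hom(P, N)),
    is_rhom g -> limg g = fullv -> is_rhom f ->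
    exists h : 'Hom(P, M), is_rhom h /\ (g \o h)%VF = f.

Definition injective_module Q : Prop :=
  forall M N (g : 'Hom(M, N)) (f : 'Hom(M, Q)),
    is_rhom g -> lker g = 0%VS -> is_rhom f ->
    exists h : 'Hom(N, Q), is_rhom h /\ (h \o g)%VF = f.

(* X has a projective resolution of length at most d, cut into short exact
   sequences. *)
Fixpoint pdim_le (d : nat) X : Prop :=
  if d is d'.+1 then
    exists P Y (f : 'Hom(Y, P)) (g : 'Hom(P, X)),
      [/\ projective P, short_exact f g & pdim_le d' Y]
  else projective X.

Fixpoint idim_le (d : nat) X : Prop :=
  if d is d'.+1 then
    exists Q Y (f : 'Hom(X, Q)) (g : 'Hom(Q, Y)),
      [/\ injective_module Q, short_exact f g & idim_le d' Y]
  else injective_module X.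

(* Ext^1(M, N) = 0, in Yoneda's description of Ext^1. *)
Definition Ext1_eq0 M N : Prop :=
  forall E (f : 'Hom(N, E)) (g : 'Hom(E, M)), short_exact f g ->
    exists h : 'Hom(M, E), is_rhom h /\ (g \o h)%VF = \1%VF.

Definition in_add T X : Prop :=
  exists (m : nat) Y, isomorphic (dsum_rmodule X Y) (power_rmodule T m).

Definition tilting T : Prop :=
  [/\ pdim_le 1 T, Ext1_eq0 T T &
      exists T0 T1 (f : 'Hom(regular_rmodule A, T0)) (g : 'Hom(T0, T1)),
        [/\ in_add T T0, in_add T T1 & short_exact f g]].

Definition hereditary : Prop :=
  forall M P (f : 'Hom(M, P)),
    projective P -> is_rhom f -> lker f = 0%VS -> projective M.

Definition shod : Prop :=
  forall X, indecomposable X -> pdim_le 1 X \/ idim_le 1 X.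

End Homological.

Arguments hereditary {K} A.
Arguments shod {K} A.

(* B is isomorphic, as a K-algebra, to End_A(T) with the usual composition. *)
Definition is_endomorphism_algebra (K : fieldType) (A : falgType K)
    (T : rmodule A) (B : falgType K) : Prop :=
  exists phi : 'Hom(B, 'End(T)),
    [/\ lker phi = 0%VS,
        forall f : 'End(T), f \in limg phi <-> is_rhom f,
        phi 1 = \1%VF &
        forall a b, phi (a * b) = (phi a \o phi b)%VF].

Definition tilted (K : fieldType) (B : falgType K) : Prop :=
  exists (H : falgType K) (T : rmodule H),
    [/\ hereditary H, tilting T & is_endomorphism_algebra T B].

(* The quiver 0 -> 1 -> ... -> n. It has exactly one path from i to j when
   i <= j and none otherwise, so a path is encoded by its two ends. *)

Definition lpath (n : nat) :=
  {ij : 'I_n.+1 * 'I_n.+1 | (ij.1 <= ij.2)%N}.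

Section Paths.
Variable n : nat.
Implicit Types p q r : lpath n.

Definition psource p : 'I_n.+1 := (val p).1.
Definition ptarget p : 'I_n.+1 := (val p).2.
Definition plength p : nat := (ptarget p - psource p)%N.

(* First p, then q. *)
Definition pcat p q : option (lpath n) :=
  if ptarget p == psource q
  then insub (psource p, ptarget q) : option (lpath n) else None.

Definition ptriv (i : 'I_n.+1) : lpath n := exist _ (i, i) (leqnn i).

Lemma pcatE p q r :
  (pcat p q == Some r) =
  [&& ptarget p == psource q, psource r == psource p & ptarget r == ptarget q].
Proof.
rewrite /pcat; case: (ptarget p =P psource q) => //= e.
have le_pq : (psource p <= ptarget q)%N.
  by apply: leq_trans (valP q); rewrite -/(psource q) -e; apply: (valP p).
case: insubP => [s _ def_s | /negP[]//].
rewrite (inj_eq Some_inj) eq_sym -val_eqE def_s /= -xpair_eqE.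
by rewrite -surjective_pairing.
Qed.

Lemma pcatA p q r :
  obind (pcat^~ r) (pcat p q) = obind (pcat p) (pcat q r).
Proof.
pose S u v w : option (lpath n) :=
  if (ptarget u == psource v) && (ptarget v == psource w)
  then insub (psource u, ptarget w) : option (lpath n) else None.
have E u v w : obind (pcat^~ w) (pcat u v) = S u v w /\
               obind (pcat u) (pcat v w) = S u v w.
  rewrite /S; split.
    case Duv: (pcat u v) => [s|] /=.
      move/eqP: Duv; rewrite pcatE => /and3P[-> /eqP es /eqP et] /=.
      by rewrite /pcat es et.
    case: (ptarget u =P psource v) => //= e; move: Duv.
    rewrite /pcat e eqxx insubT //=.
    by apply: leq_trans (valP v); rewrite -/(psource v) -e; apply: (valP u).
  case Dvw: (pcat v w) => [s|] /=.
    move/eqP: Dvw; rewrite pcatE => /and3P[-> /eqP es /eqP et] /=.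
    by rewrite andbT /pcat es et.
  case: (ptarget v =P psource w) => [e|_]; last by rewrite andbF.
  move: Dvw; rewrite /pcat e eqxx insubT //=.
  by apply: leq_trans (valP w); rewrite -/(psource w) -e; apply: (valP v).
by rewrite (E p q r).1 (E p q r).2.
Qed.

End Paths.

(* The path algebra of that quiver: x p is the coefficient of the path p. *)

Definition pathalg (K : fieldType) (n : nat) := {ffun lpath n -> K^o}.

Section PathAlgebra.
Variables (K : fieldType) (n : nat).
Local Notation KQ := (pathalg K n).

HB.instance Definition _ := Vector.on KQ.

Definition path_elt (p : lpath n) : KQ := [ffun q => (q == p)%:R].

(* The sum of the trivial paths. *)
Definition pathalg_one : KQ := [ffun p => (psource p == ptarget p)%:R].

Definition pathalg_mul (x y : KQ) : KQ :=
  [ffun r => \sum_p \sum_(q | pcat p q == Some r) x p * y q].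

Fact pathalg_mulE x y r :
  pathalg_mul x y r = \sum_p \sum_q x p * y q * (pcat p q == Some r)%:R.
Proof.
rewrite ffunE; apply: eq_bigr => p _; rewrite big_mkcond.
by apply: eq_bigr => q _; case: ifP; rewrite ?mulr1 ?mulr0.
Qed.

Fact pathalg_mulA : associative pathalg_mul.
Proof.
move=> x y z; apply/ffunP=> w.
have sel (o : option (lpath n)) (F : lpath n -> option (lpath n)) :
    \sum_p (o == Some p)%:R * (F p == Some w)%:R
    = (obind F o == Some w)%:R :> K.
  case: o => [p0|] /=; last by rewrite big1 // => p _; rewrite mul0r.
  rewrite (bigD1 p0) //= eqxx mul1r big1 ?addr0 // => p ne_p.
  by rewrite (inj_eq Some_inj) eq_sym (negPf ne_p) mul0r.
pose G p q r := x p * y q * z r * (obind (pcat p) (pcat q r) == Some w)%:R.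
transitivity (\sum_p \sum_q \sum_r G p q r).
  rewrite pathalg_mulE; apply: eq_bigr => p _.
  transitivity (\sum_s \sum_q \sum_r x p * y q * z r *
      ((pcat q r == Some s)%:R * (pcat p s == Some w)%:R)).
    apply: eq_bigr => s _; rewrite pathalg_mulE mulr_sumr mulr_suml.
    apply: eq_bigr => q _; rewrite mulr_sumr mulr_suml.
    by apply: eq_bigr => r _; rewrite !mulrA.
  rewrite exchange_big; apply: eq_bigr => q _ /=.
  rewrite exchange_big; apply: eq_bigr => r _ /=.
  by rewrite -mulr_sumr sel.
rewrite pathalg_mulE; symmetry.
transitivity (\sum_s \sum_r \sum_p \sum_q x p * y q * z r *
    ((pcat p q == Some s)%:R * (pcat s r == Some w)%:R)).
  apply: eq_bigr => s _; apply: eq_bigr => r _.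
  rewrite pathalg_mulE !mulr_suml; apply: eq_bigr => p _.
  rewrite !mulr_suml; apply: eq_bigr => q _.
  by rewrite mulrA [_ * z r]mulrAC.
rewrite exchange_big /=.
transitivity (\sum_r \sum_p \sum_q G p q r).
  apply: eq_bigr => r _; rewrite exchange_big; apply: eq_bigr => p _ /=.
  rewrite exchange_big; apply: eq_bigr => q _ /=.
  by rewrite -mulr_sumr sel pcatA.
rewrite exchange_big; apply: eq_bigr => p _ /=.
by rewrite exchange_big.
Qed.

Fact pathalg_mul1 : left_id pathalg_one pathalg_mul.
Proof.
move=> y; apply/ffunP=> r; rewrite pathalg_mulE.
have tE : pcat (ptriv (psource r)) r = Some r.
  by apply/eqP; rewrite pcatE !eqxx.
rewrite (bigD1 (ptriv (psource r))) //= (bigD1 r) //= tE !ffunE !eqxx.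
rewrite mul1r mulr1 !big1 ?addr0 // => [p ne_p | q ne_q].
  apply: big1 => q _; rewrite ffunE pcatE.
  case: eqP => [e|_]; last by rewrite !mul0r.
  case: and3P => [[_ /eqP er _]|_]; last by rewrite mulr0.
  case/negP: ne_p; rewrite -val_eqE /= er [val p]surjective_pairing.
  by rewrite -/(psource p) -/(ptarget p) -e.
rewrite pcatE; case: and3P => [[/eqP es _ /eqP et]|_]; last by rewrite mulr0.
case/negP: ne_q; rewrite -val_eqE [val q]surjective_pairing.
by rewrite [val r]surjective_pairing xpair_eqE; apply/andP; split; apply/eqP.
Qed.

Fact pathalg_1mul : right_id pathalg_one pathalg_mul.
Proof.
move=> y; apply/ffunP=> r; rewrite pathalg_mulE exchange_big /=.
have tE : pcat r (ptriv (ptarget r)) = Some r.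
  by apply/eqP; rewrite pcatE !eqxx.
rewrite (bigD1 (ptriv (ptarget r))) //= (bigD1 r) //= tE !ffunE !eqxx.
rewrite !mulr1 !big1 ?addr0 // => [p ne_p | q ne_q].
  apply: big1 => q _; rewrite ffunE pcatE.
  case: eqP => [e|_]; last by rewrite mulr0 mul0r.
  case: and3P => [[_ _ /eqP er]|_]; last by rewrite mulr0.
  case/negP: ne_p; rewrite -val_eqE /= er [val p]surjective_pairing.
  by rewrite -/(psource p) -/(ptarget p) e.
rewrite pcatE; case: and3P => [[/eqP et /eqP es _]|_]; last by rewrite mulr0.
case/negP: ne_q; rewrite -val_eqE [val q]surjective_pairing.
by rewrite [val r]surjective_pairing xpair_eqE; apply/andP; split; apply/eqP.
Qed.

Fact pathalg_mulDl : left_distributive pathalg_mul +%R.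
Proof.
move=> x y z; apply/ffunP=> r; rewrite [RHS]ffunE !pathalg_mulE -big_split.
apply: eq_bigr => p _ /=; rewrite -big_split; apply: eq_bigr => q _ /=.
by rewrite ffunE !mulrDl.
Qed.

Fact pathalg_mulDr : right_distributive pathalg_mul +%R.
Proof.
move=> x y z; apply/ffunP=> r; rewrite [RHS]ffunE !pathalg_mulE -big_split.
apply: eq_bigr => p _ /=; rewrite -big_split; apply: eq_bigr => q _ /=.
by rewrite ffunE mulrDr mulrDl.
Qed.

Fact pathalg_one_neq0 : pathalg_one != 0.
Proof.
apply/eqP=> /ffunP/(_ (ptriv ord0)); rewrite !ffunE eqxx.
by apply/eqP; rewrite oner_eq0.
Qed.

HB.instance Definition _ := GRing.Zmodule_isNzRing.Build KQ
  pathalg_mulA pathalg_mul1 pathalg_1mul pathalg_mulDl pathalg_mulDr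
  pathalg_one_neq0.

Fact pathalg_scaleAl (k : K) (x y : KQ) : k *: (x * y) = (k *: x) * y.
Proof.
apply/ffunP=> r; rewrite ffunE !pathalg_mulE scaler_sumr.
apply: eq_bigr => p _; rewrite scaler_sumr; apply: eq_bigr => q _.
by rewrite ffunE -!mulrA.
Qed.

HB.instance Definition _ := GRing.Lmodule_isLalgebra.Build K KQ pathalg_scaleAl.

Fact pathalg_scaleAr (k : K) (x y : KQ) : k *: (x * y) = x * (k *: y).
Proof.
apply/ffunP=> r; rewrite ffunE !pathalg_mulE scaler_sumr.
apply: eq_bigr => p _; rewrite scaler_sumr; apply: eq_bigr => q _.
by rewrite ffunE /GRing.scale /= !mulrA [k * x p]mulrC.
Qed.

HB.instance Definition _ := GRing.Lalgebra_isAlgebra.Build K KQ pathalg_scaleAr.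
HB.instance Definition _ := Algebra_isFalgebra.Build K KQ.

(* The two-sided ideal generated by the arrows. *)
Definition arrow_ideal : {vspace KQ} :=
  (fullv * <<[seq path_elt p | p in [pred q | plength q == 1%N]]>> * fullv)%VS.

Definition two_sided_ideal (I : {vspace KQ}) : bool :=
  (fullv * I <= I)%VS && (I * fullv <= I)%VS.

Definition admissible (I : {vspace KQ}) : Prop :=
  two_sided_ideal I /\
  exists m : nat, [/\ (2 <= m)%N, (arrow_ideal ^+ m <= I)%VS &
                      (I <= arrow_ideal ^+ 2)%VS].

(* A is isomorphic to KQ / I for an admissible ideal I (the kernel of f), and
   c lists the dimensions of the right ideals e_i A. *)
Definition linear_nakayama (A : falgType K) (c : seq nat) : Prop :=
  exists f : 'AHom(KQ, A),
    [/\ limg f = fullv, admissible (lker f), size c = n.+1 &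
        forall i : 'I_n.+1,
          nth 0%N c i = \dim (<[f (path_elt (ptriv i))]> * fullv)].

End PathAlgebra.

(* Lattice paths: true is the up-step (0,1), false the down-step (1,-1). *)

Definition lattice_step (p : nat * nat) (up : bool) : nat * nat :=
  if up then (p.1, p.2.+1) else (p.1.+1, p.2.-1).

(* All lattice points visited from (0,1), including the starting point. The
   truncation of the height at 0 is harmless: a path that goes below y = 1
   first visits height 0. *)
Definition lattice_points (w : seq bool) : seq (nat * nat) :=
  (0%N, 1%N) :: scanl lattice_step (0%N, 1%N) w.

Definition is_dyck (n : nat) (w : seq bool) : bool :=
  (last (0%N, 1%N) (lattice_points w) == (n, 1%N)) &&
  all (fun p : nat * nat => 1 <= p.2)%N (lattice_points w).

Definition area_sequence (n : nat) (w : seq bool) : seq nat :=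
  mkseq (fun i => \max_(p <- lattice_points w | p.1 == i) p.2) n.+1.

Local Open Scope classical_set_scope.

Definition shod_dyck (K : fieldType) (n : nat) : set (seq bool) :=
  [set w | is_dyck n w /\
     exists A : falgType K, linear_nakayama n A (area_sequence n w) /\ shod A].

Definition tilted_dyck (K : fieldType) (n : nat) : set (seq bool) :=
  [set w | is_dyck n w /\
     exists A : falgType K, linear_nakayama n A (area_sequence n w) /\ tilted A].

(* Permutations of {1, ..., n} are elements of 'S_n, with values shifted by 1;
   a pattern is given by its one-line word. *)

Definition contains_pattern (sigma : seq nat) (n : nat) (s : 'S_n) : Prop :=
  exists f : 'I_(size sigma) -> 'I_n,
    (forall a b : 'I_(size sigma), (a < b)%N -> (f a < f b)%N) /\
    (forall a b : 'I_(size sigma), (s (f a) < s (f b))%N =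
       (nth 0%N sigma a < nth 0%N sigma b)%N).

Definition avoiding (n : nat) (sigma : seq nat) : set 'S_n :=
  [set s | ~ contains_pattern sigma s].

Arguments avoiding : clear implicits.

Definition one_line (n : nat) (s : 'S_n) : seq nat :=
  [seq (s i).+1 | i <- enum 'I_n].

(* Positions, counted from 0, of the left-to-right minima of w. *)
Definition lrmin_positions (w : seq nat) : seq nat :=
  [seq i <- iota 0 (size w) |
     all (fun j => nth 0 w i < nth 0 w j)%N (iota 0 i)].

(* [lrmin w i] is m_i, with m_0 = size w + 1, and [lrgap w i] is |w_i|. *)
Definition lrmin (w : seq nat) (i : nat) : nat :=
  if i is i'.+1 then nth 0%N w (nth 0%N (lrmin_positions w) i') else (size w).+1.

Definition lrgap (w : seq nat) (i : nat) : nat :=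
  (nth (size w) (lrmin_positions w) i
   - (nth (size w) (lrmin_positions w) i.-1).+1)%N.

Definition krattenthaler_word (w : seq nat) : seq bool :=
  flatten [seq nseq (lrgap w i).+1 true ++ nseq (lrmin w i.-1 - lrmin w i) false
          | i <- rev (iota 1 (size (lrmin_positions w)))].

Definition krattenthaler (n : nat) (s : 'S_n) : seq bool :=
  krattenthaler_word (one_line s).

(* Main.v *)
(* Write e i = c_i + i for the Kupisch series c of A. Then A consists of the
   matrices supported on the pairs i <= j < e i, with the product truncated to this
   support, and its minimal relations are the valleys of the Dyck path.

   The indecomposable A-modules are the intervals [a, b[ with b <= e a; such a
   module has projective dimension at least 2 if and only if b < e a < e b, and
   dually for the injective dimension. So A is shod if and only if the path has at
   most two valleys and, if there are two, they are separated by a single up-step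
   or by a single down-step.

   If A = End_H(T) with T tilting over a hereditary H, then the nonzero canonical
   maps between indecomposable summands of T are injective or surjective (Happel
   and Ringel), which two relations would contradict. Conversely, if A has at most
   one relation, it is the endomorphism algebra of an explicit tilting module over
   the path algebra of a rooted tree. So A is tilted if and only if the path has at
   most one valley.

   Finally the peaks of the path of a permutation correspond to its left-to-right
   minima. A 132-avoiding permutation is increasing between consecutive minima;
   it avoids 321 if and only if it has at most two minima, and it avoids 4321 and
   4231 if and only if it has at most three and, if there are three, then the
   middle run is a single letter or the first two minima are consecutive
   integers. *)

Require Import Defs.
From HB Require Import structures.
From mathcomp Require Import all_boot all_order all_fingroup all_algebra all_field.
From mathcomp Require Import classical_sets functions.
From mathcomp Require Import zify.

Set Implicit Arguments.
Unset Strict Implicit.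
Unset Printing Implicit Defensive.

(* The name is also used for group actions in MathComp. *)
Local Notation ract := Defs.ract.

Import GRing.Theory.
Local Open Scope ring_scope.

(** * Modules over algebras of truncated matrices *)

(** Algebras, modules and the tilting bimodule are all spaces of matrices with prescribed support,
    multiplied with truncation. Ring and module axioms, exactness and compatibility with the action
    then become implications between supports, that is, linear inequalities between vertices. A
    linear Nakayama algebra is given as an abstract quotient of the path algebra, so one first has
    to show that its Kupisch series forces such coordinates: necessity is argued on an arbitrary
    algebra with the series, sufficiency on a constructed one. The resolutions in the definition of
    the dimensions are arbitrary and not minimal. Lower bounds are therefore proved by following a
    single element through a given resolution, using only lifting and extension properties. In the
    same way the Happel-Ringel argument works with elements of a free cover and with explicit
    push-outs. For surjectivity no general inverse of the bijection is built: a shod path has at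
    most three runs, and one family of permutations with four parameters reaches all of these
    paths. *)

Section LinearMaps.
Variables (K : fieldType) (U V : vectType K).

Definition lfun_of (f : U -> V) (lf : linear f) : 'Hom(U, V) :=
  linfun (HB.pack_for {linear U -> V} f (GRing.isLinear.Build K U V *:%R f lf)).

Lemma lfun_ofE f lf u : @lfun_of f lf u = f u.
Proof. by rewrite lfunE. Qed.

Lemma lfun_eq0P (f : 'Hom(U, V)) :
  reflect (forall u, f u = 0 -> u = 0) (lker f == 0%VS).
Proof.
apply: (iffP lker0P) => [f_inj u fu0 | f0 u v fuv].
  by apply: f_inj; rewrite fu0 linear0.
by apply/eqP; rewrite -subr_eq0; apply/eqP/f0; rewrite linearB /= fuv subrr.
Qed.

Lemma limg_fullP (f : 'Hom(U, V)) :
  reflect (forall v, exists u, f u = v) (limg f == fullv).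
Proof.
apply: (iffP eqP) => [imf v | surj].
  have: v \in limg f by rewrite imf memvf.
  by case/memv_imgP=> u _ ->; exists u.
by apply/vspaceP=> v; have [u <-] := surj v; rewrite memvf memv_img ?memvf.
Qed.

Lemma limg_full_invK (f : 'Hom(U, V)) : limg f = fullv -> cancel f^-1%VF f.
Proof. by move=> imf v; rewrite limg_lfunVK // imf memvf. Qed.

End LinearMaps.

Lemma exists_functional (K : fieldType) (V : vectType K) (v : V) :
  v != 0 -> exists t : 'Hom(V, K^o), t v = 1.
Proof.
move=> v_neq0; have flin : linear (fun k : K^o => k *: v).
  by move=> k a b; rewrite scalerDl scalerA.
pose f := @lfun_of K K^o V _ flin.
have kf : lker f == 0%VS.
  apply/lfun_eq0P=> a; rewrite lfun_ofE => /eqP.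
  by rewrite scaler_eq0 (negPf v_neq0) orbF => /eqP.
by exists f^-1%VF; have := lker0_lfunK kf 1; rewrite lfun_ofE scale1r.
Qed.

(* Matrices with prescribed support; the product of two of them is truncated
   to the support required of the result. This one operation models the
   product of all algebras and the action on all modules below. *)
Section Masks.
Variables (K : fieldType) (m n : nat) (W : 'I_m -> 'I_n -> bool).
Implicit Types x : 'M[K]_(m, n).

Definition mxmask (x : 'M[K]_(m, n)) : 'M[K]_(m, n) :=
  \matrix_(i, j) (if W i j then x i j else 0).

Lemma mxmask_is_linear : linear mxmask.
Proof. by move=> k x y; apply/matrixP=> i j; rewrite !mxE; case: ifP; rewrite ?mulr0 ?addr0. Qed.
HB.instance Definition _ :=
  GRing.isLinear.Build K 'M[K]_(m, n) 'M[K]_(m, n) *:%R mxmask mxmask_is_linear.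

Lemma mxmaskE x i j : mxmask x i j = if W i j then x i j else 0.
Proof. by rewrite mxE. Qed.

Definition msupp : {vspace 'M[K]_(m, n)} := limg (linfun mxmask).

Lemma mxmask_id x : mxmask (mxmask x) = mxmask x.
Proof. by apply/matrixP=> i j; rewrite !mxE; case: (W i j). Qed.

Lemma msupp_mxmask x : mxmask x \in msupp.
Proof. by rewrite -[mxmask x](lfunE mxmask) memv_img ?memvf. Qed.

Lemma msupp_fixE x : (x \in msupp) = (mxmask x == x).
Proof.
apply/idP/eqP=> [/memv_imgP[y _ ->] | <-]; last exact: msupp_mxmask.
by rewrite !lfunE /= mxmask_id.
Qed.

Lemma msuppP x : reflect (forall i j, ~~ W i j -> x i j = 0) (x \in msupp).
Proof.
rewrite msupp_fixE; apply: (iffP eqP) => [<- i j | x0].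
  by rewrite mxE => /negPf->.
by apply/matrixP=> i j; rewrite mxE; case: ifPn => // /x0.
Qed.

Lemma msupp_neq0 x i j : x \in msupp -> x i j != 0 -> W i j.
Proof. by move/msuppP=> x0; apply: contraNT => /x0->. Qed.

Lemma mxmaskK x : x \in msupp -> mxmask x = x.
Proof. by rewrite msupp_fixE => /eqP. Qed.

Lemma mxmask_delta i j : W i j -> mxmask (delta_mx i j) = delta_mx i j.
Proof.
move=> Wij; apply/matrixP=> k l; rewrite !mxE; case: ifPn => // Wkl.
by case: eqP Wkl => [->|//]; case: eqP => [->|//]; rewrite Wij.
Qed.

Lemma dim_msupp : \dim msupp = #|[pred ij | W ij.1 ij.2]|.
Proof.
set P := [pred ij | W ij.1 ij.2].
pose D (ij : 'I_m * 'I_n) : 'M[K]_(m, n) := delta_mx ij.1 ij.2.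
pose X := map_tuple D (enum_tuple P).
have eX : msupp = <<X>>%VS.
  apply/eqP; rewrite eqEsubv; apply/andP; split; last first.
    apply/span_subvP=> x /mapP[[i j]]; rewrite mem_enum => Wij ->.
    by rewrite /D -(mxmask_delta Wij) msupp_mxmask.
  apply/subvP=> x /mxmaskK <-; rewrite [mxmask x]matrix_sum_delta.
  apply: memv_suml => i _; apply: memv_suml => j _; rewrite mxmaskE.
  case: ifP => [Wij | _]; last by rewrite scale0r mem0v.
  apply: memvZ; apply: memv_span; apply/mapP; exists (i, j) => //.
  by rewrite mem_enum.
have XE (i : 'I_#|P|) : X`_i = D (enum_val i).
  have x0 := enum_default i.
  by rewrite (nth_map x0) -?cardE // -enum_val_nth.
have fX : free X.
  apply/freeP=> c c0 t; move/matrixP/(_ (enum_val t).1 (enum_val t).2): c0.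
  rewrite summxE mxE (bigD1 t) //= big1 => [|u ne_ut].
    by rewrite addr0 XE !mxE !eqxx mulr1.
  rewrite XE !mxE -xpair_eqE -!surjective_pairing (inj_eq enum_val_inj).
  by rewrite eq_sym (negPf ne_ut) mulr0.
by rewrite eX; move/eqP: fX => ->; rewrite size_tuple.
Qed.

End Masks.

Arguments mxmask {K m n} W x.
Arguments msupp {K m n} W.
Arguments mxmask_delta {K m n W i j}.

(** Both sides expand into the terms [x i j * y j k * z k l], kept on the left when [U i k] and on
    the right when [V j l]; the hypothesis compares the two guards only where all three factors can
    be non-zero. Associativity of the algebras, the module axiom and the commutation of
    endomorphisms with the action are all instances. *)
Lemma mxmask_mulmxA (K : fieldType) (m n p q : nat)
    (X : 'I_m -> 'I_n -> bool) (Y : 'I_n -> 'I_p -> bool)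
    (Z : 'I_p -> 'I_q -> bool) (U : 'I_m -> 'I_p -> bool)
    (V : 'I_n -> 'I_q -> bool) (W : 'I_m -> 'I_q -> bool)
    (x : 'M[K]_(m, n)) (y : 'M[K]_(n, p)) (z : 'M[K]_(p, q)) :
    (forall i j k l, X i j -> Y j k -> Z k l -> W i l -> U i k = V j l) ->
    x \in msupp X -> y \in msupp Y -> z \in msupp Z ->
  mxmask W (mxmask U (x *m y) *m z) = mxmask W (x *m mxmask V (y *m z)).
Proof.
move=> UV sx sy sz; apply/matrixP=> i l; rewrite !mxmaskE.
case: ifP => // Wil; rewrite !mxE.
transitivity (\sum_k \sum_j (if U i k then x i j * y j k * z k l else 0)).
  apply: eq_bigr => k _; rewrite mxE; case: ifP => _.
    by rewrite mxE mulr_suml.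
  by rewrite mul0r big1.
rewrite exchange_big; apply: eq_bigr => j _ /=; rewrite mxE.
transitivity (\sum_k (if V j l then x i j * y j k * z k l else 0)); last first.
  case: ifP => _; last by rewrite mulr0 big1.
  by rewrite mxE mulr_sumr; apply: eq_bigr => k _; rewrite mulrA.
apply: eq_bigr => k _.
have [-> | xn0] := eqVneq (x i j) 0; first by rewrite !mul0r !if_same.
have [-> | yn0] := eqVneq (y j k) 0; first by rewrite mulr0 !mul0r !if_same.
have [-> | zn0] := eqVneq (z k l) 0; first by rewrite mulr0 !if_same.
by rewrite (UV i j k l) ?(msupp_neq0 sx) ?(msupp_neq0 sy) ?(msupp_neq0 sz).
Qed.

(** * General module theory: submodules, free covers, retracts *)

Section ModuleTheory.
Variables (K : fieldType) (A : falgType K).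
Implicit Types M N P Q T X Y Z E : rmodule A.

Fact ract_is_linear M a : linear (fun u : M => ract u a).
Proof. exact: ract_linearl. Qed.
Definition ractl M (a : A) : 'Hom(M, M) := lfun_of (@ract_is_linear M a).
Lemma ractlE M a u : ractl M a u = ract u a.
Proof. exact: lfun_ofE. Qed.

Fact ractr_is_linear M (u : M) : linear (ract u).
Proof. by move=> k a b; apply: ract_linearr. Qed.
Definition ractr M (u : M) : 'Hom(A, M) := lfun_of (ractr_is_linear u).
Lemma ractrE M (u : M) a : ractr u a = ract u a.
Proof. exact: lfun_ofE. Qed.

Lemma ractDl M (u v : M) a : ract (u + v) a = ract u a + ract v a.
Proof. by rewrite -!ractlE linearD. Qed.
Lemma ractBl M (u v : M) a : ract (u - v) a = ract u a - ract v a.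
Proof. by rewrite -!ractlE linearB. Qed.
Lemma ractZl M k (u : M) a : ract (k *: u) a = k *: ract u a.
Proof. by rewrite -!ractlE linearZ. Qed.
Lemma ract0l M a : ract (0 : M) a = 0.
Proof. by rewrite -ractlE linear0. Qed.
Lemma ract_suml M (I : Type) (r : seq I) (P : pred I) (F : I -> M) a :
  ract (\sum_(i <- r | P i) F i) a = \sum_(i <- r | P i) ract (F i) a.
Proof. by rewrite -ractlE linear_sum; apply: eq_bigr => i _ /=; rewrite ractlE. Qed.
Lemma ractZr M (u : M) k a : ract u (k *: a) = k *: ract u a.
Proof. by rewrite -!ractrE linearZ. Qed.
Lemma ract0r M (u : M) : ract u 0 = 0.
Proof. by rewrite -ractrE linear0. Qed.
Lemma ract_sumr M (u : M) (I : Type) (r : seq I) (P : pred I) (F : I -> A) :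
  ract u (\sum_(i <- r | P i) F i) = \sum_(i <- r | P i) ract u (F i).
Proof. by rewrite -ractrE linear_sum; apply: eq_bigr => i _ /=; rewrite ractrE. Qed.

Lemma rhom_id M : is_rhom (\1%VF : 'Hom(M, M)).
Proof. by move=> u a; rewrite !id_lfunE. Qed.
Lemma rhom0 M N : is_rhom (0 : 'Hom(M, N)).
Proof. by move=> u a; rewrite !zero_lfunE ract0l. Qed.
Lemma rhom_comp M N P (g : 'Hom(N, P)) (f : 'Hom(M, N)) :
  is_rhom g -> is_rhom f -> is_rhom (g \o f)%VF.
Proof. by move=> hg hf u a; rewrite !comp_lfunE hf hg. Qed.

Section Submodule.
Variables (M : rmodule A) (U : {vspace M}).
Hypothesis stableU : forall u a, u \in U -> ract u a \in U.

Definition sub_act (u : subvs_of U) a : subvs_of U := vsproj U (ract (vsval u) a).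

Fact sub_actE u a : vsval (sub_act u a) = ract (vsval u) a.
Proof. by rewrite vsprojK // stableU // subvsP. Qed.

Fact sub_linearl a k u v : sub_act (k *: u + v) a = k *: sub_act u a + sub_act v a.
Proof. by apply: subvs_inj; rewrite linearP /= !sub_actE linearP /= ract_linearl. Qed.
Fact sub_linearr u k a b : sub_act u (k *: a + b) = k *: sub_act u a + sub_act u b.
Proof. by apply: subvs_inj; rewrite linearP /= !sub_actE ract_linearr. Qed.
Fact sub_act1 u : sub_act u 1 = u.
Proof. by apply: subvs_inj; rewrite sub_actE ract1. Qed.
Fact sub_actM u a b : sub_act u (a * b) = sub_act (sub_act u a) b.
Proof. by apply: subvs_inj; rewrite !sub_actE ractM. Qed.

Definition sub_rmodule : rmodule A :=
  @RModule K A (subvs_of U) sub_act sub_linearl sub_linearr sub_act1 sub_actM.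

Definition sub_incl : 'Hom(sub_rmodule, M) := linfun vsval.
Lemma sub_inclE (u : sub_rmodule) : sub_incl u = vsval u.
Proof. by rewrite lfunE. Qed.
Lemma rhom_sub_incl : is_rhom sub_incl.
Proof. by move=> u a; rewrite !sub_inclE sub_actE. Qed.
Lemma lker_sub_incl : lker sub_incl = 0%VS.
Proof.
by apply/eqP/lfun_eq0P => u; rewrite sub_inclE => u0; apply: subvs_inj; rewrite u0 linear0.
Qed.
Lemma limg_sub_incl : limg sub_incl = U.
Proof.
apply/vspaceP=> v; apply/memv_imgP/idP=> [[u _ ->]|vU]; first by rewrite sub_inclE subvsP.
by exists (vsproj U v); rewrite ?memvf // sub_inclE vsprojK.
Qed.

Lemma rhom_lift_sub N (f : 'Hom(N, M)) :
    is_rhom f -> (limg f <= U)%VS ->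
  exists g : 'Hom(N, sub_rmodule), is_rhom g /\ forall u, vsval (g u) = f u.
Proof.
move=> hf fU.
have gE u : vsval ((linfun (vsproj U) \o f)%VF u) = f u.
  by rewrite comp_lfunE lfunE vsprojK // (subvP fU) ?memv_img ?memvf.
exists (linfun (vsproj U) \o f)%VF; split=> // u a.
by apply: subvs_inj; rewrite sub_actE !gE hf.
Qed.

End Submodule.

Lemma stable_lker M N (f : 'Hom(M, N)) : is_rhom f ->
  forall u a, u \in lker f -> ract u a \in lker f.
Proof. by move=> hf u a; rewrite !memv_ker hf => /eqP->; rewrite ract0l. Qed.

Lemma stable_limg M N (f : 'Hom(M, N)) : is_rhom f ->
  forall u a, u \in limg f -> ract u a \in limg f.
Proof. by move=> hf _ a /memv_imgP[u _ ->]; rewrite -hf memv_img ?memvf. Qed.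

Lemma short_exact_ker M N (f : 'Hom(M, N)) (hf : is_rhom f) :
  limg f = fullv -> short_exact (sub_incl (stable_lker hf)) f.
Proof.
by move=> surj; split; rewrite ?lker_sub_incl ?limg_sub_incl //; apply: rhom_sub_incl.
Qed.

Definition zero_rmodule : rmodule A := power_rmodule (regular_rmodule A) 0.

Lemma zero_rmodule_eq0 (u : zero_rmodule) : u = 0.
Proof. by apply/ffunP=> -[]. Qed.

Lemma projective_zero : projective zero_rmodule.
Proof.
move=> M N g f _ _ _; exists 0; split; first exact: rhom0.
by apply/lfunP=> u; rewrite (zero_rmodule_eq0 u) !linear0.
Qed.
Lemma injective_zero : injective_module zero_rmodule.
Proof.
move=> M N g f _ _ _; exists 0; split; first exact: rhom0.
by apply/lfunP=> u; rewrite [LHS]zero_rmodule_eq0 [RHS]zero_rmodule_eq0.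
Qed.

Lemma projective_pdim_le1 X : projective X -> pdim_le 1 X.
Proof.
move=> pX; exists X, zero_rmodule, 0, \1%VF; split=> //; last exact: projective_zero.
split; [exact: rhom0 | exact: rhom_id | | |].
- by apply/eqP/lfun_eq0P=> u _; apply: zero_rmodule_eq0.
- apply/vspaceP=> u; rewrite memv_ker id_lfunE; apply/memv_imgP/eqP=> [[v _ ->]| ->].
    by rewrite zero_lfunE.
  by exists 0; rewrite ?memvf ?linear0.
- by apply/eqP/limg_fullP=> u; exists u; rewrite id_lfunE.
Qed.

Lemma injective_idim_le1 X : injective_module X -> idim_le 1 X.
Proof.
move=> iX; exists X, zero_rmodule, \1%VF, 0; split=> //; last exact: injective_zero.
split; [exact: rhom_id | exact: rhom0 | | |].
- by apply/eqP/lfun_eq0P=> u; rewrite id_lfunE.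
- apply/vspaceP=> u; rewrite memv_ker zero_lfunE eqxx; apply/memv_imgP.
  by exists u; rewrite ?memvf ?id_lfunE.
- by apply/eqP/limg_fullP=> u; exists 0; rewrite zero_lfunE [RHS]zero_rmodule_eq0.
Qed.

Lemma projective_free m : projective (power_rmodule (regular_rmodule A) m).
Proof.
move=> M N g f hg /eqP/limg_fullP surj hf.
pose d i : power_rmodule (regular_rmodule A) m := [ffun j => (j == i)%:R].
have /fin_all_exists[w wE] i : exists w, g w = f (d i) by apply: surj.
have hlin : linear (fun u : power_rmodule (regular_rmodule A) m =>
                      \sum_i ract (w i) (u i)).
  move=> k u v; rewrite scaler_sumr -big_split; apply: eq_bigr => i _ /=.
  by rewrite !ffunE ract_linearr.
exists (lfun_of hlin); split.
  move=> u a; rewrite !lfun_ofE ract_suml; apply: eq_bigr => i _.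
  by rewrite -ractM /= ffunE.
apply/lfunP=> u; rewrite comp_lfunE lfun_ofE linear_sum /=.
have {2}-> : u = \sum_i ract (d i) (u i).
  apply/ffunP=> j; rewrite sum_ffunE (bigD1 j) //= big1 => [|i ne_ij].
    by rewrite !ffunE /= eqxx mul1r addr0.
  by rewrite !ffunE /= eq_sym (negPf ne_ij) mul0r.
by rewrite linear_sum; apply: eq_bigr => i _ /=; rewrite hg wE hf.
Qed.

Lemma free_cover M : exists m (g : 'Hom(power_rmodule (regular_rmodule A) m, M)),
  is_rhom g /\ limg g = fullv.
Proof.
pose F := power_rmodule (regular_rmodule A) (\dim {:M}).
have glin : linear (fun u : F => \sum_(i < \dim {:M}) ract (vbasis {:M})`_i (u i)).
  move=> k u v; rewrite scaler_sumr -big_split; apply: eq_bigr => i _ /=.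
  by rewrite !ffunE ract_linearr.
exists (\dim {:M}), (lfun_of glin); split=> [u a|].
  rewrite !lfun_ofE ract_suml; apply: eq_bigr => i _.
  by rewrite -ractM /= ffunE.
apply/eqP/limg_fullP=> v.
exists [ffun i => (coord (vbasis {:M}) i v)%:A]; rewrite lfun_ofE.
rewrite [RHS](coord_vbasis (memvf v)); apply: eq_bigr => i _.
by rewrite ffunE ractZr ract1.
Qed.

Lemma hereditary_pdim_le1 M : hereditary A -> pdim_le 1 M.
Proof.
move=> hA; have [m [g [hg surj]]] := free_cover M.
exists (power_rmodule (regular_rmodule A) m), (sub_rmodule (stable_lker hg)),
  (sub_incl (stable_lker hg)), g.
split; [exact: projective_free | exact: short_exact_ker |].
apply: (hA _ _ (sub_incl (stable_lker hg))).
- exact: projective_free.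
- exact: rhom_sub_incl.
- exact: lker_sub_incl.
Qed.

Lemma isomorphic_sym M N : isomorphic M N -> isomorphic N M.
Proof.
case=> f [hf /eqP kf /eqP imf]; exists f^-1%VF.
have fK := lker0_lfunK kf; have fVK := limg_full_invK (eqP imf).
split.
- by move=> u a; apply: (can_inj fK) => /=; rewrite fVK hf fVK.
- by apply/eqP/lfun_eq0P=> u /(congr1 f); rewrite fVK linear0.
- by apply/eqP/limg_fullP=> u; exists (f u); rewrite fK.
Qed.

Lemma pdim_le1_iso M N : isomorphic M N -> pdim_le 1 M -> pdim_le 1 N.
Proof.
case=> f [hf /eqP kf /eqP imf] [P [Y [i [p [pP [hi hp ki ip imp]] pY]]]].
exists P, Y, i, (f \o p)%VF; split=> //; split=> //; first exact: rhom_comp.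
  rewrite ip; apply/vspaceP=> u; rewrite !memv_ker comp_lfunE.
  by rewrite -(linear0 f) (inj_eq (lker0P kf)).
apply/eqP/limg_fullP=> v; have /limg_fullP/(_ v)[w <-] := imf.
by have /eqP/limg_fullP/(_ w)[u <-] := imp; exists u; rewrite comp_lfunE.
Qed.

Lemma idim_le1_iso M N : isomorphic M N -> idim_le 1 M -> idim_le 1 N.
Proof.
move/isomorphic_sym; case=> f [hf /eqP kf /eqP imf] [P [Y [i [p [pP [hi hp ki ip imp]] pY]]]].
exists P, Y, (i \o f)%VF, p; split=> //; split=> //; first exact: rhom_comp.
  apply/eqP/lfun_eq0P=> u; rewrite comp_lfunE => /(lfun_eq0P _ (introT eqP ki)).
  exact: lfun_eq0P kf u.
rewrite -ip; apply/vspaceP=> v; apply/memv_imgP/memv_imgP=> [[u _ ->]|[u _ ->]].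
  by exists (f u); rewrite ?memvf ?comp_lfunE.
by have /limg_fullP/(_ u)[w <-] := imf; exists w; rewrite ?memvf ?comp_lfunE.
Qed.

(** The complement is the kernel of [r]. The second clause serves indecomposable [N]: once the
    complement is known to vanish, [r] itself is an isomorphism. *)
Lemma retract_split M N (i : 'Hom(M, N)) (r : 'Hom(N, M)) :
    is_rhom i -> is_rhom r -> (forall u, r (i u) = u) ->
  exists Y, isomorphic N (dsum_rmodule M Y) /\
    (is_zero Y -> isomorphic N M).
Proof.
move=> hi hr ri; pose Y := sub_rmodule (stable_lker hr); exists Y.
have kerP v : v - i (r v) \in lker r by rewrite memv_ker linearB /= ri subrr.
have flin : linear (fun v : N => (r v, vsproj (lker r) (v - i (r v))) : dsum_rmodule M Y).
  move=> k u v; congr (_, _); rewrite linearP //= linearP /= opprD addrACA -scalerBr.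
  by rewrite linearP.
split; last first.
  move=> Y0; exists r; split=> //; last by apply/eqP/limg_fullP=> u; exists (i u).
  apply/eqP/lfun_eq0P=> v rv0; have vk : v \in lker r by rewrite memv_ker rv0.
  rewrite -(vsprojK vk); have: vsproj (lker r) v \in (fullv : {vspace Y}) by apply: memvf.
  by rewrite Y0 memv0 => /eqP->; rewrite linear0.
exists (lfun_of flin); split.
- move=> v a; rewrite !lfun_ofE; apply: (congr2 pair); first exact: hr.
  apply: subvs_inj; rewrite (sub_actE (stable_lker hr)).
  by rewrite [LHS](vsprojK (kerP _)) (vsprojK (kerP v)) hr hi ractBl.
- apply/eqP/lfun_eq0P=> v; rewrite lfun_ofE => -[rv0 /(congr1 vsval)].
  rewrite (vsprojK (kerP v)) rv0 [i 0]linear0 subr0 => ->; exact: linear0.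
- apply/eqP/limg_fullP=> -[u y]; exists (i u + vsval y); rewrite lfun_ofE.
  have /eqP ry : r (vsval y) == 0 by rewrite -memv_ker subvsP.
  by rewrite linearD /= ri ry addr0 addrAC subrr add0r vsvalK.
Qed.

Lemma retract_in_add T X m (i : 'Hom(X, power_rmodule T m))
    (r : 'Hom(power_rmodule T m, X)) :
  is_rhom i -> is_rhom r -> (forall u, r (i u) = u) -> in_add T X.
Proof.
move=> hi hr ri; have [Y [isoY _]] := retract_split hi hr ri.
by exists m, Y; apply: isomorphic_sym.
Qed.

End ModuleTheory.

(* [phi] identifies A with the matrices supported on R, multiplied with
   truncation to R. *)
Definition support_algebra (K : fieldType) (n : nat) (A : falgType K)
    (R : 'I_n.+1 -> 'I_n.+1 -> bool) (phi : 'Hom(A, 'M[K]_n.+1)) : Prop :=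
  [/\ lker phi = 0%VS, limg phi = msupp R, phi 1 = 1%:M &
      forall a b, phi (a * b) = mxmask R (phi a *m phi b)].

(** This is the hypothesis of [mxmask_mulmxA] under which the matrices supported on [S] form a right
    module over the truncated matrices on [R]. For [S = R] it yields associativity of the truncated
    product. *)
Definition convex_for (n m : nat) (R : 'I_n.+1 -> 'I_n.+1 -> bool)
    (S : 'I_m -> 'I_n.+1 -> bool) : Prop :=
  forall i j k l, S i j -> R j k -> R k l -> S i l -> S i k = R j l.

Section SupportAlgebra.
Variables (K : fieldType) (n : nat) (A : falgType K).
Variables (R : 'I_n.+1 -> 'I_n.+1 -> bool) (phi : 'Hom(A, 'M[K]_n.+1)).
Hypothesis Aphi : support_algebra R phi.
Implicit Types M N : rmodule A.

Lemma phi_inj : injective phi.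
Proof. by case: Aphi => /eqP/lker0P. Qed.

Lemma phi_supp a : phi a \in msupp R.
Proof. by case: Aphi => _ <- _ _; rewrite memv_img ?memvf. Qed.

Lemma phiM a b : phi (a * b) = mxmask R (phi a *m phi b).
Proof. by case: Aphi. Qed.

Lemma phi1 : phi 1 = 1%:M.
Proof. by case: Aphi. Qed.

Lemma supp_refl (i : 'I_n.+1) : R i i.
Proof.
by apply: (msupp_neq0 (phi_supp 1)); rewrite phi1 mxE eqxx oner_neq0.
Qed.

(* The path from i to j, or 0 unless R i j. *)
Definition pp (i j : 'I_n.+1) : A := phi^-1%VF (mxmask R (delta_mx i j)).

Lemma phi_invK x : x \in msupp R -> phi (phi^-1%VF x) = x.
Proof. by move=> sx; rewrite limg_lfunVK //; case: Aphi => _ ->. Qed.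

Lemma phi_pp i j : phi (pp i j) = mxmask R (delta_mx i j).
Proof. by rewrite phi_invK ?msupp_mxmask. Qed.

Lemma pp_out i j : ~~ R i j -> pp i j = 0.
Proof.
move=> nR; apply: phi_inj; rewrite phi_pp linear0; apply/matrixP=> k l.
rewrite !mxE; case: ifPn => // Rkl; case: andP => // -[/eqP ek /eqP el].
by rewrite -ek -el Rkl in nR.
Qed.

Lemma pp_neq0 i j : R i j -> pp i j != 0.
Proof.
move=> Rij; apply/eqP=> /(congr1 phi); rewrite phi_pp linear0.
by move/matrixP/(_ i j)/eqP; rewrite !mxE Rij !eqxx oner_eq0.
Qed.

Lemma pp_mul i j k : R i j -> R j k -> pp i j * pp j k = pp i k.
Proof.
move=> Rij Rjk; apply: phi_inj.
by rewrite phiM !phi_pp (mxmask_delta Rij) (mxmask_delta Rjk) mul_delta_mx.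
Qed.

Lemma pp_mul0 i j k l : j != k -> pp i j * pp k l = 0.
Proof.
move=> ne_jk; case: (boolP (R i j)) => [Rij | /pp_out->]; last by rewrite mul0r.
case: (boolP (R k l)) => [Rkl | /pp_out->]; last by rewrite mulr0.
apply: phi_inj; rewrite phiM !phi_pp !mxmask_delta // mul_delta_mx_0 //.
by rewrite !linear0.
Qed.

Lemma pp_expand a : a = \sum_i \sum_j phi a i j *: pp i j.
Proof.
apply: phi_inj; rewrite linear_sum [LHS]matrix_sum_delta; apply: eq_bigr => i _ /=.
rewrite linear_sum; apply: eq_bigr => j _ /=; rewrite linearZ /= phi_pp.
case: (boolP (R i j)) => [Rij | nR]; first by rewrite mxmask_delta.
by rewrite (msuppP _ _ (phi_supp a)) // !scale0r.
Qed.

Lemma pp_sum1 : \sum_i pp i i = 1.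
Proof.
rewrite [RHS]pp_expand; apply: eq_bigr => i _; rewrite (bigD1 i) //= big1 => [|j ne_ji].
  by rewrite phi1 !mxE eqxx scale1r addr0.
by rewrite phi1 !mxE eq_sym (negPf ne_ji) scale0r.
Qed.

(** Corners are at most one-dimensional. Hence two-sided ideals are spanned by paths, and in
    [not_tilted] the endomorphisms of each summand of the tilting module are scalars. *)
Lemma pp_corner i j b : pp i i * b * pp j j = phi b i j *: pp i j.
Proof.
rewrite {1}[b]pp_expand mulr_sumr mulr_suml (bigD1 i) //= [X in _ + X]big1 => [|k ne_k]; last first.
  rewrite mulr_sumr mulr_suml big1 // => l _.
  by rewrite -scalerAr -scalerAl pp_mul0 1?eq_sym // mul0r scaler0.
rewrite addr0 mulr_sumr mulr_suml (bigD1 j) //= [X in _ + X]big1 => [|l ne_l]; last first.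
  by rewrite -scalerAr -scalerAl -mulrA pp_mul0 // mulr0 scaler0.
rewrite addr0 -scalerAr -scalerAl; congr (_ *: _).
case: (boolP (R i j)) => [Rij | /pp_out->]; last by rewrite mulr0 mul0r.
by rewrite !pp_mul ?supp_refl.
Qed.

Lemma ract_sum1 M (u : M) : \sum_i ract u (pp i i) = u.
Proof. by rewrite -ract_sumr pp_sum1 ract1. Qed.

Lemma ract_pp M (u : M) i j k : R i j -> R j k ->
  ract (ract u (pp i j)) (pp j k) = ract u (pp i k).
Proof. by move=> Rij Rjk; rewrite -ractM pp_mul. Qed.

Lemma ract_pp0 M (u : M) i j k l : j != k ->
  ract (ract u (pp i j)) (pp k l) = 0.
Proof. by move=> ne_jk; rewrite -ractM pp_mul0 ?ract0r. Qed.

Lemma ract_ppid M (u : M) i j : ract (ract u (pp i j)) (pp j j) = ract u (pp i j).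
Proof.
case: (boolP (R i j)) => [Rij | /pp_out->]; last by rewrite !ract0r ract0l.
by rewrite ract_pp ?supp_refl.
Qed.

Lemma ract_idpp M (u : M) i j : ract (ract u (pp i i)) (pp i j) = ract u (pp i j).
Proof.
case: (boolP (R i j)) => [Rij | /pp_out->]; last by rewrite !ract0r.
by rewrite ract_pp ?supp_refl.
Qed.

Lemma rhom_pp M N (f : 'Hom(M, N)) :
    (forall u i j, R i j -> f (ract u (pp i j)) = ract (f u) (pp i j)) ->
  is_rhom f.
Proof.
move=> fpp u a; rewrite [a]pp_expand !ract_sumr linear_sum; apply: eq_bigr => i _ /=.
rewrite !ract_sumr linear_sum; apply: eq_bigr => j _ /=.
rewrite !ractZr linearZ /=; congr (_ *: _).
case: (boolP (R i j)) => [/fpp-> // | /pp_out->]; by rewrite !ract0r linear0.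
Qed.

Section ThinModule.
Variables (m : nat) (S : 'I_m -> 'I_n.+1 -> bool).
Hypothesis cS : convex_for R S.

(** Row [i] is a summand with support [S i], of dimension at most one at each vertex. One row gives
    an interval module; [n.+1] rows give the regular module or the tilting module with all its
    summands at once. *)
Definition thin_act (x : subvs_of (msupp S : {vspace 'M[K]_(m, n.+1)})) (a : A) :
    subvs_of (msupp S) := vsproj (msupp S) (mxmask S (vsval x *m phi a)).

Fact thin_actE x a : vsval (thin_act x a) = mxmask S (vsval x *m phi a).
Proof. by rewrite vsprojK // msupp_mxmask. Qed.

Fact thin_linearl a (k : K) x y : thin_act (k *: x + y) a = k *: thin_act x a + thin_act y a.
Proof.
by apply: subvs_inj; rewrite linearP /= !thin_actE linearP /= mulmxDl -scalemxAl linearP.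
Qed.
Fact thin_linearr x (k : K) a b : thin_act x (k *: a + b) = k *: thin_act x a + thin_act x b.
Proof.
apply: subvs_inj; rewrite linearP /= !thin_actE linearP /= mulmxDr -scalemxAr.
by rewrite linearP.
Qed.
Fact thin_act1 x : thin_act x 1 = x.
Proof. by apply: subvs_inj; rewrite thin_actE phi1 mulmx1 mxmaskK ?subvsP. Qed.
Fact thin_actM x a b : thin_act x (a * b) = thin_act (thin_act x a) b.
Proof.
apply: subvs_inj; rewrite !thin_actE phiM; symmetry.
by apply: mxmask_mulmxA (subvsP x) (phi_supp a) (phi_supp b); exact: cS.
Qed.

Definition thin_rmodule : rmodule A :=
  @RModule K A (subvs_of (msupp S)) thin_act thin_linearl thin_linearr
    thin_act1 thin_actM.

Definition thin_coef (x : thin_rmodule) : 'M[K]_(m, n.+1) := vsval x.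
Arguments thin_coef : simpl never.

Fact thin_coef_is_linear : linear thin_coef.
Proof. exact: linearP. Qed.
HB.instance Definition _ := GRing.isLinear.Build K thin_rmodule 'M[K]_(m, n.+1)
  *:%R thin_coef thin_coef_is_linear.

Lemma thin_coef_inj : injective thin_coef.
Proof. exact: subvs_inj. Qed.

Lemma thin_coef_supp x : thin_coef x \in msupp S.
Proof. exact: subvsP. Qed.

Lemma thin_coef0 (x : thin_rmodule) i j : ~~ S i j -> thin_coef x i j = 0.
Proof. by apply/msuppP; rewrite thin_coef_supp. Qed.

Definition thin_of (y : 'M[K]_(m, n.+1)) : thin_rmodule := vsproj (msupp S) (mxmask S y).

Lemma thin_ofE y : thin_coef (thin_of y) = mxmask S y.
Proof. by rewrite /thin_coef vsprojK ?msupp_mxmask. Qed.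

Fact thin_of_is_linear : linear thin_of.
Proof.
by move=> k x y; apply: thin_coef_inj; rewrite [RHS]linearP /= !thin_ofE linearP.
Qed.
HB.instance Definition _ := GRing.isLinear.Build K 'M[K]_(m, n.+1) thin_rmodule
  *:%R thin_of thin_of_is_linear.

Lemma thin_coefK : cancel thin_coef thin_of.
Proof. by move=> x; apply: thin_coef_inj; rewrite thin_ofE mxmaskK ?thin_coef_supp. Qed.

Lemma thin_coef_ract x a : thin_coef (ract x a) = mxmask S (thin_coef x *m phi a).
Proof. exact: thin_actE. Qed.

Lemma thin_coef_pp x k l i j : R k l ->
  thin_coef (ract x (pp k l)) i j = if S i j && (j == l) then thin_coef x i k else 0.
Proof.
move=> Rkl; rewrite thin_coef_ract mxE; case: (S i j) => //=.
rewrite phi_pp mxmask_delta // mxE (bigD1 k) //= big1 => [|k' ne_k].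
  by rewrite !mxE eqxx /=; case: eqP; rewrite ?mulr1 ?mulr0 addr0.
by rewrite !mxE (negPf ne_k) mulr0.
Qed.

Definition tb i j : thin_rmodule := thin_of (delta_mx i j).

Lemma tb_pp i j k : S i j -> R j k -> ract (tb i j) (pp j k) = tb i k.
Proof.
move=> Sij Rjk; apply: thin_coef_inj; apply/matrixP=> a b.
rewrite thin_coef_pp // !thin_ofE !mxE; case: (S a b) => //=.
rewrite eqxx andbT; case: (eqVneq a i) => [->|_] /=; last by rewrite !if_same.
by rewrite Sij; case: (b == k).
Qed.

Lemma tb_expand x : x = \sum_i \sum_j thin_coef x i j *: tb i j.
Proof.
apply: (can_inj thin_coefK); rewrite linear_sum [LHS]matrix_sum_delta.
apply: eq_bigr => i _ /=; rewrite linear_sum; apply: eq_bigr => j _ /=.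
rewrite linearZ /= thin_ofE; case: (boolP (S i j)) => [Sij | nS].
  by rewrite mxmask_delta.
by rewrite thin_coef0 // !scale0r.
Qed.

Section Generators.
Variables (M : rmodule A) (r : 'I_m -> 'I_n.+1).

(** Row [i] is generated at [r i], subject to the paths that leave the support; images [w i] killed
    by these paths therefore define a map. [w i] need not be concentrated at the vertex [r i], hence
    the idempotent in the conclusion. *)
Lemma rhom_from_generators (w : 'I_m -> M) :
    (forall i j, S i j -> R (r i) j) ->
    (forall i l, R (r i) l -> ~~ S i l -> ract (w i) (pp (r i) l) = 0) ->
  exists h : 'Hom(thin_rmodule, M), is_rhom h /\
    forall i, S i (r i) -> h (tb i (r i)) = ract (w i) (pp (r i) (r i)).
Proof.
move=> Sr w0.
have hlin : linear (fun x => \sum_i \sum_j thin_coef x i j *: ract (w i) (pp (r i) j)).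
  move=> k x y; rewrite scaler_sumr -big_split; apply: eq_bigr => i _ /=.
  rewrite scaler_sumr -big_split; apply: eq_bigr => j _ /=.
  by rewrite linearP !mxE scalerDl scalerA.
exists (lfun_of hlin); split=> [|i SS]; last first.
  rewrite lfun_ofE (bigD1 i) //= (bigD1 (r i)) //= !big1 ?addr0.
  - by rewrite thin_ofE mxE SS mxE !eqxx scale1r.
  - move=> i' ne_i; apply: big1 => j _.
    by rewrite thin_ofE !mxE (negPf ne_i) if_same scale0r.
  - by move=> j ne_j; rewrite thin_ofE !mxE (negPf ne_j) andbF if_same scale0r.
apply: rhom_pp => x k l Rkl; rewrite !lfun_ofE ract_suml; apply: eq_bigr => i _.
rewrite ract_suml (bigD1 l) //= big1 => [|j ne_jl]; last first.
  by rewrite thin_coef_pp // (negPf ne_jl) andbF scale0r.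
rewrite addr0 thin_coef_pp // eqxx andbT (bigD1 k) //= big1 => [|j ne_jk]; last first.
  by rewrite ractZl ract_pp0 // scaler0.
rewrite addr0 ractZl; case: (boolP (S i k)) => [Sik | nS]; last first.
  by rewrite thin_coef0 // if_same !scale0r.
rewrite ract_pp ?Sr //; case: ifPn => // nSil; rewrite scale0r.
case: (boolP (R (r i) l)) => [Rl | /pp_out->]; last by rewrite ract0r scaler0.
by rewrite w0 // scaler0.
Qed.

(** The dual construction: row [i] sits in the injective at [r i], and its coordinate at [j] is the
    functional [t i] applied after the path from [j] to [r i]. The functional has to kill the paths
    that start outside the support. *)
Lemma rhom_to_cogenerators (t : 'I_m -> 'Hom(M, K^o)) :
    (forall i j, S i j -> R j (r i)) ->
    (forall i l u, R l (r i) -> ~~ S i l -> t i (ract u (pp l (r i))) = 0) ->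
  exists h : 'Hom(M, thin_rmodule), is_rhom h /\
    forall u i j, thin_coef (h u) i j = if S i j then t i (ract u (pp j (r i))) else 0.
Proof.
move=> Sr t0.
have hlin : linear (fun u => thin_of (\matrix_(i, j) t i (ract u (pp j (r i))))).
  move=> k u v; rewrite -linearP; congr thin_of; apply/matrixP=> i j; rewrite !mxE.
  by rewrite ractDl ractZl linearP.
exists (lfun_of hlin).
have hE u i j : thin_coef (lfun_of hlin u) i j =
    if S i j then t i (ract u (pp j (r i))) else 0.
  by rewrite lfun_ofE thin_ofE !mxE.
split=> //; apply: rhom_pp => u k l Rkl; apply: thin_coef_inj; apply/matrixP=> i j.
rewrite thin_coef_pp // !hE; case: (boolP (S i j)) => //= Sij.
case: eqP => [ejl | /eqP ne_jl]; last by rewrite ract_pp0 1?eq_sym // linear0.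
rewrite ejl ract_pp -?ejl ?Sr //; last by rewrite ejl.
case: ifPn => // nSik.
case: (boolP (R k (r i))) => [Rk | /pp_out->]; last by rewrite ract0r linear0.
by rewrite t0.
Qed.

Lemma rhom_generators_eq (f g : 'Hom(thin_rmodule, M)) :
    (forall i j, S i j -> R (r i) j) -> (forall i j, S i j -> S i (r i)) ->
    is_rhom f -> is_rhom g -> (forall i, f (tb i (r i)) = g (tb i (r i))) ->
  f = g.
Proof.
move=> SR Sr hf hg fg; apply/lfunP=> x; rewrite [x]tb_expand !linear_sum.
apply: eq_bigr => i _ /=; rewrite !linear_sum; apply: eq_bigr => j _ /=.
rewrite !linearZ /=; case: (boolP (S i j)) => [Sij | nS]; last first.
  by rewrite thin_coef0 // !scale0r.
by rewrite -(@tb_pp i (r i) j) ?(Sr i j) ?SR // hf hg fg.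
Qed.

End Generators.

Lemma projective_thin (r : 'I_m -> 'I_n.+1) :
  (forall i j, S i j = R (r i) j) -> projective thin_rmodule.
Proof.
move=> Sr M N g f hg /eqP/limg_fullP surj hf.
have /fin_all_exists[w wE] i : exists w, g w = f (tb i (r i)) by apply: surj.
have [i j|i l Rl|h [hh hE]] := @rhom_from_generators M r w; first by rewrite Sr.
  by rewrite Sr Rl.
exists h; split=> //; apply: (@rhom_generators_eq N r).
- by move=> i j; rewrite Sr.
- by move=> i j; rewrite !Sr supp_refl.
- exact: rhom_comp.
- by [].
move=> i; have SS : S i (r i) by rewrite Sr supp_refl.
by rewrite comp_lfunE hE // hg wE -hf tb_pp ?supp_refl.
Qed.

(** The functional on [N] is the coordinate of [f] at [r i], transported along a left inverse of [g]
    that is merely linear; [rhom_to_cogenerators] turns it into a homomorphism. *)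
Lemma injective_thin (r : 'I_m -> 'I_n.+1) :
  (forall i j, S i j = R j (r i)) -> injective_module thin_rmodule.
Proof.
move=> Sr M N g f hg /eqP kerg hf.
have tlin i : linear (fun u => thin_coef (f (g^-1%VF u)) i (r i) : K^o).
  by move=> k u v; rewrite !linearP !mxE.
have [i j|i l u Rl|h [hh hE]] := @rhom_to_cogenerators N r (fun i => lfun_of (tlin i)).
- by rewrite Sr.
- by rewrite Sr Rl.
exists h; split=> //; apply/lfunP=> u; apply: thin_coef_inj; apply/matrixP=> i j.
rewrite comp_lfunE hE; case: ifPn => [Sij | nS]; last by rewrite thin_coef0.
have Rj : R j (r i) by rewrite -Sr.
by rewrite lfun_ofE -hg lker0_lfunK // hf thin_coef_pp // eqxx andbT Sr supp_refl.
Qed.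

End ThinModule.
Arguments thin_coef {m S cS} x : simpl never.

Section ThinMaps.
Variables (m : nat) (S S' : 'I_m -> 'I_n.+1 -> bool).
Hypotheses (cS : convex_for R S) (cS' : convex_for R S').

Definition thin_map : 'Hom(thin_rmodule cS, thin_rmodule cS') :=
  linfun (@thin_of m S' cS' \o @thin_coef m S cS).

Lemma thin_mapE x : thin_coef (thin_map x) = mxmask S' (thin_coef x).
Proof. by rewrite lfunE /= thin_ofE. Qed.

Lemma rhom_thin_map :
  (forall i j k, S i j -> R j k -> S' i k -> S i k = S' i j) -> is_rhom thin_map.
Proof.
move=> SS'; apply: rhom_pp => x k l Rkl; apply: thin_coef_inj; apply/matrixP=> i j.
rewrite thin_coef_pp // !thin_mapE !mxE thin_coef_pp //.
case: (boolP (S' i j)) => //= S'ij; case: eqP => [e|]; last by rewrite andbF.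
rewrite andbT; case: (boolP (S i k)) => [Sik | nS].
  by rewrite (SS' i k j) // e.
by rewrite thin_coef0 // !if_same.
Qed.

End ThinMaps.

(** By the third condition [S1] is closed under paths inside [S], so it supports a submodule, and
    [S2] the quotient. The resolutions of intervals and the sequence in [tilt_tilting] have this
    form. *)
Lemma short_exact_thin (m : nat) (S1 S S2 : 'I_m -> 'I_n.+1 -> bool)
    (c1 : convex_for R S1) (cS : convex_for R S) (c2 : convex_for R S2) :
    (forall i j, S i j = S1 i j || S2 i j) ->
    (forall i j, S1 i j -> ~~ S2 i j) ->
    (forall i j k, S1 i j -> R j k -> S i k -> S1 i k) ->
  short_exact (thin_map c1 cS) (thin_map cS c2).
Proof.
move=> SU SD Scl; split.
- apply: rhom_thin_map => i j k S1j Rjk Sk.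
  by rewrite (Scl i j) // SU S1j.
- apply: rhom_thin_map => i j k Sj Rjk S2k; rewrite SU S2k orbT; symmetry.
  move: (Sj); rewrite SU => /orP[S1j | -> //].
  by have := SD i k (Scl i j k S1j Rjk _); rewrite S2k SU S2k orbT => /(_ isT).
- apply/eqP/lfun_eq0P=> x /(congr1 thin_coef) /matrixP x0.
  apply: thin_coef_inj; apply/matrixP=> i j; rewrite linear0 mxE.
  case: (boolP (S1 i j)) => [S1ij | nS]; last by rewrite thin_coef0.
  by have := x0 i j; rewrite thin_mapE linear0 !mxE SU S1ij.
- apply/vspaceP=> x; rewrite memv_ker; apply/memv_imgP/eqP=> [[y _ ->]|x0].
    apply: thin_coef_inj; apply/matrixP=> i j; rewrite !thin_mapE linear0 !mxE.
    case: ifPn => // S2ij; rewrite thin_coef0 ?if_same //.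
    by apply: contraL S2ij; apply: SD.
  exists (thin_map cS c1 x); rewrite ?memvf //; apply: thin_coef_inj.
  apply/matrixP=> i j; rewrite !thin_mapE !mxE; case: ifPn => Sij; last first.
    by rewrite thin_coef0.
  case: ifPn => // nS1; move/(congr1 thin_coef)/matrixP/(_ i j): x0.
  by rewrite thin_mapE linear0 !mxE; move: Sij; rewrite SU (negPf nS1) /= => ->.
apply/eqP/limg_fullP=> y; exists (thin_map c2 cS y); apply: thin_coef_inj.
apply/matrixP=> i j; rewrite !thin_mapE !mxE; case: ifPn => S2ij.
  by rewrite SU S2ij orbT.
by rewrite thin_coef0.
Qed.

End SupportAlgebra.

Arguments thin_coef {K n A R phi Aphi m S cS} x : simpl never.

(** * Linear Nakayama algebras *)

Lemma eq_mxmask (K : fieldType) (m n : nat) (W W' : 'I_m -> 'I_n -> bool) :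
  (forall i j, W i j = W' i j) -> mxmask W =1 mxmask W' :> ('M[K]_(m, n) -> _).
Proof. by move=> eW x; apply/matrixP=> i j; rewrite !mxE eW. Qed.

Lemma eq_msupp (K : fieldType) (m n : nat) (W W' : 'I_m -> 'I_n -> bool) :
  (forall i j, W i j = W' i j) -> msupp W = msupp W' :> {vspace 'M[K]_(m, n)}.
Proof. by move=> eW; apply/vspaceP=> x; rewrite !msupp_fixE (eq_mxmask eW). Qed.

Lemma eq_support_algebra (K : fieldType) (n : nat) (A : falgType K)
    (R R' : 'I_n.+1 -> 'I_n.+1 -> bool) (phi : 'Hom(A, 'M[K]_n.+1)) :
  (forall i j, R i j = R' i j) -> support_algebra R phi -> support_algebra R' phi.
Proof.
move=> eR [ker im one mul]; split=> //; first by rewrite im; apply: eq_msupp.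
by move=> a b; rewrite mul (eq_mxmask eR).
Qed.

Lemma dim_right_ideal (K : fieldType) (n : nat) (A : falgType K)
    (R : 'I_n.+1 -> 'I_n.+1 -> bool) (phi : 'Hom(A, 'M[K]_n.+1)) (k : 'I_n.+1) :
  support_algebra R phi ->
  \dim (<[pp R phi k k]> * fullv)%VS = #|[pred l | R k l]|.
Proof.
move=> Aphi; pose Rk i j := (i == k) && R i j.
have Rkk := supp_refl Aphi k.
have phi_kM b : phi (pp R phi k k * b) = mxmask Rk (phi b).
  rewrite (phiM Aphi) (phi_pp Aphi) (mxmask_delta Rkk); apply/matrixP=> i j.
  rewrite !mxE /Rk (bigD1 k) //= big1 => [|l ne_l]; last first.
    by rewrite mxE (negPf ne_l) andbF mul0r.
  by rewrite mxE eqxx andbT addr0; case: eqP => [->|_]; rewrite ?mul1r // mul0r if_same.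
transitivity (\dim (phi @: (<[pp R phi k k]> * fullv))%VS).
  symmetry; apply: limg_dim_eq; have [-> _ _ _] := Aphi; exact: capv0.
have ->: (phi @: (<[pp R phi k k]> * fullv))%VS = msupp Rk.
  apply/eqP; rewrite eqEsubv; apply/andP; split; apply/subvP=> x.
    case/memv_imgP=> u uP ->; suff: (<[pp R phi k k]> * fullv <= phi @^-1: msupp Rk)%VS.
      by move/subvP/(_ u uP); rewrite -memv_preim.
    apply/prodvP=> _ b /vlineP[c ->] _; rewrite -memv_preim -scalerAl linearZ /=.
    by rewrite memvZ // phi_kM msupp_mxmask.
  move=> xk; have xR : x \in msupp R.
    apply/msuppP=> i j nR; apply: (msuppP _ _ xk).
    by rewrite negb_and nR orbT.
  rewrite -(mxmaskK xk) -(phi_invK Aphi xR) -phi_kM memv_img // memv_mul ?memvf //.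
  exact: memv_line.
have k_inj : injective (fun l : 'I_n.+1 => (k, l)) by move=> l l' [].
rewrite dim_msupp -(card_imset [pred l | R k l] k_inj).
apply: eq_card => -[i j]; rewrite !inE /Rk /=.
apply/andP/imsetP=> [[/eqP-> Rkj]|[l]]; first by exists j.
by rewrite inE => Rkl [-> ->]; rewrite eqxx.
Qed.

(** * The path algebra in matrix coordinates *)

Section PathAlgebra.
Variables (K : fieldType) (n : nat).
Local Notation KQ := (pathalg K n).
Local Notation leR := (fun i j : 'I_n.+1 => (i <= j)%N).

Lemma sum_lpath (V : nmodType) (G : 'I_n.+1 -> 'I_n.+1 -> V) :
  \sum_(p : lpath n) G (psource p) (ptarget p) =
  \sum_(i < n.+1) \sum_(j < n.+1) (if (i <= j)%N then G i j else 0).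
Proof.
rewrite pair_bigA /=; rewrite -big_mkcond /=.
rewrite (reindex_omap (val : lpath n -> _) insub) => [|[i j] /= le_ij]; last first.
  by rewrite insubT.
by apply: eq_bigl => p; rewrite valK eqxx (valP p).
Qed.

Definition path_mx (x : KQ) : 'M[K]_n.+1 :=
  \matrix_(i, j) (if insub (i, j) is Some p then x p else 0).

Fact path_mx_is_linear : linear path_mx.
Proof.
move=> k x y; apply/matrixP=> i j; rewrite !mxE.
by case: insub => [p|]; rewrite ?ffunE // mulr0 addr0.
Qed.

Definition path_coords : 'Hom(KQ, 'M[K]_n.+1) := lfun_of path_mx_is_linear.

Lemma path_coordsE x (p : lpath n) : path_coords x (psource p) (ptarget p) = x p.
Proof. by rewrite lfun_ofE mxE -surjective_pairing valK. Qed.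

Lemma path_coords_supp x : path_coords x \in msupp leR.
Proof. by apply/msuppP=> i j nle; rewrite lfun_ofE mxE insubN. Qed.

Lemma path_coords_elt p :
  path_coords (path_elt K p) = delta_mx (psource p) (ptarget p).
Proof.
apply/matrixP=> i j; rewrite lfun_ofE !mxE; case: insubP => [q _ qE | nle].
  rewrite ffunE -val_eqE /= [sval q]qE [val p]surjective_pairing xpair_eqE; by case: eqP.
case: andP => // -[/eqP ei /eqP ej]; case/negP: nle.
by rewrite ei ej (valP p).
Qed.

Lemma path_support_algebra : support_algebra leR path_coords.
Proof.
split.
- apply/eqP/lfun_eq0P=> x x0; apply/ffunP=> p.
  by rewrite -path_coordsE x0 mxE ffunE.
- apply/vspaceP=> y; apply/memv_imgP/idP=> [[x _ ->]|sy]; first exact: path_coords_supp.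
  exists [ffun p : lpath n => y (psource p) (ptarget p)]; rewrite ?memvf //.
  apply/matrixP=> i j; rewrite lfun_ofE mxE; case: insubP => [p _ pE|nle].
    by rewrite ffunE /psource /ptarget pE.
  by rewrite (msuppP _ _ sy).
- apply/matrixP=> i j; rewrite lfun_ofE !mxE; case: insubP => [p _ pE|nle].
    by rewrite ffunE /psource /ptarget pE.
  by case: eqP nle => // ->; rewrite leqnn.
move=> x y; apply/matrixP=> i l; rewrite mxE; case: ifPn => [le_il | nle]; last first.
  by rewrite (msuppP _ _ (path_coords_supp _)).
pose r : lpath n := exist _ (i, l) le_il.
rewrite -[LHS]/(path_coords _ (psource r) (ptarget r)) path_coordsE.
rewrite [LHS]pathalg_mulE mxE.
under eq_bigr do under eq_bigr do rewrite pcatE -!path_coordsE.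
pose G i' j' := \sum_(q : lpath n) path_coords x i' j' *
   path_coords y (psource q) (ptarget q) *
   [&& j' == psource q, i == i' & l == ptarget q]%:R.
rewrite -[LHS]/(\sum_(p : lpath n) G (psource p) (ptarget p)) sum_lpath.
rewrite (bigD1 i) //= [X in _ + X]big1 ?addr0 => [|i' ne_i]; last first.
  apply: big1 => j _; case: ifP => // _; apply: big1 => q _.
  by rewrite [i == i']eq_sym (negPf ne_i) /= andbF mulr0.
apply: eq_bigr => j _; case: ifPn => [_ | nle]; last first.
  by rewrite (msuppP _ _ (path_coords_supp x)) ?mul0r.
pose H c d := path_coords x i j * path_coords y c d * [&& j == c, i == i & l == d]%:R.
rewrite -[LHS]/(\sum_(q : lpath n) H (psource q) (ptarget q)) sum_lpath.
rewrite (bigD1 j) //= [X in _ + X]big1 ?addr0 => [|c ne_c]; last first.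
  by apply: big1 => d _; rewrite /H [j == c]eq_sym (negPf ne_c) /= mulr0 if_same.
rewrite (bigD1 l) //= [X in _ + X]big1 ?addr0 => [|d ne_d]; last first.
  by rewrite /H [l == d]eq_sym (negPf ne_d) !andbF /= mulr0 if_same.
rewrite /H !eqxx mulr1; case: ifPn => // nle.
by rewrite (msuppP _ _ (path_coords_supp y)) ?mulr0.
Qed.

Lemma pp_path (p : lpath n) :
  path_elt K p = pp leR path_coords (psource p) (ptarget p).
Proof.
apply: (phi_inj path_support_algebra).
by rewrite (phi_pp path_support_algebra) path_coords_elt mxmask_delta ?(valP p).
Qed.

End PathAlgebra.

(** Reflexivity and convexity travel with the relation, so that the ring structure of [thinalg K R]
    can be inferred from its type. *)
Structure thinrel (n : nat) := ThinRel {
  thinrel_val :> 'I_n.+1 -> 'I_n.+1 -> bool;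
  thinrel_refl : forall i, thinrel_val i i;
  thinrel_convex : convex_for thinrel_val thinrel_val
}.

Definition thinalg (K : fieldType) (n : nat) (R : thinrel n) : Type :=
  subvs_of (msupp R : {vspace 'M[K]_n.+1}).

Section ThinAlgebra.
Variables (K : fieldType) (n : nat) (R : thinrel n).
Local Notation B := (thinalg K R).

HB.instance Definition _ := Vector.on B.

Definition talg_of (y : 'M[K]_n.+1) : B := vsproj (msupp R) (mxmask R y).
Definition talg_val (x : B) : 'M[K]_n.+1 := vsval x.

Lemma talg_ofE y : talg_val (talg_of y) = mxmask R y.
Proof. by rewrite /talg_val vsprojK ?msupp_mxmask. Qed.

Lemma talg_val_inj : injective talg_val. Proof. exact: subvs_inj. Qed.

Lemma talg_supp x : talg_val x \in msupp R. Proof. exact: subvsP. Qed.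

Fact talg_val_is_linear : linear talg_val. Proof. exact: linearP. Qed.
HB.instance Definition _ :=
  GRing.isLinear.Build K B 'M[K]_n.+1 *:%R talg_val talg_val_is_linear.

Fact talg_of_is_linear : linear talg_of.
Proof. by move=> k x y; apply: talg_val_inj; rewrite [RHS]linearP /= !talg_ofE linearP. Qed.
HB.instance Definition _ :=
  GRing.isLinear.Build K 'M[K]_n.+1 B *:%R talg_of talg_of_is_linear.

Definition talg_one : B := talg_of 1%:M.
Definition talg_mul (x y : B) : B := talg_of (talg_val x *m talg_val y).

Fact talg_oneE : talg_val talg_one = 1%:M.
Proof.
apply/matrixP=> i j; rewrite talg_ofE !mxE; case: eqP => [->|_]; last by rewrite if_same.
by rewrite thinrel_refl.
Qed.

Fact talg_mulA : associative talg_mul.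
Proof.
move=> x y z; apply: talg_val_inj; rewrite !talg_ofE; symmetry.
by apply: mxmask_mulmxA (talg_supp x) (talg_supp y) (talg_supp z); apply: thinrel_convex.
Qed.
Fact talg_mul1 : left_id talg_one talg_mul.
Proof.
by move=> x; apply: talg_val_inj; rewrite talg_ofE talg_oneE mul1mx mxmaskK ?talg_supp.
Qed.
Fact talg_1mul : right_id talg_one talg_mul.
Proof.
by move=> x; apply: talg_val_inj; rewrite talg_ofE talg_oneE mulmx1 mxmaskK ?talg_supp.
Qed.
Fact talg_mulDl : left_distributive talg_mul +%R.
Proof. by move=> x y z; rewrite /talg_mul linearD /= mulmxDl linearD. Qed.
Fact talg_mulDr : right_distributive talg_mul +%R.
Proof. by move=> x y z; rewrite /talg_mul [talg_val (y + z)]linearD /= mulmxDr linearD. Qed.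
Fact talg_one_neq0 : talg_one != 0.
Proof.
apply/eqP=> /(congr1 talg_val)/matrixP/(_ ord0 ord0)/eqP.
by rewrite talg_oneE linear0 !mxE oner_eq0.
Qed.

HB.instance Definition _ := GRing.Zmodule_isNzRing.Build B
  talg_mulA talg_mul1 talg_1mul talg_mulDl talg_mulDr talg_one_neq0.

Fact talg_scaleAl (k : K) (x y : B) : k *: (x * y) = (k *: x) * y.
Proof. by rewrite /GRing.mul /= /talg_mul linearZ /= -scalemxAl linearZ. Qed.
HB.instance Definition _ := GRing.Lmodule_isLalgebra.Build K B talg_scaleAl.
Fact talg_scaleAr (k : K) (x y : B) : k *: (x * y) = x * (k *: y).
Proof. by rewrite /GRing.mul /= /talg_mul [talg_val (k *: y)]linearZ /= -scalemxAr linearZ. Qed.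
HB.instance Definition _ := GRing.Lalgebra_isAlgebra.Build K B talg_scaleAr.
HB.instance Definition _ := Algebra_isFalgebra.Build K B.

Definition talg_coords : 'Hom(B, 'M[K]_n.+1) := linfun talg_val.

Lemma talg_coords_of y : talg_coords (talg_of y) = mxmask R y.
Proof. by rewrite lfunE /= talg_ofE. Qed.

Lemma talg_support_algebra : support_algebra R talg_coords.
Proof.
split.
- by apply/eqP/lfun_eq0P=> x; rewrite lfunE /= => x0; apply: talg_val_inj; rewrite linear0.
- apply/vspaceP=> y; apply/memv_imgP/idP=> [[x _ ->]|sy]; first by rewrite lfunE talg_supp.
  by exists (talg_of y); rewrite ?memvf // talg_coords_of mxmaskK.
- by rewrite lfunE /= talg_oneE.
by move=> x y; rewrite !lfunE /= talg_ofE.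
Qed.

End ThinAlgebra.

Lemma card_ord_interval (n a b : nat) : (b <= n.+1)%N ->
  #|[pred l : 'I_n.+1 | a <= l < b]%N| = (b - a)%N.
Proof.
move=> le_bn; rewrite -sum1_card.
rewrite -(big_ord_widen_cond n.+1 (fun l => a <= l)%N (fun=> 1%N) le_bn) //.
by rewrite -(big_geq_mkord a b xpredT (fun=> 1%N)) sum_nat_const_nat muln1.
Qed.

Section Nakayama.
Variables (K : fieldType) (n : nat).
Local Notation KQ := (pathalg K n).
Local Notation leR := (fun i j : 'I_n.+1 => (i <= j)%N).
Local Notation pc := (path_coords K n).
Local Notation pcS := (path_support_algebra K n).
Local Notation pe := (pp leR pc).

(** Spanned by the paths of length at least [t]; it bounds the [t]-th power of the arrow ideal from
    above. *)
Definition arrow_filtration (t : nat) : {vspace KQ} :=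
  (pc @^-1: msupp (fun i j : 'I_n.+1 => (i + t <= j)%N))%VS.

Lemma arrow_filtrationP t (x : KQ) :
  reflect (forall i j : 'I_n.+1, ~~ (i + t <= j)%N -> pc x i j = 0)
          (x \in arrow_filtration t).
Proof. by rewrite -memv_preim; apply: (iffP (msuppP _ _)). Qed.

Lemma arrow_filtrationM s t U V :
  (U <= arrow_filtration s -> V <= arrow_filtration t ->
   U * V <= arrow_filtration (s + t))%VS.
Proof.
move=> /subvP Us /subvP Vt; apply/prodvP=> x y /Us/arrow_filtrationP x0 /Vt/arrow_filtrationP y0.
apply/arrow_filtrationP=> i j; rewrite -ltnNge => lt_j.
rewrite (phiM pcS) !mxE; case: ifP => // _; apply: big1 => k _.
case: (leqP (i + s) k) => [le_k | lt_k]; last by rewrite x0 ?mul0r // -ltnNge.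
by rewrite [pc y k j]y0 ?mulr0 // -ltnNge; apply: leq_trans lt_j _; rewrite addnA leq_add2r.
Qed.

Lemma arrow_filtration0 : arrow_filtration 0 = fullv.
Proof.
apply/vspaceP=> x; rewrite memvf; apply/arrow_filtrationP=> i j; rewrite addn0 => nle.
exact: (msuppP _ _ (phi_supp pcS x)).
Qed.

Lemma arrow_ideal_filtration : (arrow_ideal K n <= arrow_filtration 1)%VS.
Proof.
rewrite -[1%N]addn0; apply: arrow_filtrationM; last by rewrite arrow_filtration0.
rewrite -[1%N]add0n; apply: arrow_filtrationM; first by rewrite arrow_filtration0.
apply/span_subvP=> x /mapP[p]; rewrite mem_enum inE => /eqP len1 ->.
apply/arrow_filtrationP=> i j; rewrite path_coords_elt mxE.
case: andP => // -[/eqP-> /eqP->]; rewrite -ltnNge addn1 ltnS => le_ts.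
by move: len1; rewrite /plength; move/eqP: le_ts => ->.
Qed.

Lemma arrow_ideal_expv m : (arrow_ideal K n ^+ m <= arrow_filtration m)%VS.
Proof.
elim: m => [|m IHm]; first by rewrite arrow_filtration0 subvf.
by rewrite expvSl -add1n; apply: arrow_filtrationM IHm; apply: arrow_ideal_filtration.
Qed.

Lemma pp_arrow_ideal (i j : 'I_n.+1) : (i < j)%N -> pe i j \in arrow_ideal K n.
Proof.
move=> lt_ij; have lt_i1 : (i.+1 < n.+1)%N by apply: leq_ltn_trans lt_ij (ltn_ord j).
pose k := Ordinal lt_i1; have le_ik : (i <= k)%N by [].
rewrite -(pp_mul pcS (j := k)) // memv_mul ?memvf // -[pe i k]mul1r memv_mul ?memvf //.
apply: memv_span; apply/mapP; exists (exist _ (i, k) le_ik); last exact/esym/pp_path.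
by rewrite mem_enum inE /plength /= subSnn.
Qed.

(** Monotonicity of [e] makes the killed paths an ideal, and [i + 2 <= e i] keeps every arrow alive,
    which puts the kernel inside the square of the arrow ideal. *)
Lemma linear_nakayama_thinalg (R : thinrel n) (e : nat -> nat) (c : seq nat) :
    (forall i j, R i j = (i <= j < e i)%N) ->
    (forall i j, i <= j -> j <= n -> e i <= e j)%N ->
    (forall i, i < n -> i + 2 <= e i)%N -> (forall i, i <= n -> e i <= n.+1)%N ->
    size c = n.+1 -> (forall i, i <= n -> nth 0%N c i = e i - i)%N ->
  linear_nakayama n (thinalg K R) c.
Proof.
move=> RE e_mono e2 en size_c cE.
pose f : 'Hom(KQ, thinalg K R) := (linfun (@talg_of K n R) \o pc)%VF.
have taS := talg_support_algebra K R.
have fE x : talg_coords K R (f x) = mxmask R (pc x).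
  by rewrite comp_lfunE [X in talg_coords _ _ X]lfunE talg_coords_of.
have R_le i j : R i j -> (i <= j)%N by rewrite RE => /andP[].
have fM : ahom_in {:KQ} f.
  apply/ahom_inP; split=> [x y _ _|]; apply: (phi_inj taS).
    rewrite (phiM taS) !fE (phiM pcS); apply/matrixP=> i k; rewrite !mxE.
    case: ifP => // Rik; rewrite (R_le i k) //; apply: eq_bigr => j _; rewrite !mxE.
    case: (leqP i j) => [le_ij | gt_ij]; last first.
      by rewrite (msuppP _ _ (phi_supp pcS x)) -?ltnNge // if_same !mul0r.
    case: (leqP j k) => [le_jk | gt_jk]; last first.
      by rewrite (msuppP _ _ (phi_supp pcS y)) -?ltnNge // if_same !mulr0.
    have Rij : R i j.
      by move: Rik; rewrite !RE le_ij => /andP[_]; apply: leq_ltn_trans.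
    have Rjk : R j k.
      move: Rik; rewrite !RE le_jk => /andP[_ lt_k].
      by apply: leq_trans lt_k (e_mono _ _ le_ij _); rewrite -ltnS.
    by rewrite Rij Rjk.
  rewrite fE (phi1 pcS) (phi1 taS); apply/matrixP=> i j; rewrite !mxE.
  by case: eqP => [->|_]; rewrite ?thinrel_refl ?if_same.
have fpp (i : 'I_n.+1) : f (path_elt K (ptriv i)) = pp R (talg_coords K R) i i.
  apply: (phi_inj taS); rewrite fE (phi_pp taS) (pp_path K (ptriv i)) (phi_pp pcS).
  by rewrite !mxmask_delta // thinrel_refl.
have fk x : (x \in lker f) = (mxmask R (pc x) == 0).
  by rewrite memv_ker -fE -(inj_eq (phi_inj taS)) linear0.
exists (AHom fM); split=> //=.
- apply/eqP/limg_fullP=> y; exists (pc^-1%VF (talg_coords K R y)).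
  apply: (phi_inj taS); rewrite fE (phi_invK pcS) ?mxmaskK ?(phi_supp taS) //.
  by apply/msuppP=> i j nle; apply: (msuppP _ _ (phi_supp taS y)); apply: contra nle; apply: R_le.
- split.
    have fM' x y : f (x * y) = f x * f y by have /ahom_inP[-> //] := fM; rewrite memvf.
    apply/andP; split; apply/prodvP=> x y.
      by move=> _; rewrite !memv_ker fM' => /eqP->; rewrite mulr0.
    by rewrite !memv_ker fM' => /eqP-> _; rewrite mul0r.
  (* Paths have length at most [n], so this power is zero; [n.+2] also meets the lower bound 2 when
     [n = 0]. *)
  exists n.+2; split=> //.
    apply: subv_trans (arrow_ideal_expv _) _; apply/subvP=> x /arrow_filtrationP x0.
    rewrite fk; apply/eqP/matrixP=> i j; rewrite !mxE; case: ifP => // _.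
    rewrite x0 // -ltnNge; apply: leq_trans (ltn_ord j) _.
    by rewrite !addnS; apply: leq_trans (leqnSn _); rewrite ltnS leq_addl.
  apply/subvP=> x; rewrite fk => /eqP/matrixP x0; rewrite [x](pp_expand pcS).
  apply: memv_suml => i _; apply: memv_suml => j _; have := x0 i j; rewrite !mxE.
  case: ifPn => [_ -> | nR _]; first by rewrite scale0r mem0v.
  apply: memvZ; case: (leqP i j) => [le_ij | gt_ij]; last first.
    by rewrite (pp_out pcS) ?mem0v // -ltnNge.
  have lt_in : (i < n)%N.
    rewrite ltn_neqAle -ltnS ltn_ord andbT; apply: contraNneq nR => ei.
    suff -> : j = i by rewrite thinrel_refl.
    by apply: val_inj; apply/eqP; rewrite eqn_leq le_ij -ltnS /= ei ltn_ord.
  have := e2 i lt_in; rewrite addn2 => lt_ie.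
  (* A killed path is longer than an arrow, so it splits at [i.+1] into two elements of the arrow
     ideal. *)
  have lt_ij : (i.+1 < j)%N.
    by move: nR; rewrite RE le_ij /= -leqNgt; apply: leq_trans.
  pose k := Ordinal (lt_in : (i.+1 < n.+1)%N).
  rewrite -(pp_mul pcS (j := k)) //=; last exact: ltnW.
  by rewrite expv2 memv_mul ?pp_arrow_ideal.
move=> i; have le_in : (i <= n)%N by rewrite -ltnS.
rewrite fpp (dim_right_ideal _ taS) cE // -(card_ord_interval (n := n) i (en _ le_in)).
by apply: eq_card => l; rewrite !inE RE.
Qed.

(** By [pp_corner] the kernel is spanned by the paths it contains. Subpaths of a surviving path
    survive, so the surviving paths from [i] end in an interval starting at [i], whose length is the
    dimension [nth 0 c i]. Positivity of the series keeps the trivial paths alive. *)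
Lemma nakayama_support_algebra (A : falgType K) (c : seq nat) :
    (forall i, i <= n -> 0 < nth 0%N c i)%N -> linear_nakayama n A c ->
  exists phi : 'Hom(A, 'M[K]_n.+1),
    support_algebra (fun i j : 'I_n.+1 => (i <= j < i + nth 0%N c i)%N) phi.
Proof.
move=> c_gt0 [f [/eqP/limg_fullP f_surj [ideal_f _] _ dim_c]].
have fVK : cancel f^-1%VF f by apply: limg_full_invK; apply/eqP/limg_fullP.
have fM x y : f (x * y) = f x * f y by rewrite rmorphM.
pose R (i j : 'I_n.+1) := (i <= j)%N && (f (pe i j) != 0).
have fpe (i : 'I_n.+1) : f (path_elt K (ptriv i)) = f (pe i i) by rewrite pp_path.
have pe0 (i j k : 'I_n.+1) : (i <= j)%N -> (j <= k)%N ->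
    f (pe i k) != 0 -> (f (pe i j) != 0) && (f (pe j k) != 0).
  move=> le_ij le_jk; rewrite -(pp_mul pcS le_ij le_jk) fM => nz.
  by apply/andP; split; apply: contraNneq nz => ->; rewrite ?mul0r ?mulr0.
have kerR x : f x = 0 -> mxmask R (pc x) = 0.
  move=> fx0; apply/matrixP=> i j; rewrite !mxE; case: ifP => // /andP[le_ij nz].
  have: f (pe i i * x * pe j j) = 0 by rewrite !fM fx0 mulr0 mul0r.
  by rewrite (pp_corner pcS) linearZ /= => /eqP; rewrite scaler_eq0 (negPf nz) orbF => /eqP.
have Rker x : mxmask R (pc x) = 0 -> f x = 0.
  move=> /matrixP x0; rewrite [x](pp_expand pcS) linear_sum big1 // => i _.
  rewrite linear_sum big1 // => j _; rewrite linearZ /=; have := x0 i j; rewrite !mxE.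
  case: ifPn => [_ -> | nR _]; first by rewrite scale0r.
  case: (boolP (i <= j)%N) nR => [le_ij | nle _].
    by rewrite /R le_ij negbK /= => /eqP->; rewrite scaler0.
  by rewrite (pp_out pcS) // linear0 scaler0.
pose phi : 'Hom(A, 'M[K]_n.+1) := (linfun (mxmask R) \o pc \o f^-1)%VF.
have phif x : phi (f x) = mxmask R (pc x).
  rewrite !comp_lfunE lfunE /=; apply/eqP; rewrite -subr_eq0 -!linearB /=.
  by apply/eqP/kerR; rewrite linearB /= fVK subrr.
have Rii i : R i i.
  rewrite /R leqnn /=; have := c_gt0 i; rewrite -ltnS ltn_ord => /(_ isT).
  rewrite dim_c fpe; apply: contraTneq => ->.
  suff -> : (<[0 : A]> * fullv)%VS = 0%VS by rewrite dimv0.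
  exact: prod0v.
have phiR : support_algebra R phi.
  split.
  - apply/eqP/lfun_eq0P=> a; have [x <-] := f_surj a; rewrite phif; exact: Rker.
  - apply/vspaceP=> y; apply/memv_imgP/idP=> [[a _ ->]|sy].
      by have [x <-] := f_surj a; rewrite phif msupp_mxmask.
    exists (f (pc^-1%VF y)); rewrite ?memvf // phif (phi_invK pcS) ?mxmaskK //.
    apply/msuppP=> i j nle; apply: (msuppP _ _ sy).
    by rewrite /R negb_and nle.
  - rewrite -(rmorph1 f) phif (phi1 pcS); apply/matrixP=> i j; rewrite !mxE.
    by case: eqP => [->|_]; rewrite ?Rii ?if_same.
  move=> a b; have [x <-] := f_surj a; have [y <-] := f_surj b.
  rewrite -fM !phif (phiM pcS); apply/matrixP=> i k; rewrite !mxE.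
  case: ifP => // /andP[le_ik nz]; rewrite le_ik; apply: eq_bigr => j _; rewrite !mxE.
  case: (leqP i j) => [le_ij | gt_ij]; last first.
    by rewrite (msuppP _ _ (phi_supp pcS x)) -?ltnNge // if_same !mul0r.
  case: (leqP j k) => [le_jk | gt_jk]; last first.
    by rewrite (msuppP _ _ (phi_supp pcS y)) -?ltnNge // if_same !mulr0.
  by have /andP[n1 n2] := pe0 i j k le_ij le_jk nz; rewrite /R le_ij le_jk n1 n2.
exists phi; apply: (eq_support_algebra _ phiR) => i j.
have fpp k : f (pe k k) = pp R phi k k.
  apply: (phi_inj phiR); rewrite phif (phi_pp phiR) (phi_pp pcS).
  by rewrite !mxmask_delta // Rii.
have cE : nth 0%N c i = #|[pred l | R i l]| by rewrite dim_c fpe fpp (dim_right_ideal _ phiR).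
case: (leqP i j) => [le_ij | gt_ij]; last by rewrite /R leqNgt gt_ij.
(* If the path to [j] survives, so do those to all targets between [i] and [j], and the dimension
   exceeds [j - i]; otherwise all surviving targets lie before [j]. *)
case: (boolP (R i j)) => [/andP[_ nz] | nR].
  suff: (j.+1 - i <= nth 0 c i)%N by rewrite leq_subLR.
  rewrite cE -(card_ord_interval (n := n) i (ltn_ord j)).
  apply: subset_leq_card; apply/fintype.subsetP=> l; rewrite !inE => /andP[le_il le_lj].
  by rewrite /R le_il; case/andP: (pe0 i l j le_il le_lj nz).
apply/esym/negbTE; rewrite -leqNgt -leq_subRL // cE.
rewrite -(card_ord_interval (n := n) i (ltnW (ltn_ord j))).
apply: subset_leq_card; apply/fintype.subsetP=> l; rewrite !inE => /andP[le_il nz].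
rewrite le_il ltnNge; apply: contra nR => le_jl; rewrite /R le_ij.
by case/andP: (pe0 i j l le_ij le_jl nz).
Qed.

End Nakayama.

(** * Two relations are not tilted *)

Section ExtensionFromKernel.
Variables (K : fieldType) (A : falgType K) (M N F : rmodule A).
Variables (q : 'Hom(F, M)) (s : 'Hom(F, N)).
Hypotheses (hq : is_rhom q) (q_surj : limg q = fullv).
Hypothesis hs : forall u a, q u = 0 -> s (ract u a) = ract (s u) a.

Let qK : cancel q^-1%VF q. Proof. exact: limg_full_invK. Qed.

(* The cocycle of the push-out along s of 0 -> ker q -> F -> M -> 0. *)
Definition pushout_cocycle (t : M) (a : A) : N :=
  s (ract (q^-1%VF t) a - q^-1%VF (ract t a)).
Local Notation c := pushout_cocycle.

(** The push-out is realised on [N * M] by means of the linear section [q^-1] of [q]. The module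
    axioms become cocycle identities, which hold because [s] respects the action on the kernel of
    [q]. *)
Definition pushout_act (x : N * M) (a : A) : N * M :=
  (ract x.1 a + c x.2 a, ract x.2 a).

Fact pushout_linearl a k (x y : N * M) :
  pushout_act (k *: x + y) a = k *: pushout_act x a + pushout_act y a.
Proof.
rewrite /pushout_act /c /=; congr (_, _); last by rewrite ract_linearl.
rewrite [q^-1%VF (_ + _)]linearP !ract_linearl [q^-1%VF (_ + _)]linearP /=.
by rewrite opprD addrACA -scalerBr [s _]linearP scalerDr addrACA.
Qed.

Fact pushout_linearr (x : N * M) k a b :
  pushout_act x (k *: a + b) = k *: pushout_act x a + pushout_act x b.
Proof.
rewrite /pushout_act /c /=; congr (_, _); last by rewrite ract_linearr.
rewrite !ract_linearr [q^-1%VF (_ + _)]linearP /=.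
by rewrite opprD addrACA -scalerBr [s _]linearP scalerDr addrACA.
Qed.

Fact pushout_act1 (x : N * M) : pushout_act x 1 = x.
Proof.
by case: x => u t; rewrite /pushout_act /c /= !ract1 subrr linear0 addr0.
Qed.

Fact pushout_actM (x : N * M) a b :
  pushout_act x (a * b) = pushout_act (pushout_act x a) b.
Proof.
rewrite /pushout_act /c /= !ractM ractDl -addrA; congr (_ + _, _).
rewrite -hs; last by rewrite linearB /= hq !qK subrr.
by rewrite -linearD /= ractBl addrA subrK.
Qed.

Definition pushout_rmodule : rmodule A :=
  @RModule K A (N * M)%type pushout_act pushout_linearl pushout_linearr
    pushout_act1 pushout_actM.

(** Only the restriction of [s] to the kernel of [q] matters. It extends to a homomorphism on [F]
    because the push-out extension splits: a splitting [h] corrects the map sending [w] to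
    [s (w - q^-1 (q w))]. *)
Lemma Ext1_eq0_extend : Ext1_eq0 M N ->
  exists s' : 'Hom(F, N), is_rhom s' /\ forall u, q u = 0 -> s' u = s u.
Proof.
move=> ext0; pose E := pushout_rmodule.
have flin : linear (fun u : N => (u, 0) : E).
  by move=> k u v; congr (_, _); rewrite /= scaler0 addr0.
have glin : linear (fun x : E => x.2) by [].
have [|h [hh /lfunP gh]] := ext0 E (lfun_of flin) (lfun_of glin).
  split.
  - move=> u a; rewrite !lfun_ofE; congr (_, _) => /=; last by rewrite ract0l.
    by rewrite /c linear0 !ract0l linear0 subrr linear0 addr0.
  - by move=> x a; rewrite !lfun_ofE.
  - by apply/eqP/lfun_eq0P=> u; rewrite lfun_ofE => -[].
  - apply/vspaceP=> -[u t]; rewrite memv_ker lfun_ofE /=.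
    apply/memv_imgP/eqP=> [[v _] | ->]; first by rewrite lfun_ofE => -[].
    by exists u; rewrite ?memvf // lfun_ofE.
  - by apply/eqP/limg_fullP=> t; exists (0, t); rewrite lfun_ofE.
have h2 t : (h t).2 = t by have := gh t; rewrite comp_lfunE lfun_ofE id_lfunE.
have h1 t a : (h (ract t a)).1 = ract (h t).1 a + c t a by rewrite hh /= h2.
have slin : linear (fun w => s (w - q^-1%VF (q w)) - (h (q w)).1).
  move=> k u v; rewrite [q _]linearP [q^-1%VF (_ + _)]linearP [h _]linearP /=.
  by rewrite opprD addrACA -scalerBr [s _]linearP opprD addrACA -scalerBr.
exists (lfun_of slin); split=> [w a | w qw0]; rewrite !lfun_ofE; last first.
  by rewrite qw0 [q^-1%VF 0]linear0 [h 0]linear0 /= !subr0.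
rewrite hq h1 /c ractBl -hs; last by rewrite linearB /= qK subrr.
by rewrite opprD addrCA addrC -[s _ - s _]linearB /= opprB addrA subrK ractBl.
Qed.

End ExtensionFromKernel.

(* The Happel-Ringel lemma for summands of T with trivial endomorphism rings. *)
Section HappelRingel.
Variables (K : fieldType) (H : falgType K) (T : rmodule H).
Hypotheses (hH : hereditary H) (extT : Ext1_eq0 T T).
Variables f ex ey : 'Hom(T, T).
Hypotheses (hf : is_rhom f) (hey : is_rhom ey).
Hypotheses (exf : forall u, ex (f u) = f u) (fey : forall u, f (ey u) = f u).
Hypothesis f_neq0 : f != 0.
Hypothesis eyK : forall u, ey (ey u) = ey u.
Hypothesis end_x : forall g : 'Hom(T, T), is_rhom g ->
  exists k, forall u, ex (g (ex u)) = k *: ex u.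
Hypothesis end_y : forall g : 'Hom(T, T), is_rhom g ->
  exists k, forall u, ey (g (ey u)) = k *: ey u.

(** Let [X] and [Y] be the images of [ex] and [ey]. As [H] is hereditary, the preimage [L] of the
    image of [f] in a free cover is projective, so [q] lifts through [f] on [L]; as [Ext1_eq0 T T],
    the lift restricted to the kernel of [q] extends to the whole cover. The difference of lift and
    extension factors through the image of [f] and induces an endomorphism of [Y], a scalar [k]. If
    [k] is non-zero, [f] is injective on [Y]. If [k = 0], lift and extension agree on [L], and [f]
    after the extension induces a scalar on [X] that fixes the image of [f], hence is 1. *)
Lemma mono_or_epi :
  (forall u, f u = 0 -> ey u = 0) \/ (forall u, exists v, f v = ex u).
Proof.
have [m [q [hq q_surj]]] := free_cover T; set F := power_rmodule _ m in q hq q_surj.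
have qK : cancel q^-1%VF q by apply: limg_full_invK.
pose L := (q @^-1: limg f)%VS.
have LP l : reflect (exists v, q l = f v) (l \in L).
  rewrite -memv_preim; apply: (iffP memv_imgP) => [[v _ e]|[v e]]; first by exists v.
  by exists v; rewrite ?memvf.
have stabL u a : u \in L -> ract u a \in L.
  by case/LP=> v e; apply/LP; exists (ract v a); rewrite hq hf e.
have pL : projective (sub_rmodule stabL) :=
  @hH _ _ _ (@projective_free K H m) (@rhom_sub_incl _ _ _ _ stabL) (lker_sub_incl stabL).
have [fI [hfI fIE]] := rhom_lift_sub (stable_limg hf) hf (subvv _).
have fI_surj : limg fI = fullv.
  apply/eqP/limg_fullP=> v; have /memv_imgP[u _ e] := subvsP v.
  by exists u; apply: subvs_inj; rewrite fIE.
have [||qI [hqI qIE]] := rhom_lift_sub (f := (q \o sub_incl stabL)%VF) (stable_limg hf).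
- by apply: rhom_comp => //; apply: rhom_sub_incl.
- rewrite limg_comp limg_sub_incl; apply/subvP=> _ /memv_imgP[l /LP[v ->] ->].
  by rewrite memv_img ?memvf.
have [s [hs fs]] := pL _ _ fI qI hfI fI_surj hqI.
(* [vsproj L] extends the lift linearly to all of [F]; compatibility with the action holds on [L],
   which contains the kernel of [q]. *)
pose s1 : 'Hom(F, T) := (ey \o s \o linfun (vsproj L))%VF.
have s1E l : s1 l = ey (s (vsproj L l)) by rewrite !comp_lfunE lfunE.
have hs1 l a : l \in L -> s1 (ract l a) = ract (s1 l) a.
  move=> Ll; rewrite !s1E -hey -hs; congr (ey (s _)); apply: subvs_inj.
  by rewrite (sub_actE stabL) !vsprojK // stabL.
have fs1 l : l \in L -> f (s1 l) = q l.
  move=> Ll; rewrite s1E fey; have /lfunP/(_ (vsproj L l)) := fs.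
  by move/(congr1 vsval); rewrite comp_lfunE fIE qIE comp_lfunE sub_inclE vsprojK.
have kerL l : q l = 0 -> l \in L by move=> ql0; apply/LP; exists 0; rewrite linear0.
have [|s' [hs' s'E]] := Ext1_eq0_extend hq q_surj _ extT (s := s1).
  by move=> u a /kerL; apply: hs1.
pose d : 'Hom(F, T) := (s1 - (ey \o s')%VF).
have dE l : d l = s1 l - ey (s' l) by rewrite add_lfunE opp_lfunE comp_lfunE.
have hd l a : l \in L -> d (ract l a) = ract (d l) a.
  by move=> Ll; rewrite !dE hs1 // hs' hey ractBl.
have d0 l : q l = 0 -> d l = 0.
  by move=> ql0; rewrite dE s'E // s1E eyK subrr.
have dq l l' : q l = q l' -> d l = d l'.
  by move=> e; apply/eqP; rewrite -subr_eq0 -linearB; apply/eqP/d0; rewrite linearB /= e subrr.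
have thL u : u \in limg f -> q^-1%VF u \in L.
  by case/memv_imgP=> v _ ->; apply/LP; exists v; rewrite qK.
have hg : is_rhom (d \o q^-1 \o f)%VF.
  move=> u a; rewrite !comp_lfunE hf -hd; last by rewrite thL ?memv_img ?memvf.
  by apply: dq; rewrite hq !qK.
have [k kE] := end_y hg.
have [k0 | k_neq0] := eqVneq k 0; last first.
  left=> u fu0; have := kE u; rewrite !comp_lfunE fey fu0 !linear0 => /esym/eqP.
  by rewrite scaler_eq0 (negPf k_neq0) => /eqP.
right; have dL l : l \in L -> d l = 0.
  case/LP=> v qlv; have := kE v; rewrite k0 scale0r !comp_lfunE fey.
  rewrite (dq _ l) ?qK // => <-; rewrite dE linearB /= eyK; congr (_ - _).
  by rewrite s1E eyK.
have s1s' l : l \in L -> s1 l = ey (s' l).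
  by move/dL/eqP; rewrite dE subr_eq0 => /eqP.
pose G := (f \o s' \o q^-1)%VF; have GE u : G u = f (s' (q^-1%VF u)) by rewrite !comp_lfunE.
have fs'0 l : q l = 0 -> f (s' l) = 0.
  by move=> ql0; rewrite -fey -s1s' ?kerL // fs1 ?kerL.
have hG : is_rhom G.
  move=> u a; rewrite !GE -hf -hs'; apply/eqP; rewrite -subr_eq0 -!linearB.
  by apply/eqP/fs'0; rewrite linearB /= hq !qK subrr.
have Gf u : G (f u) = f u.
  have Lu : q^-1%VF (f u) \in L by rewrite thL ?memv_img ?memvf.
  by rewrite GE -fey -s1s' // fs1 // qK.
have [c cE] := end_x hG.
have /lfunPn[v] := f_neq0; rewrite zero_lfunE => fv_neq0.
have c1 : c = 1.
  have := cE (f v); rewrite !exf Gf exf => /eqP.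
  rewrite -[f v in X in X == _]scale1r -subr_eq0 -scalerBl scaler_eq0 (negPf fv_neq0) orbF.
  by rewrite subr_eq0 => /eqP.
move=> u; have := cE u; rewrite c1 scale1r GE exf => <-.
by eexists.
Qed.

End HappelRingel.

Section NotTilted.
Variables (K : fieldType) (n : nat) (B : falgType K).
Variables (R : 'I_n.+1 -> 'I_n.+1 -> bool) (phi : 'Hom(B, 'M[K]_n.+1)).
Hypothesis Bphi : support_algebra R phi.
Local Notation p := (pp R phi).

(** By [mono_or_epi] the map of [T] given by [p x y] is injective on the summand at [y] or
    surjective onto the summand at [x]. The first contradicts [p x y * p y z = 0], the second
    [p w x * p x y = 0]. *)
Lemma not_tilted (w x y z : 'I_n.+1) :
  R w x -> R x y -> R y z -> ~~ R w y -> ~~ R x z -> ~ tilted B.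
Proof.
move=> Rwx Rxy Ryz nRwy nRxz [H [T [hH [_ extT _] [t [/eqP/lker0P t_inj imt t1 tM]]]]].
have ht b : is_rhom (t b) by apply/imt; rewrite memv_img ?memvf.
have tMu a b u : t a (t b u) = t (a * b) u by rewrite tM comp_lfunE.
have t_neq0 i j : R i j -> exists u, t (p i j) u != 0.
  move=> Rij; have /lfunPn[u] : t (p i j) != 0.
    by rewrite -(linear0 t) (inj_eq t_inj) (pp_neq0 Bphi).
  by rewrite zero_lfunE; exists u.
have t_end i (g : 'Hom(T, T)) : is_rhom g ->
    exists k, forall u, t (p i i) (g (t (p i i) u)) = k *: t (p i i) u.
  case/imt/memv_imgP=> b _ ->; exists (phi b i i) => u.
  by rewrite !tMu (pp_corner Bphi) linearZ /= scale_lfunE.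
have ref := supp_refl Bphi.
have [||||||||f0|f1] := @mono_or_epi K H T hH extT (t (p x y)) (t (p x x)) (t (p y y)).
- exact: ht.
- exact: ht.
- by move=> u; rewrite tMu (pp_mul Bphi).
- by move=> u; rewrite tMu (pp_mul Bphi).
- by rewrite -(linear0 t) (inj_eq t_inj) (pp_neq0 Bphi).
- by move=> u; rewrite tMu (pp_mul Bphi).
- exact: t_end.
- exact: t_end.
- have [u] := t_neq0 y z Ryz; have := f0 (t (p y z) u).
  rewrite !tMu !(pp_mul Bphi) // (pp_out Bphi nRxz) linear0 zero_lfunE.
  by move=> /(_ erefl)->; rewrite eqxx.
have [u] := t_neq0 w x Rwx; have [v fv] := f1 u.
rewrite -(pp_mul Bphi Rwx (ref x)) -tMu -fv tMu (pp_mul Bphi) // (pp_out Bphi nRwy).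
by rewrite linear0 zero_lfunE eqxx.
Qed.

End NotTilted.

(** * Shod linear Nakayama algebras *)

Section Interval.
Variables (K : fieldType) (n : nat) (A : falgType K) (e : nat -> nat).
Local Notation R := (fun i j : 'I_n.+1 => (i <= j < e i)%N).
Variable phi : 'Hom(A, 'M[K]_n.+1).
Hypothesis Aphi : support_algebra R phi.
Hypothesis e_mono : forall i j, (i <= j)%N -> (j <= n)%N -> (e i <= e j)%N.
Hypothesis e_le : forall i, (i <= n)%N -> (e i <= n.+1)%N.
Implicit Types X Y Z P Q : rmodule A.

Local Notation p := (pp R phi).

(** The dummy index makes this a support with a single row. *)
Definition interval (a b : nat) (_ : 'I_1) (j : 'I_n.+1) : bool := (a <= j < b)%N.

Fact gt_e (i : 'I_n.+1) : (i < e i)%N.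
Proof. by have /= := supp_refl Aphi i; rewrite leqnn. Qed.

Fact e_mono_ord (i j : 'I_n.+1) : (i <= j)%N -> (e i <= e j)%N.
Proof. by move=> le_ij; apply: e_mono; rewrite // -ltnS. Qed.

Lemma convex_interval (a : 'I_n.+1) b : (b <= e a)%N -> convex_for R (interval a b).
Proof.
rewrite /interval => le_b i j k l; have := @e_mono_ord a j; have := @e_mono_ord j k; lia.
Qed.

Lemma convex_column (r : 'I_n.+1) : convex_for R (fun (_ : 'I_1) j => R j r).
Proof. by move=> i j k l; have := @e_mono_ord j k; lia. Qed.

Lemma convex_row (r : 'I_n.+1) : convex_for R (fun (_ : 'I_1) j => R r j).
Proof. by move=> i j k l; have := @e_mono_ord r j; lia. Qed.

Arguments convex_column : clear implicits.
Arguments convex_row : clear implicits.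

Definition interval_rmodule (a : 'I_n.+1) b (le_b : (b <= e a)%N) : rmodule A :=
  thin_rmodule Aphi (convex_interval le_b).

(* With i the first vertex at which X does not vanish, every nonzero element of
   X at i generates a direct summand of X. *)
Lemma indecomposable_interval X : indecomposable X ->
  exists (a : 'I_n.+1) b (le_b : (b <= e a)%N),
    (a < b)%N /\ isomorphic X (interval_rmodule le_b).
Proof.
case=> X_neq0 X_ind.
have [i0 i0P] : exists i, lker (ractl X (p i i)) != fullv.
  case: (pickP (fun i => lker (ractl X (p i i)) != fullv)) => [i|no_i]; first by exists i.
  case: X_neq0.
  apply/vspaceP=> u; rewrite memvf memv0; symmetry; apply/eqP.
  rewrite -[u](ract_sum1 Aphi) big1 // => i _; apply/eqP; rewrite -ractlE -memv_ker.
  by move/negbFE/eqP: (no_i i) => ->; rewrite memvf.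
pose i := [arg min_(i < i0 | lker (ractl X (p i i)) != fullv) i].
have iP : lker (ractl X (p i i)) != fullv by rewrite /i; case: arg_minnP.
have i_min (j : 'I_n.+1) (u : X) : (j < i)%N -> ract u (p j j) = 0.
  move=> lt_ji; apply/eqP; rewrite -ractlE -memv_ker; apply: contraTT lt_ji => nu.
  rewrite -leqNgt /i; case: arg_minnP => // i' _; apply.
  by apply: contraNneq nu => ->; rewrite memvf.
have [u0 u0P] : exists u : X, ract u (p i i) != 0.
  have := iP; rewrite eqEsubv subvf /= => /subvPn[u _]; rewrite memv_ker ractlE; by exists u.
(* The end of the longest path from [i] along which [u0] survives; [u0] then generates a copy of
   [[i, j]]. *)
pose j := [arg max_(j > i | ract u0 (p i j) != 0) (j : nat)].
have jP : ract u0 (p i j) != 0 by rewrite /j; case: arg_maxnP.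
have j_max (l : 'I_n.+1) : (j < l)%N -> ract u0 (p i l) = 0.
  move=> lt_jl; apply/eqP; apply: contraTT lt_jl => nu; rewrite -leqNgt /j.
  by case: arg_maxnP => // j' _; apply.
have /andP[le_ij lt_je] : R i j.
  by apply: contraNT jP => /(pp_out Aphi)->; rewrite ract0r.
clearbody i j; exists i, j.+1, lt_je; split; first by rewrite ltnS.
pose M := interval_rmodule lt_je.
have [||h [hh hE]] := @rhom_from_generators _ _ _ _ _ Aphi _ _ (convex_interval lt_je)
    X (fun=> i) (fun=> ract u0 (p i i)).
- by move=> a l; rewrite /interval; lia.
- move=> a l; rewrite /interval => Ril nl; rewrite (ract_idpp Aphi) j_max //; lia.
(* The functional is normalised to be 1 on [u0] moved to [j], so that the map [r] back to the
   interval satisfies [r (h u) = u]. That [r] is well defined uses that [X] vanishes before [i]. *)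
have [t tE] := exists_functional jP.
have [||r [hr rE]] := @rhom_to_cogenerators _ _ _ _ _ Aphi _ _ (convex_interval lt_je)
    X (fun=> j) (fun=> t).
- by move=> a l; rewrite /interval; have := @e_mono_ord i l; lia.
- move=> a l u; rewrite /interval => Rlj nl.
  by rewrite -(ract_idpp Aphi) i_min ?ract0l ?linear0 //; lia.
have rh : (r \o h)%VF = \1%VF.
  apply: (rhom_generators_eq (Aphi := Aphi) (r := fun=> i)).
  - by move=> a l; rewrite /interval; lia.
  - by move=> a l; rewrite /interval; lia.
  - exact: rhom_comp.
  - exact: rhom_id.
  move=> a; rewrite comp_lfunE id_lfunE hE ?/interval ?leqnn ?ltnS //.
  rewrite ract_idpp //; apply: thin_coef_inj; apply/matrixP=> b l.
  rewrite rE thin_ofE !mxE !(ord1 a) !(ord1 b) eqxx /=.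
  rewrite /interval; case: ifPn => // /andP[le_il le_lj].
  case: (eqVneq l i) => [-> | ne_l]; first by rewrite ract_idpp // tE.
  by rewrite ract_pp0 1?eq_sym // linear0.
have rhE u : r (h u) = u by move/lfunP/(_ u): rh; rewrite comp_lfunE id_lfunE.
have [Y [isoY isoM]] := retract_split hh hr rhE.
case: (X_ind _ _ isoY) => [M0 | /isoM //].
have : tb Aphi (convex_interval lt_je) ord0 i \in (fullv : {vspace M}) by apply: memvf.
rewrite M0 memv0 => /eqP/(congr1 thin_coef)/matrixP/(_ ord0 i)/eqP.
by rewrite thin_ofE linear0 !mxE /interval leqnn ltnS le_ij !eqxx oner_eq0.
Qed.

Section Homology.
Variables (a : 'I_n.+1) (b : nat) (le_b : (b <= e a)%N).
Hypothesis lt_ab : (a < b)%N.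
Local Notation X := (interval_rmodule le_b).

(** [[a, b[] is the projective [[a, e a[] modulo [[b, e a[], and the latter is the projective at [b]
    when [e b = e a]. *)
Lemma interval_pdim_le1 : b = e a \/ (b < e a)%N /\ e b = e a -> pdim_le 1 X.
Proof.
case=> [eb | [lt_be eb]].
  apply: projective_pdim_le1; apply: projective_thin (fun=> a) _ => i j.
  by rewrite /interval eb.
have lt_bn : (b < n.+1)%N by apply: leq_trans lt_be (e_le _); rewrite -ltnS.
pose b' := Ordinal lt_bn; have cb : (e a <= e b')%N by rewrite /= eb.
exists (thin_rmodule Aphi (convex_row a)), (thin_rmodule Aphi (convex_interval cb)).
do 2!eexists; split.
- by apply: projective_thin (fun=> a) _ => i j.
- apply: short_exact_thin => i j; rewrite /interval /=; [lia.. | ].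
  by move=> k; lia.
- by apply: projective_thin (fun=> b') _ => i j; rewrite /interval /= eb.
Qed.

(** The injective at [b - 1] contains [[a, b[], with quotient supported on the [k < a] with
    [b <= e k]. This support is empty in the first case; in the second it is that of the injective
    at [a - 1]. *)
Lemma interval_idim_le1 :
    (forall k : nat, (k < a)%N -> (e k < b)%N) \/
    (0 < a)%N /\ (forall k : nat, (k < a)%N -> (a <= e k)%N -> (b <= e k)%N) ->
  idim_le 1 X.
Proof.
have le_bn : (b <= n.+1)%N by apply: leq_trans le_b (e_le _); rewrite -ltnS.
have lt_d : (b.-1 < n.+1)%N by lia.
pose d := Ordinal lt_d.
case=> [eb | [a_gt0 eb]].
  apply: injective_idim_le1; apply: injective_thin (fun=> d) _ => i j.
  rewrite /interval /=; have := eb j; have := @e_mono_ord a j; lia.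
have lt_a1 : (a.-1 < n.+1)%N by have := ltn_ord a; lia.
pose a1 := Ordinal lt_a1.
exists (thin_rmodule Aphi (convex_column d)), (thin_rmodule Aphi (convex_column a1)).
do 2!eexists; split.
- by apply: injective_thin (fun=> d) _ => i j.
- apply: short_exact_thin => i j; rewrite /interval /=.
  + have := eb j; have := @e_mono_ord a j; lia.
  + by lia.
  + by move=> k; lia.
- by apply: injective_thin (fun=> a1) _ => i j.
Qed.

Local Notation x0 := (tb Aphi (convex_interval le_b) ord0 a).

Lemma interval_gen_pp (i : 'I_n.+1) : (a <= i)%N -> (i < e a)%N ->
  ract x0 (p a i) = tb Aphi (convex_interval le_b) ord0 i.
Proof. by move=> le_ai lt_i; rewrite tb_pp /interval ?leqnn ?lt_ab // le_ai. Qed.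

Lemma rhom_interval_eq (N : rmodule A) (f g : 'Hom(X, N)) :
  is_rhom f -> is_rhom g -> f x0 = g x0 -> f = g.
Proof.
move=> hf hg fg; apply: (rhom_generators_eq (Aphi := Aphi) (r := fun=> a)) => // i.
- by move=> l; rewrite /interval; lia.
- by move=> l; rewrite /interval; lia.
- by rewrite (ord1 i).
Qed.

Lemma interval_gen_coef : thin_coef x0 ord0 a = 1.
Proof. by rewrite thin_ofE !mxE /interval leqnn lt_ab !eqxx. Qed.

(** A decomposition gives an idempotent endomorphism [G]. It multiplies the generator [x0] by a
    scalar [k] with [k * (k - 1) = 0], and [G] is determined by its value at [x0]. *)
Lemma interval_indecomposable : indecomposable X.
Proof.
have x0_neq0 : x0 <> 0.
  move/(congr1 thin_coef)/matrixP/(_ ord0 a)/eqP.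
  by rewrite interval_gen_coef linear0 mxE oner_eq0.
split=> [X0 | Y Z [F [hF /eqP kF /eqP/limg_fullP surjF]]].
  by apply: x0_neq0; apply/eqP; rewrite -memv0 -X0 memvf.
have FK := lker0_lfunK kF.
have FVK : cancel F^-1%VF F by apply: limg_full_invK; apply/eqP/limg_fullP.
pose D := dsum_rmodule Y Z.
have plin : linear (fun u : D => (u.1, 0) : D).
  by move=> k u v; congr (_, _); rewrite /= scaler0 addr0.
pose G : 'Hom(X, X) := (F^-1 \o lfun_of plin \o F)%VF.
have GE u : F (G u) = ((F u).1, 0) by rewrite !comp_lfunE FVK lfun_ofE.
have hG : is_rhom G.
  move=> u c; apply: (can_inj FK) => /=; rewrite GE !hF GE.
  by congr (_, _) => /=; rewrite ract0l.
pose k := thin_coef (G x0) ord0 a.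
have Gx0 : G x0 = k *: x0.
  have x0E : x0 = ract x0 (p a a).
    by rewrite interval_gen_pp // (leq_trans lt_ab).
  apply: thin_coef_inj; apply/matrixP=> i j; rewrite [in LHS]x0E hG (ord1 i).
  rewrite linearZ /= thin_coef_pp ?(supp_refl Aphi) // thin_ofE !mxE /interval.
  case: ifP => [/andP[-> /eqP->] | ne]; first by rewrite !eqxx mulr1.
  by case: ifP ne => _; rewrite ?mulr0 //= eq_sym => /eqP/eqP/negPf->; rewrite mulr0.
have GG u : G (G u) = G u by apply: (can_inj FK); rewrite /= !GE.
have : k * (k - 1) == 0.
  have := GG x0; rewrite !Gx0 linearZ /= Gx0 scalerA.
  move/(congr1 (fun u : X => @thin_coef _ _ _ _ _ Aphi _ _ (convex_interval le_b) u ord0 a)).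
  by rewrite !linearZ /= !mxE interval_gen_coef !mulr1 mulrBr mulr1 subr_eq0 => /eqP.
rewrite mulf_eq0 => /orP[/eqP k0 | k1].
  left; have G0 : G = 0.
    apply: rhom_interval_eq => //; first exact: rhom0.
    by rewrite Gx0 k0 scale0r zero_lfunE.
  apply/vspaceP=> y; rewrite memvf memv0; symmetry; apply/eqP.
  have [u Fu] := surjF (y, 0); have := GE u.
  by rewrite G0 zero_lfunE linear0 Fu => -[<-].
right; have G1 : G = \1%VF.
  apply: rhom_interval_eq => //; first exact: rhom_id.
  by move: k1; rewrite subr_eq0 => /eqP k1; rewrite Gx0 k1 scale1r id_lfunE.
apply/vspaceP=> z; rewrite memvf memv0; symmetry; apply/eqP.
have [u Fu] := surjF (0, z); have := GE u.
by rewrite G1 id_lfunE Fu => -[->].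
Qed.

(** Lift the generator to [m] in [P] at vertex [a]. Then [m] moved to [b] equals [f y], and [y] dies
    on the path from [b] to [e a], because no path leads from [a] to [e a]. As [Y] is projective,
    [gamma], which sends [y] to an element with coordinate 1 at [b], lifts to the projective at [b];
    there the path to [e a] does not kill that coordinate, since [e a < e b]. *)
Lemma interval_pdim_gt1 : (b < e a)%N -> (e a < e b)%N -> ~ pdim_le 1 X.
Proof.
move=> lt_be lt_ee [P [Y [f [g [pP [hf hg kf fg surjg] pY]]]]].
have le_ean : (e a <= n.+1)%N by apply: e_le; rewrite -ltnS.
have lt_bn : (b < n.+1)%N by apply: leq_trans lt_be _.
pose b' := Ordinal lt_bn; have eb'n : (e b' <= n.+1)%N by apply: e_le.
have lt_cn : (e a < n.+1)%N by apply: leq_trans lt_ee _.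
pose c := Ordinal lt_cn; have cN : (e a <= e b')%N by apply: ltnW.
have [m0 gm0] : exists m, g m = x0 by apply/limg_fullP; apply/eqP.
pose m := ract m0 (p a a).
have gm : g m = x0 by rewrite hg gm0 interval_gen_pp // (leq_trans lt_ab).
have Rab : R a b' by rewrite /= (ltnW lt_ab).
have Rbc : R b' c by rewrite /= (ltnW lt_be).
have nRac : ~~ R a c by rewrite /= ltnn andbF.
have [y0 fy0] : exists y, f y = ract m (p a b').
  have : ract m (p a b') \in lker g.
    rewrite memv_ker hg gm; apply/eqP/thin_coef_inj/matrixP=> i j.
    rewrite thin_coef_pp // linear0 mxE /interval; case: ifP => // /andP[/andP[_ ltb] /eqP ej].
    by rewrite ej ltnn in ltb.
  by rewrite -fg => /memv_imgP[y _ ->]; exists y.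
pose y := ract y0 (p b' b').
have fy : f y = ract m (p a b') by rewrite hf fy0 ract_ppid.
pose cPa := convex_row a; pose Pa := thin_rmodule Aphi cPa.
pose pi := thin_map Aphi cPa (convex_interval le_b).
have hpi : is_rhom pi.
  by apply: rhom_thin_map => i j k; rewrite /interval; lia.
have surjpi : limg pi = fullv.
  apply/eqP/limg_fullP=> u; exists (thin_map Aphi (convex_interval le_b) cPa u).
  apply: thin_coef_inj; apply/matrixP=> i j; rewrite !thin_mapE !mxE /interval.
  case: ifPn => [ab | nab]; last by rewrite thin_coef0.
  by case: ifPn => // nj; lia.
have [beta [hbeta /lfunP pibeta]] := pP _ _ pi g hpi surjpi hg.
have coef_pi u (j : 'I_n.+1) : (a <= j < b)%N ->
    thin_coef (beta u) ord0 j = thin_coef (g u) ord0 j.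
  by move=> abj; rewrite -pibeta comp_lfunE thin_mapE mxE /interval abj.
have betam : thin_coef (beta m) ord0 a = 1.
  by rewrite coef_pi ?leqnn ?lt_ab // gm interval_gen_coef.
pose cN' := convex_interval cN; pose Nn := thin_rmodule Aphi cN'.
(* [beta] compares [P] with the projective at [a]; on the image of [f], the kernel of [g], its
   coordinates in [[a, b[] vanish, so truncation to [[b, e a[] is compatible with the action. *)
pose gamma : 'Hom(Y, Nn) := (thin_map Aphi cPa cN' \o beta \o f)%VF.
have gammaE u (j : 'I_n.+1) :
    thin_coef (gamma u) ord0 j = if (b <= j < e a)%N then thin_coef (beta (f u)) ord0 j else 0.
  by rewrite !comp_lfunE thin_mapE mxE.
have ker0 u (j : 'I_n.+1) : (a <= j < b)%N -> thin_coef (beta (f u)) ord0 j = 0.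
  move=> abj; have : f u \in lker g by rewrite -fg memv_img ?memvf.
  by rewrite coef_pi // memv_ker => /eqP->; rewrite linear0 mxE.
have hgamma : is_rhom gamma.
  apply: (rhom_pp Aphi) => u k l Rkl; apply: thin_coef_inj; apply/matrixP=> i j.
  rewrite (ord1 i) thin_coef_pp // !gammaE hf hbeta thin_coef_pp // /interval /=.
  case: (eqVneq j l) => [-> | _]; last by rewrite !andbF if_same.
  rewrite !andbT; case: ifP => // bl; have -> : (a <= l < e a)%N by lia.
  case: ifPn => // nk; case: (boolP (a <= k < e a)%N) => [ak | nak].
    by apply: ker0; lia.
  by rewrite thin_coef0 // /=; lia.
pose cPb := convex_row b'.
pose q := thin_map Aphi cPb cN'.
have hq : is_rhom q by apply: rhom_thin_map => i j k; rewrite /interval /=; lia.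
have surjq : limg q = fullv.
  apply/eqP/limg_fullP=> u; exists (thin_map Aphi cN' cPb u).
  apply: thin_coef_inj; apply/matrixP=> i j; rewrite !thin_mapE !mxE /interval /=.
  case: ifPn => [ab | nab]; last by rewrite thin_coef0.
  by case: ifPn => // nj; lia.
have [gamma' [hgamma' /lfunP qgamma']] := pY _ _ q gamma hq surjq hgamma.
have zb : thin_coef (gamma' y) ord0 b' = 1.
  have := congr1 (fun x => thin_coef x ord0 b') (qgamma' y).
  rewrite comp_lfunE thin_mapE mxE gammaE /interval /= leqnn lt_be fy hbeta.
  by rewrite thin_coef_pp // eqxx andbT betam /= (ltnW lt_ab) lt_be.
have yc : ract y (p b' c) = 0.
  apply: (lfun_eq0P f (introT eqP kf)).
  by rewrite hf fy ract_pp // (pp_out Aphi nRac) ract0r.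
have := congr1 (fun x => thin_coef x ord0 c) (hgamma' y (p b' c)).
rewrite yc linear0 linear0 mxE thin_coef_pp // zb eqxx andbT /= (ltnW lt_be) lt_ee.
by move/esym/eqP; rewrite oner_eq0.
Qed.

(** The dual chase. Extending [f] to the injective at [b - 1] gives [q] in [Q] at vertex [a - 1]
    that survives the path to [b - 1]. Its image [v] in [Y] is killed by the paths to [a] and
    beyond, so the simple at [a - 1] maps to it; as [Y] is injective and [a <= e k], [v] comes from
    the vertex [k]. Since [X] vanishes at [a - 1], [q] itself then comes from [k]; but no path leads
    from [k] to [b - 1], as [e k < b]. *)
Lemma interval_idim_gt1 (k : nat) : (k < a)%N -> (a <= e k)%N -> (e k < b)%N ->
  (b <= e a.-1)%N -> ~ idim_le 1 X.
Proof.
move=> lt_ka le_ak lt_kb le_be [Q [Y [f [g [iQ [hf hg kf fg surjg] iY]]]]].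
have le_bn : (b <= n.+1)%N by apply: leq_trans le_b (e_le _); rewrite -ltnS.
have lt_d : (b.-1 < n.+1)%N by lia.
have lt_an := ltn_ord a.
have lt_a1 : (a.-1 < n.+1)%N by lia.
have lt_kn : (k < n.+1)%N by lia.
pose d := Ordinal lt_d; pose a1 := Ordinal lt_a1; pose k' := Ordinal lt_kn.
have Rkd : ~~ R k' d by rewrite /=; lia.
have Rka1 : R k' a1 by rewrite /=; lia.
have Ra1a : R a1 a by rewrite /=; lia.
have Ra1d : R a1 d by rewrite /=; lia.
have Rad : R a d by rewrite /=; lia.
have f_inj : forall u, f u = 0 -> u = 0 by apply/lfun_eq0P/eqP.
pose cI := convex_column d; pose inc := thin_map Aphi (convex_interval le_b) cI.
have hinc : is_rhom inc.
  apply: rhom_thin_map => i j l; rewrite /interval /=.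
  by have := @e_mono_ord a j; lia.
have kinc : lker inc = 0%VS.
  apply/eqP/lfun_eq0P=> u /(congr1 thin_coef)/matrixP u0.
  apply: thin_coef_inj; apply/matrixP=> i j; rewrite linear0 mxE.
  case: (boolP (interval a b i j)) => [abj | nS]; last by rewrite thin_coef0.
  have := u0 i j; rewrite thin_mapE linear0 !mxE; case: ifPn => // /negP[].
  by move: abj; rewrite /interval /=; have := @e_mono_ord a j; lia.
have [alpha [halpha /lfunP alphaE]] := iQ _ _ inc f hinc kinc hf.
pose xI (j : 'I_n.+1) := tb Aphi cI ord0 j.
have incE (j : 'I_n.+1) : (a <= j < b)%N ->
    inc (tb Aphi (convex_interval le_b) ord0 j) = xI j.
  move=> abj; apply: thin_coef_inj; rewrite thin_mapE !thin_ofE; apply/matrixP=> i l.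
  rewrite !mxE /interval; case: (eqVneq l j) => [->|]; last by rewrite !andbF !if_same.
  by rewrite abj.
pose q := alpha (xI a1).
have qd : ract q (p a1 d) <> 0.
  rewrite -halpha tb_pp // -[tb _ _ _ _]/(xI d) -incE; last by rewrite /=; lia.
  have := alphaE (tb Aphi (convex_interval le_b) ord0 d); rewrite comp_lfunE => ->.
  move/f_inj/(congr1 thin_coef)/matrixP/(_ ord0 d)/eqP.
  by rewrite linear0 thin_ofE !mxE /interval !eqxx /=; case: ifPn; rewrite ?oner_eq0 //; lia.
have qa1 : ract q (p a1 a1) = q by rewrite -halpha tb_pp ?(supp_refl Aphi).
pose v := g q.
have va (l : 'I_n.+1) : (a <= l)%N -> R a1 l -> ract v (p a1 l) = 0.
  move=> le_al Ra1l; have Ral : R a l by move: Ra1l; have := @e_mono_ord a1 a; rewrite /=; lia.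
  rewrite -(ract_pp Aphi v Ra1a Ral) -hg -halpha tb_pp // -[tb _ _ _ _]/(xI a).
  rewrite -incE; last by rewrite leqnn.
  have := alphaE x0; rewrite comp_lfunE => ->.
  suff -> : g (f x0) = 0 by rewrite ract0l.
  by apply/eqP; rewrite -memv_ker -fg memv_img ?memvf.
have la1 : (a <= e a1)%N by rewrite /=; lia.
have [||h [hh hE]] := @rhom_from_generators _ _ _ _ _ Aphi _ _ (convex_interval la1)
    Y (fun=> a1) (fun=> v).
- by move=> i j; rewrite /interval /=; lia.
- by move=> i l Rl; rewrite /interval => nl; apply: va => //; lia.
pose cI1 := convex_column a1; pose inc1 := thin_map Aphi (convex_interval la1) cI1.
have hinc1 : is_rhom inc1.
  by apply: rhom_thin_map => i j l; rewrite /interval /=; lia.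
have kinc1 : lker inc1 = 0%VS.
  apply/eqP/lfun_eq0P=> u /(congr1 thin_coef)/matrixP u0.
  apply: thin_coef_inj; apply/matrixP=> i j; rewrite linear0 mxE.
  case: (boolP (interval a1 a i j)) => [abj | nS]; last by rewrite thin_coef0.
  have := u0 i j; rewrite thin_mapE linear0 !mxE; case: ifPn => // /negP[].
  move: abj; rewrite /interval /= => abj; have -> : j = a1 by apply: val_inj => /=; lia.
  by have := gt_e a1; rewrite /=; lia.
have [h' [hh' /lfunP h'E]] := iY _ _ inc1 h hinc1 kinc1 hh.
have tE : inc1 (tb Aphi (convex_interval la1) ord0 a1) = ract (tb Aphi cI1 ord0 k') (p k' a1).
  rewrite tb_pp //; apply: thin_coef_inj; rewrite thin_mapE !thin_ofE; apply/matrixP=> i l.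
  rewrite !mxE /interval; case: (eqVneq l a1) => [->|]; last by rewrite !andbF !if_same.
  have -> : (a1 <= a1 < a)%N by rewrite /=; lia.
  by rewrite (gt_e a1) leqnn.
have vE : v = ract (h' (tb Aphi cI1 ord0 k')) (p k' a1).
  rewrite -hh' -tE -[RHS]/(h' (inc1 _)); have := h'E (tb Aphi (convex_interval la1) ord0 a1).
  rewrite comp_lfunE => ->; rewrite hE /interval /=; last by lia.
  by rewrite /v -hg qa1.
have /limg_fullP/(_ (h' (tb Aphi cI1 ord0 k')))[q' gq'] := introT eqP surjg.
have : ract q' (p k' a1) - q \in lker g by rewrite memv_ker linearB /= hg gq' -vE subrr.
rewrite -fg => /memv_imgP[u _ uE].
have : ract (ract q' (p k' a1) - q) (p a1 a1) = ract q' (p k' a1) - q.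
  by rewrite ractBl (ract_ppid Aphi) qa1.
rewrite uE -hf; have -> : ract u (p a1 a1) = 0.
  apply: thin_coef_inj; apply/matrixP=> i j; rewrite thin_coef_pp ?(supp_refl Aphi) // linear0 mxE.
  by case: andP => // -[]; rewrite /interval => ij /eqP ej; move: ij; rewrite ej /=; lia.
rewrite linear0 -uE => /esym/eqP; rewrite subr_eq0 => /eqP qE.
by apply: qd; rewrite -qE ract_pp // (pp_out Aphi Rkd) ract0r.
Qed.

End Homology.

(** The triples describe the intervals [[a, b[] with both dimensions above 1. As [e] is monotone,
    [b <= e a.-1] says that the quotient of the injective at [b - 1] by [[a, b[] is non-zero, and
    [k] shows that it is smaller than the injective at [a - 1]. *)
Lemma shodP :
  shod A <->
  (forall k a b : nat, (a <= e k)%N -> (k < a)%N -> (e k < b)%N -> (b <= e a.-1)%N ->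
     (b < e a)%N -> (e a < e b)%N -> (a <= n)%N -> False).
Proof.
split=> [shodA k a b le_ak lt_ka lt_kb le_ba lt_be lt_ee le_an | no_bad X].
  have lt_an : (a < n.+1)%N by []. pose a' := Ordinal lt_an.
  have le_b : (b <= e a')%N by apply: ltnW.
  have lt_ab : (a' < b)%N by apply: leq_ltn_trans lt_kb.
  have [|] := shodA _ (interval_indecomposable le_b lt_ab).
    exact: interval_pdim_gt1.
  exact: (interval_idim_gt1 lt_ab (k := k)).
case/indecomposable_interval => a [b [le_b [lt_ab isoX]]].
have le_an : (a <= n)%N by rewrite -ltnS.
case: (boolP ((b == e a) || (b < e a) && (e b == e a))%N) => [ok | nok].
  left; apply: pdim_le1_iso (isomorphic_sym isoX) _; apply: interval_pdim_le1 => //.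
  by case/orP: ok => [/eqP | /andP[? /eqP]]; [left | right].
right; apply: idim_le1_iso (isomorphic_sym isoX) _; apply: interval_idim_le1 => //.
case: (pickP (fun k : 'I_a => b <= e k)%N) => [k0 le_bk | no_k]; last first.
  by left=> k lt_ka; rewrite ltnNge; apply: negbT (no_k (Ordinal lt_ka)).
right; have lt_k0 := ltn_ord k0; split=> [|k lt_ka le_ak]; first by lia.
rewrite leqNgt; apply/negP=> lt_kb; apply: (no_bad k a b) => //.
- by apply: leq_trans le_bk (e_mono _ _); lia.
- by move: nok; lia.
- move: nok; have := e_le le_an; have := @e_mono a b; lia.
Qed.

End Interval.

(** * At most one relation is tilted *)

(* For the path algebra of a rooted forest: a module is projective if and only
   if all paths act injectively, a property inherited by submodules. *)
Section Forest.
Variables (K : fieldType) (n : nat) (A : falgType K).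
Variables (R : 'I_n.+1 -> 'I_n.+1 -> bool) (phi : 'Hom(A, 'M[K]_n.+1)).
Hypothesis Aphi : support_algebra R phi.
Hypothesis R_le : forall i j, R i j -> (i <= j)%N.
Hypothesis R_trans : forall i j k, R i j -> R j k -> R i k.
Hypothesis R_parent : forall v,
  (forall k, R k v -> k = v) \/
  exists q : 'I_n.+1, [/\ (q < v)%N, R q v & forall k, R k v -> k != v -> R k q].
Implicit Types M N P : rmodule A.
Local Notation p := (pp R phi).

Definition injective_paths M : Prop := forall k v (u : M),
  R k v -> ract u (p k v) = 0 -> ract u (p k k) = 0.

(** A projective embeds in a free module, and there transitivity of [R] prevents truncation when a
    path is multiplied on the right. *)
Lemma projective_injective_paths P : projective P -> injective_paths P.
Proof.
move=> pP; have [m [g [hg surjg]]] := free_cover P.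
have [h [hh /lfunP gh]] := pP _ _ g \1%VF hg surjg (rhom_id (M := P)).
have h_inj u : h u = 0 -> u = 0.
  by move=> hu0; have := gh u; rewrite comp_lfunE hu0 linear0 id_lfunE.
move=> k v u Rkv; rewrite -[ract u (p k v)]/(ract _ _) => /(congr1 h).
rewrite hh linear0 => /ffunP hu0; apply: h_inj; rewrite hh; apply/ffunP=> i.
have := hu0 i; rewrite !ffunE; set x := h u i.
rewrite -[ract _ _]/(x * p k v) -[ract _ _]/(x * p k k) => xkv.
apply: (phi_inj Aphi); rewrite linear0 (phiM Aphi) (phi_pp Aphi) mxmask_delta ?(supp_refl Aphi) //.
move/(congr1 phi): xkv; rewrite linear0 (phiM Aphi) (phi_pp Aphi) mxmask_delta // => /matrixP xkv.
apply/matrixP=> a c; rewrite !mxE; case: ifP => // Rac.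
rewrite (bigD1 k) //= big1 ?addr0 => [|l ne_l]; last by rewrite mxE (negPf ne_l) mulr0.
rewrite mxE eqxx /=; case: eqP => [ec|_]; last by rewrite mulr0.
have := xkv a v; rewrite !mxE (R_trans (j := k)) -?ec //; last by rewrite ec.
rewrite (bigD1 c) //= big1 ?addr0 => [|l ne_l]; last by rewrite mxE (negPf ne_l) mulr0.
by rewrite mxE !eqxx.
Qed.

(** The lift is built vertex by vertex in increasing order. If [v] has parent [q], the component of
    [M] at [q] embeds in that at [v]: on its image the lift is forced by the one at [q], and on a
    linear complement any preimage under [g] will do. *)
Lemma injective_paths_projective M : injective_paths M -> projective M.
Proof.
move=> iM M' N g f hg surjg hf.
have gK : cancel g^-1%VF g by apply: limg_full_invK.
(* [h v] is the component of the lift at [v], so far constructed for [v < t]. *)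
pose good t (h : 'I_n.+1 -> 'Hom(M, M')) := forall v : 'I_n.+1, (v < t)%N ->
  [/\ forall u, ract (h v u) (p v v) = h v u,
      forall u, g (h v u) = f (ract u (p v v)) &
      forall k u, R k v -> h v (ract u (p k v)) = ract (h k u) (p k v)].
suff [h hP] : exists h, good n.+1 h.
  exists (\sum_v h v); split; last first.
    apply/lfunP=> u; rewrite comp_lfunE sum_lfunE linear_sum /=.
    rewrite -[in RHS](ract_sum1 Aphi u) linear_sum; apply: eq_bigr => v _ /=.
    by have [_ -> _] := hP v (ltn_ord v).
  apply: (rhom_pp Aphi) => u k l Rkl; rewrite !sum_lfunE ract_suml.
  rewrite (bigD1 l) //= big1 ?addr0 => [|v ne_v]; last first.
    have [_ _ h3] := hP v (ltn_ord v).
    have [h1 _ _] := hP v (ltn_ord v).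
    have := h3 v (ract u (p k l)) (supp_refl Aphi v).
    by rewrite ract_pp0 1?eq_sym // linear0 h1.
  rewrite (bigD1 k) //= [X in _ = _ + X]big1 ?addr0 => [|v ne_v]; last first.
    by have [<- _ _] := hP v (ltn_ord v); rewrite ract_pp0.
  by have [_ _ ->] := hP l (ltn_ord l).
suff good_ex t : (t <= n.+1)%N -> exists h, good t h by apply: good_ex.
elim: t => [_|t IHt lt_t]; first by exists (fun=> 0).
have [h hP] := IHt (ltnW lt_t); pose v := Ordinal lt_t.
suff [hv [hv1 hv2 hv3]] : exists hv : 'Hom(M, M'),
    [/\ forall u, ract (hv u) (p v v) = hv u,
        forall u, g (hv u) = f (ract u (p v v)) &
        forall k u, R k v -> hv (ract u (p k v)) = ract ((if k == v then hv else h k) u) (p k v)].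
  exists (fun k => if k == v then hv else h k) => w; rewrite ltnS leq_eqVlt.
  case: eqP => [ew _ | ne_w /= lt_w].
    by rewrite (_ : w = v) ?eqxx; last exact: val_inj.
  have /negPf-> : w != v by apply: contra_not_neq ne_w => ->.
  have [h1 h2 h3] := hP w lt_w; split=> // k u Rkw; rewrite h3 //.
  case: eqP => // ek; have := R_le Rkw; rewrite ek /= => le_tw.
  by rewrite ltnNge le_tw in lt_w.
have pvv (u : M) : ract (ract u (p v v)) (p v v) = ract u (p v v) by rewrite (ract_ppid Aphi).
have pvv' (u : M') : ract (ract u (p v v)) (p v v) = ract u (p v v) by rewrite (ract_ppid Aphi).
case: (R_parent v) => [root | [q [lt_qv Rqv qP]]].
  exists (ractl M' (p v v) \o g^-1 \o f \o ractl M (p v v))%VF.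
  split=> [u|u|k u /root->]; rewrite !comp_lfunE !ractlE //.
    by rewrite hg gK -hf pvv.
  by rewrite eqxx !comp_lfunE !ractlE pvv pvv'.
(* [r] is a linear retraction of the component at [v] onto the component at [q]; it exists because
   the path from [q] to [v] acts injectively. *)
pose F := ractl M (p q v); pose r : 'Hom(M, M) := (ractl M (p q q) \o F^-1)%VF.
have rF u : r (ract u (p q v)) = ract u (p q q).
  rewrite -ractlE comp_lfunE; apply/eqP; rewrite -subr_eq0 !ractlE -ractBl; apply/eqP.
  apply: (iM _ _ _ Rqv); rewrite ractBl -[ract (F^-1%VF _) _]ractlE -/F -ractlE -/F.
  by rewrite limg_lfunVK ?subrr // memv_img ?memvf.
have rq u : ract (r u) (p q q) = r u by rewrite comp_lfunE ractlE (ract_ppid Aphi).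
have [hq1 hq2 hq3] := hP q lt_qv.
pose E := ractl M (p v v).
exists ((ractl M' (p q v) \o h q \o r \o E) +
        (ractl M' (p v v) \o g^-1 \o f \o (E - (ractl M (p q v) \o r \o E))))%VF.
set hv := (_ + _)%R.
have hvE u : hv u = ract (h q (r (ract u (p v v)))) (p q v) +
    ract (g^-1%VF (f (ract u (p v v) - ract (r (ract u (p v v))) (p q v)))) (p v v).
  by rewrite add_lfunE !comp_lfunE add_lfunE opp_lfunE !comp_lfunE !ractlE.
have hv_v u : hv (ract u (p v v)) = hv u by rewrite !hvE pvv.
split=> [u|u|k u Rkv].
- by rewrite hvE ractDl pvv' (ract_pp Aphi) ?(supp_refl Aphi).
- rewrite hvE linearD /= !hg hq2 gK -!hf rq ractBl pvv (ract_ppid Aphi).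
  by rewrite -linearD /= addrC subrK.
case: (eqVneq k v) => [-> | ne_kv].
  by rewrite hv_v hvE ractDl pvv' (ract_pp Aphi) ?(supp_refl Aphi).
have Rkq := qP k Rkv ne_kv.
have rk : r (ract u (p k v)) = ract u (p k q).
  by rewrite -(ract_pp Aphi u Rkq Rqv) rF (ract_ppid Aphi).
rewrite hvE (ract_ppid Aphi) rk (ract_pp Aphi) // subrr !linear0 ract0l addr0.
by rewrite hq3 // (ract_pp Aphi).
Qed.

Lemma forest_hereditary : hereditary A.
Proof.
move=> M P f pP hf /eqP kf; apply: injective_paths_projective => k v u Rkv ukv.
apply: (lfun_eq0P _ kf); rewrite hf.
by apply: (projective_injective_paths pP) Rkv _; rewrite -hf ukv linear0.
Qed.

End Forest.

Lemma short_exact_iso_l (K : fieldType) (A : falgType K) (L M E N : rmodule A)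
    (t : 'Hom(L, M)) (f : 'Hom(M, E)) (g : 'Hom(E, N)) :
  is_rhom t -> lker t = 0%VS -> limg t = fullv -> short_exact f g ->
  short_exact (f \o t)%VF g.
Proof.
move=> ht /eqP kt /eqP/limg_fullP st [hf hg /eqP kf fg sg]; split=> //.
- exact: rhom_comp.
- apply/eqP/lfun_eq0P=> u; rewrite comp_lfunE => /(lfun_eq0P _ kf).
  exact: (lfun_eq0P _ kt).
rewrite -fg; apply/vspaceP=> v; apply/memv_imgP/memv_imgP=> [[u _ ->]|[u _ ->]].
  by exists (t u); rewrite ?memvf ?comp_lfunE.
by have [w <-] := st u; exists w; rewrite ?memvf ?comp_lfunE.
Qed.

(** One copy of the big module is used for each row [v] of [S'], and the row is placed in it as row
    [row_of v]; [None] marks an empty row. *)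
Lemma thin_in_add (K : fieldType) (n : nat) (A : falgType K)
    (R : 'I_n.+1 -> 'I_n.+1 -> bool) (phi : 'Hom(A, 'M[K]_n.+1))
    (Aphi : support_algebra R phi) (m q : nat)
    (S : 'I_m -> 'I_n.+1 -> bool) (cS : convex_for R S)
    (S' : 'I_q -> 'I_n.+1 -> bool) (cS' : convex_for R S')
    (row_of : 'I_q -> option 'I_m) :
    (forall v u, S' v u = oapp (S^~ u) false (row_of v)) ->
  in_add (thin_rmodule Aphi cS) (thin_rmodule Aphi cS').
Proof.
move=> S'E.
pose im (y : (thin_rmodule Aphi cS')) v : 'M[K]_(m, n.+1) :=
  \matrix_(i, u) (if row_of v == Some i then thin_coef y v u else 0).
have ilin : linear (fun y : (thin_rmodule Aphi cS') =>
    [ffun v => thin_of Aphi cS (im y v)] : power_rmodule (thin_rmodule Aphi cS) q).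
  move=> k y z; apply/ffunP=> v; rewrite !ffunE -linearP; congr thin_of.
  apply/matrixP=> i u; rewrite !mxE; case: eqP => //.
  by rewrite mulr0 addr0.
pose rm (t : power_rmodule (thin_rmodule Aphi cS) q) : 'M[K]_(q, n.+1) :=
  \matrix_(v, u) (if row_of v is Some i then thin_coef (t v) i u else 0).
have rlin : linear (fun t : power_rmodule (thin_rmodule Aphi cS) q => thin_of Aphi cS' (rm t)).
  move=> k y z; rewrite -linearP; congr thin_of; apply/matrixP=> v u; rewrite !mxE.
  by case: (row_of v) => [i|]; rewrite ?mulr0 ?addr0 // !ffunE !mxE.
apply: (@retract_in_add _ _ (thin_rmodule Aphi cS) (thin_rmodule Aphi cS') q
  (lfun_of ilin) (lfun_of rlin)).
- apply: (rhom_pp Aphi) => y k l Rkl; rewrite !lfun_ofE; apply/ffunP=> v.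
  rewrite !ffunE; apply: thin_coef_inj; apply/matrixP=> i u.
  rewrite thin_coef_pp // !thin_ofE !mxE thin_coef_pp // S'E.
  case: (eqVneq (row_of v) (Some i)) => [e | ne]; last by rewrite !if_same.
  rewrite e /=; case: (boolP (S i u)) => //= Siu; case: (u == l) => //.
  case: ifPn => // nSik; rewrite thin_coef0 // S'E e; exact: nSik.
- apply: (rhom_pp Aphi) => t k l Rkl; rewrite !lfun_ofE.
  apply: thin_coef_inj; apply/matrixP=> v u.
  rewrite thin_coef_pp // !thin_ofE !mxE !S'E.
  case: (row_of v) => [i|] /=; last by rewrite ?if_same.
  rewrite ffunE thin_coef_pp //; case: (boolP (S i u)) => //= Siu; case: (u == l) => //.
  by case: ifPn => // nS; rewrite thin_coef0.
move=> y; rewrite !lfun_ofE; apply: thin_coef_inj; apply/matrixP=> v u.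
rewrite !thin_ofE !mxE S'E.
case e: (row_of v) => [i|] /=; last by rewrite thin_coef0 // S'E e.
rewrite ffunE thin_ofE !mxE e eqxx; case: (boolP (S i u)) => // nS.
by rewrite thin_coef0 // S'E e.
Qed.

(* The quiver of H is the tree 0 -> ... -> x with two branches grafted on x, one
   through x + 1, ..., b - 1 and the other through b, ..., n. The summands T_i of
   the tilting module are thin, with support
     {0, ..., i}                    for i < x          (injective),
     {0, ..., i} u {b, ..., n}      for x <= i < b,
     {i, ..., n}                    for b <= i         (projective),
   and the only vanishing composition T_j -> T_i of the canonical maps is the one
   for i < x and b <= j. *)
Section TiltingModule.
Variables (K : fieldType) (n x b : nat).
Hypotheses (lt_xb : (x < b)%N) (le_bn : (b <= n.+1)%N).

Definition tree_rel (i j : 'I_n.+1) : bool :=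
  (i <= j)%N && ~~ [&& x < i, i < b & b <= j]%N.
Definition relation_rel (i j : 'I_n.+1) : bool :=
  (i <= j)%N && ~~ ((i < x) && (b <= j))%N.
Definition tilt_supp (i v : 'I_n.+1) : bool :=
  [|| (i < x) && (v <= i), [&& x <= i, i < b & (v <= i) || (b <= v)] |
      (b <= i) && (i <= v)]%N.
(** The least vertex of the support of [T_i]; it generates [T_i]. *)
Definition tilt_top (i : 'I_n.+1) : 'I_n.+1 := if (i < b)%N then ord0 else i.

Local Notation RH := tree_rel.
Local Notation RB := relation_rel.
Local Notation S := tilt_supp.

Fact tree_refl i : RH i i. Proof. rewrite /tree_rel; lia. Qed.
Fact tree_trans i j k : RH i j -> RH j k -> RH i k.
Proof. by rewrite /tree_rel; lia. Qed.
Fact tree_convex : convex_for RH RH.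
Proof. by move=> i j k l; rewrite /tree_rel; lia. Qed.
Fact tilt_convex : convex_for RH S.
Proof. by move=> i j k l; rewrite /tree_rel /tilt_supp; lia. Qed.

Definition tree_thinrel : thinrel n := ThinRel tree_refl tree_convex.
Local Notation H := (thinalg K tree_thinrel).
Let HS : support_algebra RH (talg_coords K tree_thinrel) := talg_support_algebra K tree_thinrel.
Local Notation p := (pp RH (talg_coords K tree_thinrel)).

Definition tilt_module : rmodule H := thin_rmodule HS tilt_convex.
Local Notation T := tilt_module.

Lemma tree_hereditary : hereditary H.
Proof.
apply: (forest_hereditary HS) => [i j | i j k | v].
- by case/andP.
- exact: tree_trans.
case: (posnP v) => [v0 | v_gt0].
  by left=> k /andP[]; rewrite v0 leqn0 => /eqP k0 _; apply: val_inj; rewrite /= k0.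
right; have lt_vn := ltn_ord v.
have lt_q : ((if v == b :> nat then x else v.-1) < n.+1)%N by case: ifP; lia.
exists (Ordinal lt_q); split=> /=; rewrite /tree_rel /=.
- by case: ifP; lia.
- by case: ifP; lia.
move=> k + ne_kv; have {ne_kv} ne_kv : (k : nat) <> v by move/val_inj/eqP; rewrite (negPf ne_kv).
by case: ifP; lia.
Qed.

Fact tilt_gen i v : S i v -> RH (tilt_top i) v.
Proof. by rewrite /tilt_supp /tree_rel /tilt_top; case: ifP => /=; lia. Qed.
Fact tilt_gen_top i : S i (tilt_top i).
Proof. by rewrite /tilt_supp /tilt_top; case: ifP => /=; lia. Qed.

Local Notation t i := (tb HS tilt_convex i (tilt_top i)).

Lemma tilt_hom_eq (M : rmodule H) (f g : 'Hom(T, M)) :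
  is_rhom f -> is_rhom g -> (forall i, f (t i) = g (t i)) -> f = g.
Proof.
apply: (rhom_generators_eq (r := tilt_top)) => i j; [exact: tilt_gen | by rewrite tilt_gen_top].
Qed.

(** For [i.+1 < b] the summand [T_i] is the projective at 0 modulo this single path; the other
    summands are projective. *)
Lemma tilt_gen_relation (i : 'I_n.+1) (lt_i : (i.+1 < n.+1)%N) : (i.+1 < b)%N ->
  ract (t i) (p (tilt_top i) (Ordinal lt_i)) = 0.
Proof.
move=> lt_ib; rewrite tb_pp ?tilt_gen_top //; last first.
  by rewrite /tree_rel /tilt_top; case: ifP => /=; lia.
apply: thin_coef_inj; apply/matrixP=> k l; rewrite thin_ofE linear0 !mxE.
case: ifPn => // Skl; case: andP => // -[/eqP ek /eqP el].
by move: Skl; rewrite ek el /tilt_supp /=; lia.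
Qed.

(** An extension splits once the generators lift to elements satisfying the relation of [T_i]. A
    lift [w1] violates it by some [f s] at the vertex [i.+1]. Every row alive at that vertex is
    alive at 0, so [s] at [i.+1] is the image of some [s2] along the path, and subtracting [f s2] at
    0 repairs [w1]. *)
Lemma tilt_Ext1 : Ext1_eq0 T T.
Proof.
move=> E f g [hf hg kf fg /eqP/limg_fullP surjg].
have w_ex i : exists w : E, [/\ g w = t i, ract w (p (tilt_top i) (tilt_top i)) = w &
    forall l, RH (tilt_top i) l -> ~~ S i l -> ract w (p (tilt_top i) l) = 0].
  have [w0 gw0] := surjg (t i); pose w1 := ract w0 (p (tilt_top i) (tilt_top i)).
  have gw1 : g w1 = t i by rewrite hg gw0 tb_pp ?tilt_gen_top ?tree_refl.
  have w1i : ract w1 (p (tilt_top i) (tilt_top i)) = w1 by rewrite (ract_ppid HS).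
  case: (ltnP i.+1 b) => [lt_ib | le_bi]; last first.
    exists w1; split=> // l; rewrite /tilt_top /tree_rel /tilt_supp.
    by have := ltn_ord l; case: ifP => /=; lia.
  have lt_in : (i.+1 < n.+1)%N by apply: leq_trans lt_ib le_bn.
  pose i1 := Ordinal lt_in.
  have Ri1 : RH (tilt_top i) i1 by rewrite /tree_rel /tilt_top; case: ifP => /=; lia.
  have : ract w1 (p (tilt_top i) i1) \in lker g.
    by rewrite memv_ker hg gw1 tilt_gen_relation.
  rewrite -fg => /memv_imgP[s _ ws].
  pose s2 := thin_of HS tilt_convex
    (\matrix_(k, l) (if l == tilt_top i then thin_coef s k i1 else 0)).
  have s2E : ract s2 (p (tilt_top i) i1) = ract s (p i1 i1).
    apply: thin_coef_inj; apply/matrixP=> k l.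
    rewrite !thin_coef_pp ?(supp_refl HS) // thin_ofE !mxE eqxx.
    case: (eqVneq l i1) => [-> | _]; last by rewrite !andbF.
    rewrite andbT; case: ifP => // Ski1; suff -> : S k (tilt_top i) by [].
    by move: Ski1; rewrite /tilt_supp /tilt_top; case: ifP => /=; lia.
  exists (w1 - f (ract s2 (p (tilt_top i) (tilt_top i)))); split.
  - rewrite linearB /= gw1; suff -> : forall y, g (f y) = 0 by rewrite subr0.
    by move=> y; apply/eqP; rewrite -memv_ker -fg memv_img ?memvf.
  - by rewrite ractBl w1i -hf (ract_ppid HS).
  have w0i : ract (w1 - f (ract s2 (p (tilt_top i) (tilt_top i)))) (p (tilt_top i) i1) = 0.
    rewrite ractBl -hf (ract_idpp HS s2) s2E hf -ws (ract_ppid HS); exact: subrr.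
  move=> l Rl nS; have Ri1l : RH i1 l.
    by move: Rl nS; rewrite /tilt_top /tree_rel /tilt_supp; case: ifP => /=; lia.
  by rewrite -(ract_pp HS _ Ri1 Ri1l) w0i ract0l.
have /fin_all_exists[w wP] := w_ex.
have [||h [hh hE]] := @rhom_from_generators _ _ _ _ _ HS _ _ tilt_convex E tilt_top w.
- exact: tilt_gen.
- by move=> i l; have [_ _] := wP i; apply.
exists h; split=> //; apply: tilt_hom_eq => [||i]; [exact: rhom_comp | exact: rhom_id |].
have [gw wi _] := wP i.
by rewrite comp_lfunE id_lfunE hE ?tilt_gen_top // wi gw.
Qed.

Lemma tilt_tilting : tilting T.
Proof.
split; [exact: hereditary_pdim_le1 tree_hereditary | exact: tilt_Ext1 |].
(* The regular module embeds row by row. For [v < b] the projective at [v] lies in [T_(b-1)], the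
   projective at 0, with quotient [T_(v-1)] (zero if [v = 0]); for [b <= v] it is [T_v] itself, with
   zero quotient. Hence the two row assignments. *)
pose row0 (v : 'I_n.+1) : option 'I_n.+1 := Some (if (v < b)%N then inord b.-1 else v).
pose row1 (v : 'I_n.+1) : option 'I_n.+1 := if (0 < v < b)%N then Some (inord v.-1) else None.
pose S0 v u := oapp (S^~ u) false (row0 v); pose S1 v u := oapp (S^~ u) false (row1 v).
have S0E (v u : 'I_n.+1) : S0 v u = (v < b)%N || (v <= u)%N.
  rewrite /S0 /row0 /= /tilt_supp; have := ltn_ord u; have := ltn_ord v.
  by case: ifP => lt_vb; rewrite ?inordK; lia.
have S1E (v u : 'I_n.+1) : S1 v u = (0 < v < b)%N && ((u < v)%N || (x < v)%N && (b <= u)%N).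
  rewrite /S1 /row1 /=; have := ltn_ord u; have := ltn_ord v.
  by case: ifP => //= lt_vb; rewrite /tilt_supp ?inordK; lia.
have c0 : convex_for RH S0 by move=> i j k l; rewrite !S0E /tree_rel; lia.
have c1 : convex_for RH S1 by move=> i j k l; rewrite !S1E /tree_rel; lia.
pose reg (u : regular_rmodule H) := thin_of HS tree_convex (talg_coords K tree_thinrel u).
have reglin : linear reg by move=> k u v; rewrite /reg !linearP.
have regE u : thin_coef (lfun_of reglin u) = talg_coords K tree_thinrel u.
  by rewrite lfun_ofE thin_ofE mxmaskK ?(phi_supp HS).
exists (thin_rmodule HS c0), (thin_rmodule HS c1),
  (thin_map HS tree_convex c0 \o lfun_of reglin)%VF, (thin_map HS c0 c1); split.
- by apply: (thin_in_add HS tilt_convex c0 (row_of := row0)).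
- by apply: (thin_in_add HS tilt_convex c1 (row_of := row1)).
apply: short_exact_iso_l.
- by move=> u a; apply: thin_coef_inj; rewrite thin_coef_ract !regE; exact: (phiM HS).
- apply/eqP/lfun_eq0P=> u /(congr1 thin_coef); rewrite regE !linear0 => u0.
  by apply: (phi_inj HS); rewrite linear0.
- apply/eqP/limg_fullP=> y; exists ((talg_coords K tree_thinrel)^-1%VF (thin_coef y)).
  by apply: thin_coef_inj; rewrite regE (phi_invK HS) ?thin_coef_supp.
apply: short_exact_thin => i j; rewrite ?S0E ?S1E /tree_rel; [lia.. |].
by move=> k; rewrite S0E; lia.
Qed.

Section Endomorphisms.
Variables (B : falgType K) (phi : 'Hom(B, 'M[K]_n.+1)).
Hypothesis Bphi : support_algebra RB phi.

Let act_lin c : linear (fun u : T => thin_of HS tilt_convex (phi c *m thin_coef u) : T).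
Proof. by move=> k u v; rewrite -linearP [thin_coef (_ + _)]linearP mulmxDr -scalemxAr. Qed.

Definition tilt_end (c : B) : 'End(T) := lfun_of (act_lin c).

Lemma tilt_endE c u : thin_coef (tilt_end c u) = mxmask S (phi c *m thin_coef u).
Proof. by rewrite lfun_ofE thin_ofE. Qed.

Fact tilt_end_is_linear : linear tilt_end.
Proof.
move=> k c d; apply/lfunP=> u; apply: thin_coef_inj.
rewrite add_lfunE scale_lfunE linearP /= !tilt_endE linearP /= mulmxDl -scalemxAl.
by rewrite linearP.
Qed.

Lemma rhom_tilt_end c : is_rhom (tilt_end c).
Proof.
move=> u a; apply: thin_coef_inj; rewrite thin_coef_ract !tilt_endE thin_coef_ract.
symmetry; apply: mxmask_mulmxA (phi_supp Bphi c) (thin_coef_supp u) (phi_supp HS a).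
by move=> i j k l; rewrite /relation_rel /tree_rel /tilt_supp; lia.
Qed.

Lemma tilt_end_gen c j i l :
  thin_coef (tilt_end c (t j)) i l = if S i l && (l == tilt_top j) then phi c i j else 0.
Proof.
rewrite tilt_endE mxE; case: (S i l) => //=.
rewrite mxE (bigD1 j) //= thin_ofE big1 ?addr0 => [|j' ne_j]; last first.
  by rewrite !mxE (negPf ne_j) if_same mulr0.
rewrite !mxE eqxx; case: (eqVneq l (tilt_top j)) => [->|_]; last by rewrite if_same mulr0.
by rewrite tilt_gen_top mulr1.
Qed.

Lemma tilt_end_inj c : tilt_end c = 0 -> c = 0.
Proof.
move=> c0; apply: (phi_inj Bphi); rewrite linear0; apply/matrixP=> i j; rewrite mxE.
case: (boolP (RB i j)) => [Rij | nR]; last by rewrite (msuppP _ _ (phi_supp Bphi c)).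
have := tilt_end_gen c j i (tilt_top j); rewrite c0 zero_lfunE linear0 mxE eqxx andbT.
suff -> : S i (tilt_top j) by [].
by move: Rij; rewrite /relation_rel /tilt_supp /tilt_top; case: ifP => /=; lia.
Qed.

(** [g] is determined by the coordinates of [g (t j)] at the top of [T_j]. When [RB i j] fails and
    row [i] is alive at that top, [j.+1 < b] and row [i] is still alive at [j.+1], so the relation
    of [T_j] forces the coordinate to vanish. *)
Lemma tilt_end_surj (g : 'End(T)) : is_rhom g -> exists c, g = tilt_end c.
Proof.
move=> hg; pose c := phi^-1%VF (mxmask RB (\matrix_(i, j) thin_coef (g (t j)) i (tilt_top j))).
have cE i j : phi c i j = if RB i j then thin_coef (g (t j)) i (tilt_top j) else 0.
  by rewrite (phi_invK Bphi) ?msupp_mxmask // !mxE.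
exists c; apply: tilt_hom_eq => //; first exact: rhom_tilt_end.
move=> j; apply: thin_coef_inj; apply/matrixP=> i l; rewrite tilt_end_gen cE.
have gt_top : g (t j) = ract (g (t j)) (p (tilt_top j) (tilt_top j)).
  by rewrite -hg tb_pp ?tilt_gen_top ?tree_refl.
rewrite [in LHS]gt_top thin_coef_pp ?tree_refl //.
case: (boolP (S i l)) => //= Sil; case: (eqVneq l (tilt_top j)) => // el; rewrite el in Sil.
case: (boolP (RB i j)) => // nR.
have lt_jb : (j.+1 < b)%N.
  move: nR Sil; rewrite /relation_rel /tilt_supp /tilt_top; case: ifP => /=; lia.
have lt_jn : (j.+1 < n.+1)%N by apply: leq_trans lt_jb le_bn.
have := tilt_gen_relation lt_jn lt_jb => /(congr1 g); rewrite hg linear0.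
move=> /(congr1 thin_coef)/matrixP/(_ i (Ordinal lt_jn)); rewrite thin_coef_pp; last first.
  by rewrite /tree_rel /tilt_top; case: ifP => /=; lia.
rewrite linear0 mxE eqxx andbT; suff -> : S i (Ordinal lt_jn) by [].
by move: nR Sil; rewrite /relation_rel /tilt_supp /tilt_top; case: ifP => /=; lia.
Qed.

Lemma relation_tilted : tilted B.
Proof.
exists H, T; split; [exact: tree_hereditary | exact: tilt_tilting |].
exists (lfun_of tilt_end_is_linear); split.
- by apply/eqP/lfun_eq0P=> c; rewrite lfun_ofE; apply: tilt_end_inj.
- move=> g; split=> [/memv_imgP[c _ ->]|/tilt_end_surj[c ->]].
    by rewrite lfun_ofE; apply: rhom_tilt_end.
  by apply/memv_imgP; exists c; rewrite ?memvf ?lfun_ofE.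
- apply/lfunP=> u; apply: thin_coef_inj; rewrite lfun_ofE tilt_endE (phi1 Bphi) mul1mx.
  by rewrite id_lfunE mxmaskK ?thin_coef_supp.
move=> c d; apply/lfunP=> u; apply: thin_coef_inj.
have tE a : lfun_of tilt_end_is_linear a = tilt_end a by rewrite lfun_ofE.
rewrite !tE comp_lfunE !tilt_endE (phiM Bphi).
apply: mxmask_mulmxA (phi_supp Bphi c) (phi_supp Bphi d) (thin_coef_supp u).
by move=> i j k l; rewrite /relation_rel /tilt_supp; lia.
Qed.

End Endomorphisms.
End TiltingModule.

Local Close Scope ring_scope.

(** * Dyck words *)

Section DyckWords.
Implicit Types (w : seq bool) (i n : nat) (rs : seq (nat * nat)).
Local Open Scope nat_scope.

(* One more than the number of up-steps before the (i+1)-st down-step, i.e. the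
   height of the path at abscissa i plus i. *)
Fixpoint ups w i : nat :=
  match w, i with
  | [::], _ => 1
  | true :: w', _ => (ups w' i).+1
  | false :: w', 0 => 1
  | false :: w', i'.+1 => ups w' i'
  end.

Definition points (a h : nat) w : seq (nat * nat) := (a, h) :: scanl lattice_step (a, h) w.

Lemma points_cons a h s w :
  points a h (s :: w) = (a, h) :: (if s then points a h.+1 w else points a.+1 h.-1 w).
Proof. by case: s. Qed.

Lemma ups_gt0 w i : 0 < ups w i.
Proof. by elim: w i => [|[] w IHw] [|i] //=. Qed.

Lemma ups_mono w i j : i <= j -> ups w i <= ups w j.
Proof.
elim: w i j => [|[] w IHw] i j //= le_ij; first by rewrite ltnS IHw.
by case: i j le_ij => [|i] [|j] //= le_ij; [apply: ups_gt0 | apply: IHw].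
Qed.

Lemma ups_le w i : ups w i <= (count_mem true w).+1.
Proof. by elim: w i => [|[] w IHw] [|i] //=; rewrite ?add1n ?add0n ?ltnS ?IHw. Qed.

Lemma ups_ge w i : count_mem false w <= i -> ups w i = (count_mem true w).+1.
Proof.
elim: w i => [|[] w IHw] [|i] //=; rewrite ?add0n ?add1n // => h; first by rewrite IHw.
  by rewrite IHw.
by rewrite IHw.
Qed.

Definition above a h w : bool := all (fun p : nat * nat => 1 <= p.2) (points a h w).

(** Lowest points follow down-steps: just before down-step number [i.+1] the height is
    [h + ups w i - 1 - i], and it must be at least 2. *)
Lemma aboveP a h w : 0 < h ->
  reflect (forall i, i < count_mem false w -> i + 3 <= h + ups w i) (above a h w).
Proof.
rewrite /above; elim: w a h => [|s w IHw] a h h_gt0; first by rewrite /= h_gt0; constructor.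
rewrite points_cons /= h_gt0 /=; case: s => /=.
  by apply: (iffP (IHw _ _ (ltn0Sn h))) => H i; have := H i; rewrite /= ?add0n; lia.
case: (ltnP 1 h) => [h_gt1 | le_h1]; last first.
  have -> : h.-1 = 0 by lia.
  by rewrite /points /=; constructor => /(_ 0); rewrite add1n; lia.
have h1_gt0 : 0 < h.-1 by lia.
apply: (iffP (IHw _ _ h1_gt0)) => [H [|i]|H i]; first by lia.
  by have := H i; rewrite /= ?add1n; lia.
by have := H i.+1; rewrite /= ?add1n; lia.
Qed.

Lemma points_last a h w p0 : above a h w ->
  last p0 (points a h w) = (a + count_mem false w, h + count_mem true w - count_mem false w).
Proof.
rewrite /above; elim: w a h p0 => [|s w IHw] a h p0; first by rewrite /= addn0 addn0 subn0.
rewrite points_cons /= => /andP[h_gt0]; case: s => [H|H]; rewrite IHw //=; congr (_, _); lia.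
Qed.

Lemma points_ge a h w p : p \in points a h w -> a <= p.1.
Proof.
elim: w a h => [|s w IHw] a h; first by rewrite inE => /eqP->.
rewrite points_cons inE => /orP[/eqP-> //|].
by case: s => /IHw // /ltnW.
Qed.

Lemma points_max a h w i : above a h w -> i <= count_mem false w ->
  \max_(p <- points a h w | p.1 == a + i) p.2 + i.+1 = h + ups w i.
Proof.
rewrite /above; elim: w a h i => [|s w IHw] a h i.
  rewrite /= andbT leqn0 => h_gt0 /eqP->.
  by rewrite /points /= big_cons big_nil /= addn0 eqxx maxn0.
rewrite points_cons /= => /andP[h_gt0]; rewrite big_cons /=; case: s => /= H le_i.
  have := IHw a h.+1 i H; rewrite add0n in le_i => /(_ le_i) M.
  case: (eqVneq a (a + i)) => [ea | _]; last by lia.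
  have := ups_gt0 w i; rewrite maxnE; move: M; set m := \max_(p <- _ | _) _; lia.
case: i le_i => [|i] le_i.
  rewrite addn0 eqxx big1_seq ?maxn0 //= => p /andP[/eqP pa /points_ge].
  by rewrite pa ltnn.
have -> : (a == a + i.+1) = false by apply/eqP; lia.
rewrite add1n ltnS in le_i; have := IHw a.+1 h.-1 i H le_i.
by rewrite addSnnS /=; set m := \max_(p <- _ | _) _; lia.
Qed.

Lemma is_dyckP n w :
  reflect [/\ count_mem true w = n, count_mem false w = n &
              forall i, i < n -> i + 2 <= ups w i] (is_dyck n w).
Proof.
rewrite /is_dyck -/(points 0 1 w) -/(above 0 1 w).
apply: (iffP andP) => [[/eqP lastE ab]|[cU cD H]].
  move: lastE; rewrite points_last // add0n => -[cD].
  rewrite cD => cU; split=> //; first by move: cU; move: (count_mem true w) => c; lia.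
  by move=> i lt_i; move/aboveP: ab => /(_ isT i); rewrite cD; lia.
have ab : above 0 1 w by apply/aboveP => // i; rewrite cD => /H; lia.
by split=> //; rewrite points_last // cU cD add0n addnK.
Qed.

Lemma nth_area_sequence n w i : is_dyck n w -> i <= n ->
  nth 0 (area_sequence n w) i = ups w i - i.
Proof.
move=> dw le_in; rewrite nth_mkseq //; have [_ cD _] := is_dyckP _ _ dw.
have ab : above 0 1 w by case/andP: dw.
have := points_max ab (i := i); rewrite cD add0n => /(_ le_in).
by rewrite /lattice_points -/(points 0 1 w); lia.
Qed.

Definition expand rs : seq bool :=
  flatten [seq nseq r.1 true ++ nseq r.2 false | r <- rs].

Definition positive_runs rs : bool := all (fun r : nat * nat => (0 < r.1) && (0 < r.2)) rs.

Lemma ups_expand u d rs i :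
  ups (expand ((u, d) :: rs)) i = if i < d then u.+1 else u + ups (expand rs) (i - d).
Proof.
rewrite /expand /= -catA; elim: u => [|u IHu] /=; last by rewrite IHu; case: ifP.
by elim: d i => [|d IHd] [|i] //=; rewrite IHd subSS ltnS.
Qed.

Lemma ups_cat_nseq w u i : i < count_mem false w -> ups (w ++ nseq u true) i = ups w i.
Proof. by elim: w i => [|[] w IHw] [|i] //=; rewrite ?add0n ?add1n ?ltnS => lt_i; rewrite ?IHw. Qed.

Lemma word_runs w : exists d rs u, positive_runs rs /\
  w = nseq d false ++ expand rs ++ nseq u true.
Proof.
elim: w => [|s w [d [rs [u [rs_pos ->]]]]]; first by exists 0, [::], 0.
case: s; last by exists d.+1, rs, u.
case: d => [|d]; last by exists 0, ((1, d.+1) :: rs), u; split=> //=; rewrite -catA.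
case: rs rs_pos => [|[u1 d1] rs] rs_pos; first by exists 0, [::], u.+1.
exists 0, ((u1.+1, d1) :: rs), u; split=> //.
by case/andP: rs_pos => /andP[_ d1_gt0] rs_pos; rewrite /positive_runs /= d1_gt0.
Qed.

Lemma dyck_runs n w : 0 < n -> is_dyck n w ->
  exists rs, positive_runs rs /\ w = expand rs.
Proof.
move=> n_gt0 /is_dyckP[cU cD H]; have [d [rs [u [rs_pos wE]]]] := word_runs w.
exists rs; split=> //; case: d wE => [|d] wE; last by have := H 0 n_gt0; rewrite wE.
have cD' : count_mem false (expand rs) = n.
  by move: cD; rewrite wE /= count_cat count_nseq /= mul0n addn0.
move: cU; rewrite wE /= count_cat count_nseq /= mul1n => cU.
have := H n.-1; rewrite wE /= ups_cat_nseq ?cD'; last by lia.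
have := ups_le (expand rs) n.-1; case: u {wE} cU => [|u] cU; first by rewrite cats0.
by move=> h1 h2; exfalso; move: cU h1 h2; move: (count_mem true _) (ups _ _) => c k; lia.
Qed.

End DyckWords.

(** * Vertices that witness the obstruction between two valleys *)

Section Valleys.
Local Open Scope nat_scope.
Variables (n : nat) (e : nat -> nat).
Hypotheses (e_mono : forall i j, i <= j -> e i <= e j) (e_le : forall i, e i <= n.+1).
Hypothesis e_gt : forall i, i < n -> i + 2 <= e i.

Lemma crossing a b c : a <= b -> e a <= c -> c < e b ->
  exists k, [/\ a <= k, k < b, e k <= c & c < e k.+1].
Proof.
move=> le_ab eac; elim: b le_ab => [|b IHb] le_ab ceb.
  by move: le_ab; rewrite leqn0 => /eqP ea; rewrite ea in eac; lia.
case: (ltnP c (e b)) => [ceb' | le_ebc].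
  have le_ab' : a <= b by rewrite leqNgt; apply/negP=> lt_ba; have := e_mono (ltnW lt_ba); lia.
  by have [k [? ? ? ?]] := IHb le_ab' ceb'; exists k; split=> //; lia.
exists b; split=> //; rewrite leqNgt; apply/negP=> lt_ba.
have : b.+1 = a by lia.
by move=> eab; rewrite eab in ceb; lia.
Qed.

(** The index [k] makes the relations from [k] to [e k] and from [d2 - 1] to [e (d2 - 1)]
    consecutive. If they overlap, the middle vertices are [d2 - 1] and [e k]; otherwise [e k - 1]
    and [d2], since [e] is constant from [k + 1] to [d2 - 1]. The vertex after [y] in the resulting
    chain is [e x]. *)
Lemma valleys_not_tilted d1 d2 :
    0 < d1 -> d1 < d2 -> d2 <= n -> e d1.-1 < e d1 -> e d2.-1 < e d2 ->
  exists w x y, [/\ w <= x < e w, e w <= y, x <= y < e x, e x < e y & (y <= n)%N].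
Proof.
move=> d1_gt0 lt_d lt_dn v1 v2.
have le1 := @e_mono d1 d2.-1; have [||| k [le_k lt_k ek ek1]] := @crossing d1.-1 d2.-1 (e d2.-1).-1.
- by lia.
- by lia.
- by lia.
have ekE : e k.+1 = e d2.-1 by have := @e_mono k.+1 d2.-1; lia.
have gk := @e_gt k; have gd := @e_gt d2.-1; have ed2 := e_le d2.
case: (leqP d2 (e k)) => [le_dk | lt_kd].
  have := @e_mono d2 (e k); exists k, d2.-1, (e k); split; lia.
have xE : e (e k).-1 = e d2.-1.
  have := @e_mono k.+1 (e k).-1; have := @e_mono (e k).-1 d2.-1; lia.
by exists k, (e k).-1, d2; split; lia.
Qed.

(** The gaps of 2 say that the valleys are more than one down-step and more than one up-step apart.
    If a relation starting at [d - 1] reaches [d2 - 1], the interval from [d2 - 1] to [e (d - 1)] is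
    bad ([near]). Otherwise a relation from [k] ends before [d2 - 1] while that of [k + 1] passes
    it, and a bad interval starts at [e k]. *)
Lemma valleys_not_shod d1 d2 :
    0 < d1 -> d1 + 2 <= d2 -> d2 <= n -> e d1.-1 < e d1 -> e d2.-1 < e d2 ->
    e d1.-1 + 2 <= e d2.-1 ->
  exists k a b, [/\ a <= e k, k < a, e k < b, b <= e a.-1 & [/\ b < e a, e a < e b & a <= n]].
Proof.
move=> d1_gt0 lt_d lt_dn v1 v2 gap.
have near d : 0 < d -> d + 2 <= d2 -> e d.-1 < e d -> e d.-1 + 2 <= e d2.-1 ->
    d2.-1 <= e d.-1 ->
  exists k a b, [/\ a <= e k, k < a, e k < b, b <= e a.-1 & [/\ b < e a, e a < e b & a <= n]].
  move=> d_gt0 lt_dd v g le_d; exists d.-1, d2.-1, (e d.-1).+1.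
  have := @e_mono d d2.-2; have := @e_mono d2 (e d.-1).+1.
  by split; [..| split]; lia.
case: (leqP d2.-1 (e d1.-1)) => [|far]; first exact: near.
have gd2 := @e_gt d2.-1.
have [||| k [le_k lt_k ek ek1]] := @crossing d1.-1 d2.-1 d2.-1; [lia.. |].
have gk := @e_gt k.
case: (ltnP (e k) d2.-1) => [far_k | near_k]; last by apply: (near k.+1) => //=; lia.
have h1 := @e_mono k.+1 (e k).-1; have h2 := @e_mono (e k).-1 (e k).
have h3 := @e_mono (e k) d2.-1.
case: (ltnP d2 (e (e k))) => [lt_e | le_e].
  by exists k, (e k), d2; split; [..| split]; lia.
by exists k, (e k), d2.-1; split; [..| split]; lia.
Qed.

End Valleys.

(** * Shod and tilted paths in terms of runs *)

Section NakayamaDyck.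
Variables (K : fieldType) (n : nat).
Implicit Types (w : seq bool) (rs : seq (nat * nat)).
Local Open Scope nat_scope.
Local Notation rel_of e := (fun i j : 'I_n.+1 => (i <= j < e i)%N).

Lemma ups_ge2 w i : is_dyck n w -> i < n -> i + 2 <= ups w i.
Proof. by case/is_dyckP=> _ _; apply. Qed.

Lemma ups_le_n w i : is_dyck n w -> ups w i <= n.+1.
Proof. by case/is_dyckP=> <- _ _; apply: ups_le. Qed.

Lemma ups_n w : is_dyck n w -> ups w n = n.+1.
Proof. by case/is_dyckP=> cU cD _; rewrite ups_ge ?cU ?cD. Qed.

Lemma ups_gt w i : is_dyck n w -> i <= n -> i < ups w i.
Proof.
move=> dw; rewrite leq_eqVlt => /orP[/eqP-> | lt_in]; first by rewrite ups_n.
by have := ups_ge2 dw lt_in; lia.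
Qed.

Lemma dyck_support_algebra w (A : falgType K) :
    is_dyck n w -> linear_nakayama n A (area_sequence n w) ->
  exists phi : 'Hom(A, 'M[K]_n.+1), support_algebra (rel_of (ups w)) phi.
Proof.
move=> dw /nakayama_support_algebra[i le_in | phi phiP].
  by rewrite nth_area_sequence // subn_gt0 ups_gt.
exists phi; apply: eq_support_algebra phiP => i j.
have le_in : i <= n by rewrite -ltnS.
by rewrite nth_area_sequence // subnKC // ltnW // ups_gt.
Qed.

Lemma dyck_algebra w : is_dyck n w ->
  exists A : falgType K, linear_nakayama n A (area_sequence n w).
Proof.
move=> dw; pose R : 'I_n.+1 -> 'I_n.+1 -> bool := rel_of (ups w).
have Rrefl i : R i i by rewrite /R leqnn ups_gt // -ltnS.
have Rconv : convex_for R R.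
  move=> i j k l; rewrite /R; have := @ups_mono w i j; lia.
exists (thinalg K (ThinRel Rrefl Rconv)).
apply: (@linear_nakayama_thinalg K n _ (ups w)) => //.
- by move=> i j le_ij _; apply: ups_mono.
- by move=> i; apply: ups_ge2.
- by move=> i _; apply: ups_le_n.
- by rewrite size_mkseq.
by move=> i; apply: nth_area_sequence.
Qed.

Lemma count_expand rs :
  count_mem false (expand rs) = sumn [seq r.2 | r <- rs].
Proof.
elim: rs => [|[u d] rs IHrs] //=.
by rewrite /expand /= -catA !count_cat !count_nseq /= mul0n mul1n add0n -IHrs.
Qed.

Lemma count_expand_true rs :
  count_mem true (expand rs) = sumn [seq r.1 | r <- rs].
Proof.
elim: rs => [|[u d] rs IHrs] //=.
by rewrite /expand /= -catA !count_cat !count_nseq /= mul0n mul1n add0n -IHrs.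
Qed.

Definition shod_runs rs : bool :=
  match rs with
  | [:: _; (u, d); _] => (u == 1) || (d == 1)
  | _ => size rs <= 3
  end.

(** With four or more runs the first and the third valley work: two full runs lie between them,
    hence at least two steps of each kind. *)
Lemma not_shod_valleys rs : positive_runs rs -> ~~ shod_runs rs ->
  exists d1 d2, let e := ups (expand rs) in
    [/\ 0 < d1, d1 + 2 <= d2, d2 <= count_mem false (expand rs), e d1.-1 < e d1 &
        e d2.-1 < e d2 /\ e d1.-1 + 2 <= e d2.-1].
Proof.
rewrite /positive_runs count_expand.
case: rs => [|[u1 d1] [|[u2 d2] [|[u3 d3] [|[u4 d4] rs]]]] //= pos bad.
  exists d1, (d1 + d2); rewrite !ups_expand /=.
  by split; [lia | lia | lia | | split]; do ?case: ifPn; lia.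
exists d1, (d1 + d2 + d3); rewrite !ups_expand /=.
by split; [lia | lia | lia | | split]; do ?case: ifPn; lia.
Qed.

Lemma shod_dyckP w rs : 0 < n -> positive_runs rs -> w = expand rs -> is_dyck n w ->
  (exists A : falgType K, linear_nakayama n A (area_sequence n w) /\ shod A) <->
  shod_runs rs.
Proof.
move=> n_gt0 rs_pos wE dw; have e_mono : forall i j, i <= j -> ups w i <= ups w j.
  by move=> i j; apply: ups_mono.
have e_mono' : forall i j, i <= j -> j <= n -> ups w i <= ups w j.
  by move=> i j le_ij _; apply: ups_mono.
have e_le i : ups w i <= n.+1 by apply: ups_le_n.
have e_le' i : i <= n -> ups w i <= n.+1 by [].
split=> [[A [nakA shodA]] | good].
  have [phi phiP] := dyck_support_algebra dw nakA.
  apply: contraT => bad; have [d1 [d2 []]] := not_shod_valleys rs_pos bad.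
  rewrite -wE => d1_gt0 lt_d; have [_ -> e_gt] := is_dyckP _ _ dw => le_d v1 [v2 gap].
  have [k [a [b [h1 h2 h3 h4 [h5 h6 h7]]]]] :=
    valleys_not_shod e_mono e_gt d1_gt0 lt_d le_d v1 v2 gap.
  by have /(shodP phiP e_mono' e_le')/(_ k a b) := shodA; case.
have [A nakA] := dyck_algebra dw; exists A; split=> //.
have [phi phiP] := dyck_support_algebra dw nakA.
apply/(shodP phiP e_mono' e_le') => k a b h1 h2 h3 h4 h5 h6 _.
move: h1 h3 h4 h5 h6; rewrite wE; clear - rs_pos good h2; move: rs_pos; rewrite /positive_runs.
case: rs good => [|[u1 d1] [|[u2 d2] [|[u3 d3] [|[u4 d4] rs]]]] //= good pos;
  rewrite !ups_expand /=; do ?case: ifPn; lia.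
Qed.

Lemma tilted_dyckP w rs : 0 < n -> positive_runs rs -> w = expand rs -> is_dyck n w ->
  (exists A : falgType K, linear_nakayama n A (area_sequence n w) /\ tilted A) <->
  size rs <= 2.
Proof.
move=> n_gt0 rs_pos wE dw; have e_mono : forall i j, i <= j -> ups w i <= ups w j.
  by move=> i j; apply: ups_mono.
have e_le i : ups w i <= n.+1 by apply: ups_le_n.
have [_ cD e_gt] := is_dyckP _ _ dw.
split=> [[A [nakA tiltA]] | good].
  have [phi phiP] := dyck_support_algebra dw nakA.
  apply: contraT; case: rs rs_pos wE => [|[u1 d1] [|[u2 d2] [|[u3 d3] rs]]] //= pos wE _.
  have [||||| x [y [z [h1 h2 h3 h4 h5]]]] :=
      @valleys_not_tilted n _ e_mono e_le e_gt d1 (d1 + d2).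
  - by lia.
  - by lia.
  - by move: cD; rewrite wE count_expand /=; lia.
  - by rewrite wE !ups_expand; do ?case: ifPn; lia.
  - by rewrite wE !ups_expand; do ?case: ifPn; lia.
  (* The fourth vertex for [not_tilted] is [ups w y], the first one that no path from [y]
     reaches. *)
  have lt_zn : ups w y < n.+1 by have := e_le z; lia.
  have lt_xn : x < n.+1 by lia.
  have lt_yn : y < n.+1 by lia.
  have lt_zn' : z < n.+1 by lia.
  case: (@not_tilted _ _ _ _ _ phiP (Ordinal lt_xn) (Ordinal lt_yn) (Ordinal lt_zn')
    (Ordinal lt_zn)) => //=; lia.
have [A nakA] := dyck_algebra dw; exists A; split=> //.
have [phi phiP] := dyck_support_algebra dw nakA.
(* The single relation kills the paths from before [x] to [b] or beyond. With one valley, [x = d1]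
   and [b = u1.+1]; without valleys, [x = 0] and [b = n.+1] impose nothing. *)
suff [x [b [lt_xb le_bn eE]]] : exists x b, [/\ x < b, b <= n.+1 &
    forall i, i <= n -> ups w i = if i < x then b else n.+1].
  apply: (@relation_tilted K n x b lt_xb le_bn A phi).
  apply: eq_support_algebra phiP => i j; have le_in : i <= n by rewrite -ltnS.
  rewrite /relation_rel eE //.
  by have := ltn_ord j; case: ifP; lia.
have [cU _ _] := is_dyckP _ _ dw; move: rs_pos cU cD; rewrite /positive_runs.
have e_gt' := e_gt; rewrite wE in e_gt'; clear - n_gt0 wE good e_gt'.
case: rs wE good e_gt' => [|[u1 d1] [|[u2 d2] [|r rs]]] //= -> _ e_gt;
  rewrite ?count_expand ?count_expand_true /= => pos cU cD.
- by lia.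
- exists 0, n.+1; split=> // i _; rewrite ups_expand /=; case: ifP => _; lia.
exists d1, u1.+1; split; last first.
- move=> i _; rewrite !ups_expand /=; case: ifP => // _; case: ifP => _; lia.
- by lia.
have := e_gt d1.-1; rewrite ups_expand ifT; lia.
Qed.

End NakayamaDyck.

(** * Permutations *)

Section Patterns.
Local Open Scope nat_scope.
Variables (n : nat) (s : 'S_n).
Implicit Types i j k l : 'I_n.

Lemma contains132P : contains_pattern [:: 1; 3; 2] s <->
  exists i j k, [/\ i < j, j < k, s i < s k & s k < s j].
Proof.
split=> [[f [f_lt f_ord]] | [i [j [k [lt_ij lt_jk lt_ik lt_kj]]]]].
  pose o a (lt_a : a < 3) : 'I_(size [:: 1; 3; 2]) := Ordinal lt_a.
  exists (f (o 0 isT)), (f (o 1 isT)), (f (o 2 isT)).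
  by rewrite !f_ord; split=> //; apply: f_lt.
exists (fun a : 'I_3 => nth i [:: i; j; k] a).
by split=> -[[|[|[|a]]] lt_a] // [[|[|[|b]]] lt_b] //=; lia.
Qed.

Lemma contains321P : contains_pattern [:: 3; 2; 1] s <->
  exists i j k, [/\ i < j, j < k, s k < s j & s j < s i].
Proof.
split=> [[f [f_lt f_ord]] | [i [j [k [lt_ij lt_jk lt_kj lt_ji]]]]].
  pose o a (lt_a : a < 3) : 'I_(size [:: 3; 2; 1]) := Ordinal lt_a.
  exists (f (o 0 isT)), (f (o 1 isT)), (f (o 2 isT)).
  by rewrite !f_ord; split=> //; apply: f_lt.
exists (fun a : 'I_3 => nth i [:: i; j; k] a).
by split=> -[[|[|[|a]]] lt_a] // [[|[|[|b]]] lt_b] //=; lia.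
Qed.

Lemma contains4321P : contains_pattern [:: 4; 3; 2; 1] s <->
  exists i j k l, [/\ i < j, j < k, k < l & [/\ s l < s k, s k < s j & s j < s i]].
Proof.
split=> [[f [f_lt f_ord]] | [i [j [k [l [lt_ij lt_jk lt_kl [h1 h2 h3]]]]]]].
  pose o a (lt_a : a < 4) : 'I_(size [:: 4; 3; 2; 1]) := Ordinal lt_a.
  exists (f (o 0 isT)), (f (o 1 isT)), (f (o 2 isT)), (f (o 3 isT)).
  by rewrite !f_ord; split=> //; apply: f_lt.
exists (fun a : 'I_4 => nth i [:: i; j; k; l] a).
by split=> -[[|[|[|[|a]]]] lt_a] // [[|[|[|[|b]]]] lt_b] //=; lia.
Qed.

Lemma contains4231P : contains_pattern [:: 4; 2; 3; 1] s <->
  exists i j k l, [/\ i < j, j < k, k < l & [/\ s l < s j, s j < s k & s k < s i]].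
Proof.
split=> [[f [f_lt f_ord]] | [i [j [k [l [lt_ij lt_jk lt_kl [h1 h2 h3]]]]]]].
  pose o a (lt_a : a < 4) : 'I_(size [:: 4; 2; 3; 1]) := Ordinal lt_a.
  exists (f (o 0 isT)), (f (o 1 isT)), (f (o 2 isT)), (f (o 3 isT)).
  by rewrite !f_ord; split=> //; apply: f_lt.
exists (fun a : 'I_4 => nth i [:: i; j; k; l] a).
by split=> -[[|[|[|[|a]]]] lt_a] // [[|[|[|[|b]]]] lt_b] //=; lia.
Qed.

End Patterns.

(** * Left-to-right minima and the runs of the path *)

Section Minima.
Local Open Scope nat_scope.
Variables (n : nat) (s : 'S_n).
Local Notation w := (one_line s).
Local Notation pos := (lrmin_positions w).
Implicit Types i j k : 'I_n.

Lemma size_one_line : size w = n.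
Proof. by rewrite size_map size_enum_ord. Qed.

Lemma nth_one_line i : nth 0 w i = (s i).+1.
Proof. by rewrite (nth_map i) ?size_enum_ord // nth_ord_enum. Qed.

Lemma mem_lrmin i : ((i : nat) \in pos) = [forall j : 'I_n, (j < i) ==> (s i < s j)].
Proof.
rewrite mem_filter mem_iota size_one_line ltn_ord andbT leq0n andbT nth_one_line.
apply/allP/forallP=> [H j | H j]; first apply/implyP=> lt_ji.
  by have := H j; rewrite mem_iota nth_one_line ltnS; apply.
rewrite mem_iota add0n /= => lt_ji; have lt_jn := ltn_trans lt_ji (ltn_ord i).
by have /implyP := H (Ordinal lt_jn);
  rewrite -[j]/(nat_of_ord (Ordinal lt_jn)) nth_one_line ltnS; apply.
Qed.

Lemma pos_lt a : a \in pos -> a < n.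
Proof. by rewrite mem_filter mem_iota size_one_line => /andP[_]. Qed.

Lemma pos_sorted : sorted ltn pos.
Proof. exact: (sorted_filter ltn_trans _ (iota_ltn_sorted 0 _)). Qed.

(* The last run starts at n, beyond the end of w. *)
Definition lrpos t := nth n pos t.

Lemma lrpos_lt t : t < size pos -> lrpos t < n.
Proof. by move=> lt_t; apply: pos_lt; apply: mem_nth. Qed.

Lemma lrpos_size : lrpos (size pos) = n.
Proof. exact: nth_default. Qed.

Lemma lrpos_ltS t : t < size pos -> lrpos t < lrpos t.+1.
Proof.
move=> lt_t; case: (ltnP t.+1 (size pos)) => [lt_t1 | le_t].
  by apply: (sorted_ltn_nth ltn_trans n pos_sorted) => //; rewrite inE.
by rewrite [lrpos t.+1]nth_default // lrpos_lt.
Qed.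

Lemma lrpos_mem t i : t < size pos -> lrpos t = i -> forall j, j < i -> s i < s j.
Proof.
move=> lt_t ei j lt_ji; have : (i : nat) \in pos by rewrite -ei mem_nth.
by rewrite mem_lrmin => /forallP/(_ j)/implyP; apply.
Qed.

Lemma lrpos_index i : (forall j, j < i -> s i < s j) ->
  exists2 t, t < size pos & lrpos t = i.
Proof.
move=> min_i; have : (i : nat) \in pos.
  by rewrite mem_lrmin; apply/forallP=> j; apply/implyP; apply: min_i.
by move=> ip; exists (index (i : nat) pos); rewrite ?index_mem // /lrpos nth_index.
Qed.

Lemma lrminS t i : t < size pos -> lrpos t = i -> lrmin w t.+1 = (s i).+1.
Proof.
move=> lt_t ei; rewrite /= [nth 0 pos t](set_nth_default n) // -/(lrpos t) ei.
exact: nth_one_line.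
Qed.

Lemma lrgapE t : lrgap w t.+1 = lrpos t.+1 - (lrpos t).+1.
Proof. by rewrite /lrgap size_one_line. Qed.

Lemma lrmin_ltS t : t < size pos -> lrmin w t.+1 < lrmin w t.
Proof.
move=> lt_t; pose i := Ordinal (lrpos_lt lt_t).
rewrite (@lrminS t i) //; case: t lt_t @i => [|t] lt_t i.
  by rewrite /= size_one_line ltnS.
have lt_t' : t < size pos by apply: ltnW.
rewrite (@lrminS t (Ordinal (lrpos_lt lt_t'))) // ltnS.
by apply: (lrpos_mem (i := i) lt_t erefl); apply: lrpos_ltS.
Qed.

Definition run t := ((lrgap w t).+1, lrmin w t.-1 - lrmin w t).
Definition runs t := [seq run a | a <- rev (iota 1 t)].

Lemma runsS t : runs t.+1 = run t.+1 :: runs t.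
Proof.
have iotaS : iota 1 t.+1 = rcons (iota 1 t) t.+1 by rewrite -{1}[t.+1]addn1 iotaD cats1.
by rewrite /runs iotaS rev_rcons.
Qed.

Lemma krattenthalerE : krattenthaler s = expand (runs (size pos)).
Proof. by rewrite /krattenthaler /krattenthaler_word /expand /runs -map_comp. Qed.

Lemma size_runs t : size (runs t) = t.
Proof. by rewrite size_map size_rev size_iota. Qed.

Lemma runs_positive t : t <= size pos -> positive_runs (runs t).
Proof.
elim: t => // t IHt lt_t; rewrite runsS /positive_runs /= subn_gt0 lrmin_ltS //=.
exact/IHt/ltnW.
Qed.

(* The values at positions before the t-th minimum are distinct and at least the
   previous minimum. *)
Lemma lrpos_lrmin t : t < size pos -> lrpos t + lrmin w t <= n.+1.
Proof.
case: t => [|t] lt_t.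
  rewrite /= size_one_line; suff -> : lrpos 0 = 0 by [].
  have n_gt0 : 0 < n by have := lrpos_lt lt_t; lia.
  have [[|t] lt_t' e0] : exists2 t, t < size pos & lrpos t = Ordinal n_gt0.
    by apply: lrpos_index.
  - by rewrite e0.
  have : lrpos 0 < lrpos t.+1.
    by apply: (sorted_ltn_nth ltn_trans n pos_sorted); rewrite ?inE.
  by rewrite e0.
have lt_t' : t < size pos by apply: ltnW.
pose i := Ordinal (lrpos_lt lt_t'); rewrite (@lrminS t i) //.
(* A smaller value would produce a left-to-right minimum strictly between two consecutive ones, or
   contradict the minimality of [s i]. *)
have small j : j < lrpos t.+1 -> s i <= s j.
  move: j; suff H m : forall j, j < m -> j < lrpos t.+1 -> s i <= s j.
    by move=> j; apply: (H j.+1).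
  elim: m => // m IHm j; rewrite ltnS leq_eqVlt => /orP[/eqP jm lt_j | lt_jm]; last exact: IHm.
  rewrite leqNgt; apply/negP=> lt_s.
  have [k lt_k ek] : exists2 k, k < size pos & lrpos k = j.
    apply: lrpos_index => j' lt_j'; apply: leq_trans lt_s _.
    by apply: IHm; [rewrite -jm | apply: ltn_trans lt_j' lt_j].
  have lt_kt : k < t.+1.
    rewrite ltnNge; apply/negP=> le_tk; move: lt_j; rewrite -ek.
    move: le_tk; rewrite leq_eqVlt => /orP[/eqP-> | lt_tk]; first by rewrite ltnn.
    by rewrite ltnNge ltnW //; apply: (sorted_ltn_nth ltn_trans n pos_sorted); rewrite ?inE.
  move: lt_kt; rewrite ltnS leq_eqVlt => /orP[/eqP e | lt_kt].
    have ij : i = j by apply: val_inj; rewrite /= -ek e.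
    by rewrite ij ltnn in lt_s.
  have lt_ji : j < i.
    by rewrite -ek /=; apply: (sorted_ltn_nth ltn_trans n pos_sorted); rewrite ?inE.
  by have := lrpos_mem lt_t' (erefl : lrpos t = i) lt_ji; rewrite ltnNge ltnW.
have le_pn : lrpos t.+1 <= n by apply/ltnW/lrpos_lt.
have : #|[set s j | j in [pred j : 'I_n | j < lrpos t.+1]]| <= #|[pred k : 'I_n | s i <= k]|.
  apply: subset_leq_card; apply/fintype.subsetP=> _ /imsetP[j lt_j ->].
  by rewrite inE small.
rewrite card_imset; last exact: perm_inj.
have card_ge a : a <= n -> #|[pred k : 'I_n | a <= k]| = n - a.
  case: n => [|m] le_a; first by rewrite eq_card0 // => -[].
  rewrite -(card_ord_interval (n := m) a (leqnn _)).
  by apply: eq_card => k; rewrite !inE ltn_ord andbT.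
have card_lt a : a <= n -> #|[pred k : 'I_n | k < a]| = a.
  case: n => [|m] le_a; first by rewrite eq_card0 //; [lia | case].
  by rewrite -[RHS]subn0 -(card_ord_interval (n := m) 0 le_a); apply: eq_card.
by rewrite card_ge ?card_lt //; have := ltn_ord (s i); lia.
Qed.

Lemma lrmin_size : 0 < n -> lrmin w (size pos) = 1.
Proof.
move=> n_gt0; pose i := (s^-1)%g (Ordinal n_gt0).
have si : s i = Ordinal n_gt0 by rewrite permKV.
have [t lt_t et] : exists2 t, t < size pos & lrpos t = i.
  apply: lrpos_index => j lt_ji; rewrite si lt0n; apply: contraTneq lt_ji => sj0.
  suff -> : j = i by rewrite ltnn.
  by apply: (@perm_inj _ s); rewrite si; apply: val_inj.
have mt : lrmin w t.+1 = 1 by rewrite (lrminS lt_t et) si.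
move: lt_t; rewrite leq_eqVlt => /orP[/eqP<- // | lt_t].
have := lrmin_ltS lt_t; rewrite mt.
by have := lrminS lt_t (erefl : lrpos t.+1 = Ordinal (lrpos_lt lt_t)); lia.
Qed.

Lemma krattenthaler_dyck : 0 < n -> is_dyck n (krattenthaler s).
Proof.
move=> n_gt0; have pos_gt0 : 0 < size pos.
  by case E: (size pos) (lrmin_size n_gt0) => //; rewrite /= size_one_line; lia.
have lrpos0 : lrpos 0 = 0.
  by have := lrpos_lrmin pos_gt0; rewrite /= size_one_line; lia.
have le_m t : t <= size pos -> lrmin w t <= n.+1.
  elim: t => [|t IHt] lt_t; first by rewrite /= size_one_line.
  by have := lrmin_ltS lt_t; have := IHt (ltnW lt_t); lia.
have sumU t : t <= size pos -> sumn [seq r.1 | r <- runs t] = lrpos t.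
  elim: t => [|t IHt] lt_t; first by rewrite lrpos0.
  rewrite runsS /= IHt 1?ltnW // lrgapE; have := lrpos_ltS lt_t; lia.
have sumD t : t <= size pos -> sumn [seq r.2 | r <- runs t] = n.+1 - lrmin w t.
  elim: t => [|t IHt] lt_t; first by rewrite /= size_one_line subnn.
  rewrite runsS -[LHS]/((lrmin w t - lrmin w t.+1) + sumn [seq r.2 | r <- runs t]).
  rewrite IHt 1?ltnW //; have := lrmin_ltS lt_t; have := le_m _ lt_t.
  have := le_m t (ltnW lt_t).
  move: (lrmin w t) (lrmin w t.+1) => a b; lia.
rewrite krattenthalerE; apply/is_dyckP; split.
- by rewrite count_expand_true sumU // lrpos_size.
- by rewrite count_expand sumD // lrmin_size // subn1.
(* [runs t] is the tail of the path, preceded by [n - lrpos s t] up-steps and [lrmin w t - 1]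
   down-steps; with these offsets the inequality is the Dyck condition for the down-steps in the
   tail. *)
suff H t (i : nat) : t <= size pos -> i < n.+1 - lrmin w t ->
    i + lrmin w t + 1 <= ups (expand (runs t)) i + (n - lrpos t).
  by move=> i lt_in; have := H (size pos) i (leqnn _); rewrite lrmin_size // lrpos_size; lia.
elim: t i => [|t IHt] i lt_t; first by rewrite /= size_one_line subnn.
rewrite runsS ups_expand lrgapE; have := lrpos_ltS lt_t; have := lrmin_ltS lt_t.
have := lrpos_lrmin lt_t; rewrite -[lrmin w t.+1.-1]/(lrmin w t).
have := IHt (i - (lrmin w t - lrmin w t.+1)) (ltnW lt_t).
have : lrpos t.+1 <= n.
  move: lt_t; rewrite leq_eqVlt => /orP[/eqP-> | /lrpos_lt/ltnW //].
  by rewrite lrpos_size.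
have := le_m _ lt_t.
move: (lrmin w t) (lrmin w t.+1) (lrpos t) (lrpos t.+1) => a b c d.
by case: ifP; lia.
Qed.

End Minima.

Section ExpandInjective.
Local Open Scope nat_scope.

Lemma index_nseq_cat (b : bool) k (l : seq bool) :
  index b (nseq k (~~ b) ++ l) = k + index b l.
Proof. by elim: k => //= k ->; case: b. Qed.

Lemma expand_inj rs rs' : positive_runs rs -> positive_runs rs' ->
  expand rs = expand rs' -> rs = rs'.
Proof.
have hd u d l : 0 < d -> index false (expand ((u, d) :: l)) = u.
  by case: d => // d _; rewrite /expand /= -catA (index_nseq_cat false) addn0.
have tl u d l : drop u (expand ((u, d) :: l)) = nseq d false ++ expand l.
  by rewrite /expand /= -catA drop_size_cat ?size_nseq.
have it l : positive_runs l -> index true (expand l) = 0.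
  by case: l => // -[[|u] d] l.
elim: rs rs' => [|[u d] rs IHrs] [|[u' d'] rs'] //=.
- by move=> _ /andP[/andP[]]; case: u'.
- by move=> /andP[/andP[]]; case: u.
move=> /andP[/andP[/= u_gt0 d_gt0] rs_pos] /andP[/andP[/= u'_gt0 d'_gt0] rs'_pos] E.
have eu : u = u' by rewrite -(hd u d rs) // E hd.
have := congr1 (drop u) E; rewrite {3}eu !tl => E'.
have ed : d = d'.
  have := congr1 (index true) E'.
  by rewrite !(index_nseq_cat true) !it // !addn0.
move/(congr1 (drop d)): E'; rewrite {3}ed !drop_size_cat ?size_nseq //.
by move/(IHrs _ rs_pos rs'_pos) ->; rewrite eu ed.
Qed.

End ExpandInjective.

(* In one-line notation and for values counted from 0, the permutation whose runs
   (in the order of the permutation) are M, M+1, ... (p letters), then A followed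
   by the letters still unused after M+p-1 (q letters in total), and finally the
   remaining letters in increasing order. *)
Section ShapeFunction.
Local Open Scope nat_scope.
Variables p q A M : nat.

Definition shape_fun i :=
  if i < p then M + i else if i == p then A else if i < p + q then M + i.-1
  else if i - (p + q) < A then i - (p + q)
  else if i - (p + q) < M.-1 then (i - (p + q)).+1 else i.

Lemma shape_funP i :
  [\/ i < p /\ shape_fun i = M + i, i = p /\ shape_fun i = A,
      [/\ p < i, i < p + q & shape_fun i = M + i.-1] |
      p + q <= i /\ [\/ i - (p + q) < A /\ shape_fun i = i - (p + q),
        [/\ A <= i - (p + q), i - (p + q) < M.-1 & shape_fun i = (i - (p + q)).+1] |
        M.-1 <= i - (p + q) /\ shape_fun i = i]].
Proof.
rewrite /shape_fun; case: ltnP => [|le_p]; first by constructor 1.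
case: eqP => [|ne_p]; first by constructor 2.
case: ltnP => [|le_pq]; first by constructor 3; split=> //; lia.
constructor 4; split=> //; case: ltnP => [|le_A]; first by constructor 1.
by case: ltnP => [|le_M]; [constructor 2 | constructor 3].
Qed.

End ShapeFunction.

Section Krattenthaler.
Local Open Scope nat_scope.
Variable n : nat.
Hypothesis n_gt0 : 0 < n.
Implicit Types s : 'S_n.
Local Notation npos s := (size (lrmin_positions (one_line s))).

Lemma npos_gt0 s : 0 < npos s.
Proof.
by case E: (npos s) (lrmin_size s n_gt0) => //; rewrite /= size_one_line; lia.
Qed.

Lemma lrpos0 s : lrpos s 0 = 0.
Proof. by have := lrpos_lrmin (npos_gt0 s); rewrite /= size_one_line; lia. Qed.

Lemma runs_inj s s' t : runs s t = runs s' t ->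
  forall a, a < t -> run s a.+1 = run s' a.+1.
Proof.
elim: t => // t IHt; rewrite !runsS => -[e1 e2 /IHt IH] a; rewrite ltnS leq_eqVlt.
by case/orP=> [/eqP-> | /IH //]; rewrite /run e1 e2.
Qed.

Lemma same_minima s s' : krattenthaler s = krattenthaler s' ->
  npos s = npos s' /\ forall t, t <= npos s ->
    lrpos s t = lrpos s' t /\ lrmin (one_line s) t = lrmin (one_line s') t.
Proof.
rewrite !krattenthalerE => /(expand_inj (runs_positive (leqnn _)) (runs_positive (leqnn _))) E.
have eq_n : npos s = npos s' by rewrite -(size_runs s (npos s)) E size_runs.
split=> //; rewrite -eq_n in E; have runE := runs_inj E.
elim=> [_|t IHt lt_t]; first by rewrite !lrpos0 /= !size_one_line.
have [ep em] := IHt (ltnW lt_t).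
have eg : lrgap (one_line s) t.+1 = lrgap (one_line s') t.+1.
  exact/succn_inj/(congr1 fst (runE t lt_t)).
have ed : lrmin (one_line s) t - lrmin (one_line s) t.+1 =
          lrmin (one_line s') t - lrmin (one_line s') t.+1.
  exact: (congr1 snd (runE t lt_t)).
have lt_t' : t < npos s' by rewrite -eq_n.
move: eg; rewrite !lrgapE; have := lrpos_ltS lt_t; have := lrpos_ltS lt_t'.
move: ed (lrmin_ltS lt_t) (lrmin_ltS lt_t'); move: ep em.
move: (lrpos s t) (lrpos s' t) (lrpos s t.+1) (lrpos s' t.+1) => a b c d.
move: (lrmin (one_line s) t) (lrmin (one_line s') t) => a' b'.
by move: (lrmin (one_line s) t.+1) (lrmin (one_line s') t.+1) => c' d'; lia.
Qed.

(** If [s' i] were larger, the value [s i] would occur in [s'] after position [i], and with [j] and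
    [i] it would form a 132. *)
Lemma avoid132_step s s' (i j : 'I_n) :
    ~ contains_pattern [:: 1; 3; 2] s' ->
    (forall k : 'I_n, k < i -> s k = s' k) ->
  j < i -> s j < s i -> s' i <= s i.
Proof.
move=> av agree lt_ji lt_s; rewrite leqNgt; apply/negP=> lt_i; apply: av.
apply/contains132P; pose k := (s'^-1)%g (s i); have s'k : s' k = s i by rewrite permKV.
exists j, i, k; rewrite s'k -(agree j) //; split=> //.
case: (ltngtP k i) => // [lt_ki | /val_inj ek].
  have ki : k = i by apply: (@perm_inj _ s); rewrite agree.
  by rewrite ki ltnn in lt_ki.
by rewrite -s'k ek ltnn in lt_i.
Qed.

(** Induction on positions. The values at the minima are determined by the path; at any other
    position both permutations have a smaller earlier value, and [avoid132_step] applies in both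
    directions. *)
Lemma krattenthaler_inj s s' :
  ~ contains_pattern [:: 1; 3; 2] s -> ~ contains_pattern [:: 1; 3; 2] s' ->
  krattenthaler s = krattenthaler s' -> s = s'.
Proof.
move=> av av' /same_minima[eq_n same]; apply/permP=> i.
suff H m : forall i : 'I_n, i < m -> s i = s' i by apply: (H i.+1).
elim: m => // m IHm {}i; rewrite ltnS leq_eqVlt => /orP[/eqP im | ]; last exact: IHm.
have agree (k : 'I_n) : k < i -> s k = s' k by rewrite im; apply: IHm.
have at_min t : t < npos s -> lrpos s t = i -> s i = s' i.
  move=> lt_t et; have [_ em] := same t.+1 lt_t; have [et' _] := same t (ltnW lt_t).
  move: em; rewrite (lrminS lt_t et) (@lrminS _ s' t i) -?eq_n // -?et' //.
  by case=> /val_inj.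
case: (pickP (fun j : 'I_n => (j < i) && (s j < s i))) => [j /andP[lt_j lt_s] | no_j].
  case: (pickP (fun j : 'I_n => (j < i) && (s' j < s' i))) => [j' /andP[lt_j' lt_s'] | no_j'].
    apply: val_inj; apply/eqP; rewrite eqn_leq (avoid132_step av' agree lt_j lt_s) andbT.
    by apply: (avoid132_step av _ lt_j' lt_s') => k /agree.
  have [k lt_kj|t lt_t et] := @lrpos_index _ s' i.
    rewrite ltn_neqAle leqNgt; have := no_j' k; rewrite lt_kj /= => ->; rewrite andbT.
    by apply: contraTneq lt_kj => /val_inj/perm_inj->; rewrite ltnn.
  rewrite -eq_n in lt_t; apply: (at_min t) => //.
  by have [-> _] := same t (ltnW lt_t).
have [k lt_kj|t lt_t et] := @lrpos_index _ s i; last exact: (at_min t).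
rewrite ltn_neqAle leqNgt; have := no_j k; rewrite lt_kj /= => ->; rewrite andbT.
by apply: contraTneq lt_kj => /val_inj/perm_inj->; rewrite ltnn.
Qed.

Section Minima.
Variable s : 'S_n.

Lemma minimum_at t : t < npos s -> exists i : 'I_n, [/\ lrpos s t = i,
  lrmin (one_line s) t.+1 = (s i).+1 & forall j : 'I_n, j < i -> s i < s j].
Proof.
move=> lt_t; exists (Ordinal (lrpos_lt lt_t)); split=> //; first exact: lrminS.
exact: (lrpos_mem (i := Ordinal (lrpos_lt lt_t)) lt_t erefl).
Qed.

Lemma avoid321_runs : ~ contains_pattern [:: 3; 2; 1] s -> npos s <= 2.
Proof.
move=> av; rewrite leqNgt; apply/negP=> gt2; apply: av; apply/contains321P.
have [i [ei _ mi]] := minimum_at (ltnW (ltnW gt2)).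
have [j [ej _ mj]] := minimum_at (ltnW gt2).
have [k [ek _ mk]] := minimum_at gt2.
have lt_ij : i < j by rewrite -ei -ej; apply: lrpos_ltS; apply: ltnW (ltnW _).
have lt_jk : j < k by rewrite -ej -ek; apply: lrpos_ltS; apply: ltnW.
by exists i, j, k; rewrite mk // mj.
Qed.

Lemma avoid4321_runs : ~ contains_pattern [:: 4; 3; 2; 1] s -> npos s <= 3.
Proof.
move=> av; rewrite leqNgt; apply/negP=> gt3; apply: av; apply/contains4321P.
have gt2 := ltnW gt3; have gt1 := ltnW gt2; have gt0 := ltnW gt1.
have [i [ei _ mi]] := minimum_at gt0.
have [j [ej _ mj]] := minimum_at gt1.
have [k [ek _ mk]] := minimum_at gt2.
have [l [el _ ml]] := minimum_at gt3.
have lt_ij : i < j by rewrite -ei -ej lrpos_ltS.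
have lt_jk : j < k by rewrite -ej -ek lrpos_ltS.
have lt_kl : k < l by rewrite -ek -el lrpos_ltS.
by exists i, j, k, l; rewrite ml // mk // mj.
Qed.

(** Suppose there are three minima, at [i], [j], [l], the middle run has a second letter, at [y],
    and the value just below [s i] exceeds [s j]. That value occurs at some [x] after [j], as all
    values before [j] are at least [s i]. If [x < l], then [i, j, x, l] is a 4231. Otherwise
    [i, j, y, l] is a 4231 or [j, y, x] is a 132, according to the order of [s y] and [s x]. *)
Lemma avoid_shod_runs : ~ contains_pattern [:: 1; 3; 2] s ->
    ~ contains_pattern [:: 4; 3; 2; 1] s -> ~ contains_pattern [:: 4; 2; 3; 1] s ->
  shod_runs (runs s (npos s)).
Proof.
move=> av132 /avoid4321_runs le3 av4231.
case E: (npos s) le3 => [|[|[|[|]]]] // _; rewrite !runsS.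
rewrite -[shod_runs _]/(((lrgap (one_line s) 2).+1 == 1) ||
  (lrmin (one_line s) 1 - lrmin (one_line s) 2 == 1)).
apply: contraT; rewrite negb_or => /andP[gap2 d2].
have [i [ei mi _]] := @minimum_at 0 (npos_gt0 s).
have [j [ej mj minj]] := @minimum_at 1 ltac:(by rewrite E).
have [l [el _ minl]] := @minimum_at 2 ltac:(by rewrite E).
have lt_ij : i < j by rewrite -ei -ej lrpos_ltS ?E.
have lt_jl : j < l by rewrite -ej -el lrpos_ltS ?E.
have lt_s : s j < s i by apply: minj.
have lt_sl : s l < s j by apply: minl.
have i0 : i = 0 :> nat by rewrite -ei lrpos0.
have lt_gap : j.+1 < l.
  by move: gap2; rewrite lrgapE ej el eqSS subn_eq0 -ltnNge.
have gap_v : s j + 1 < s i.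
  by move: d2; rewrite mi mj; lia.
have lt_yn : j.+1 < n by apply: ltn_trans lt_gap _.
pose y := Ordinal lt_yn.
have lt_vn : (s i).-1 < n by have := ltn_ord (s i); lia.
pose x := (s^-1)%g (Ordinal lt_vn); have sx : s x = (s i).-1 :> nat by rewrite permKV.
have lt_jx : j < x.
  case: (ltngtP x j) => // [lt_xj | /val_inj ex]; last by move: sx; rewrite ex; lia.
  have : x < j -> s i <= s x.
    move: x {sx lt_xj}; suff H m : forall z : 'I_n, z < m -> z < j -> s i <= s z.
      by move=> x; apply: (H x.+1).
    elim: m => // m IHm z; rewrite ltnS leq_eqVlt => /orP[/eqP zm lt_zj | ]; last exact: IHm.
    rewrite leqNgt; apply/negP=> lt_zi.
    have [t lt_t et] : exists2 t, t < npos s & lrpos s t = z.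
      apply: lrpos_index => z' lt_z'; apply: leq_trans lt_zi _.
      by apply: IHm; [rewrite -zm | apply: ltn_trans lt_z' lt_zj].
    case: t lt_t et => [|[|[|t]]] lt_t et; last by move: lt_t; rewrite E.
    - by have iz : i = z; [apply: val_inj; rewrite /= -ei et | rewrite iz ltnn in lt_zi].
    - by move: lt_zj; rewrite -et ej ltnn.
    by move: lt_zj; rewrite -et el; lia.
  by move/(_ lt_xj); lia.
have lt_ly : s j < s y.
  case: (pickP (fun z : 'I_n => (z < y) && (s z < s y))) => [z /andP[lt_zy lt_zs] | no_z].
    have le_zj : z <= j by [].
    apply: leq_ltn_trans lt_zs; move: le_zj; rewrite leq_eqVlt.
    by case/orP=> [/eqP/val_inj-> // | /minj/ltnW].
  have [z lt_zy|t lt_t et] := @lrpos_index _ s y.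
    rewrite ltn_neqAle leqNgt; have := no_z z; rewrite lt_zy /= => ->; rewrite andbT.
    by apply: contraTneq lt_zy => /val_inj/perm_inj->; rewrite ltnn.
  move: et; case: t lt_t => [|[|[|t]]] lt_t; rewrite ?ei ?ej ?el /=; [lia.. |].
  by move: lt_t; rewrite E.
case: (ltnP x l) => [lt_xl | le_lx].
  by case: av4231; apply/contains4231P; exists i, j, x, l; split=> //; split; lia.
case: (ltngtP (s y) (s x)) => [lt_yx | lt_xy | /val_inj/perm_inj eyx].
- by case: av4231; apply/contains4231P; exists i, j, y, l; split=> //; split=> //; lia.
- case: av132; apply/contains132P; exists j, y, x; split=> //=; lia.
by move: le_lx; rewrite -eyx /=; lia.
Qed.

End Minima.

Section Explicit.
Variables p q A M : nat.
Hypotheses (q_gt0 : 0 < q) (lt_AM : A < M) (le_n : p + q + M <= n.+1).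
Hypothesis qM : (q == 1) || (M == A.+1).
Local Notation shape_fun := (shape_fun p q A M).
Local Notation shape_funP := (shape_funP p q A M).

Lemma shape_fun_lt i : i < n -> shape_fun i < n.
Proof. by move=> lt_in; case: (shape_funP i) => [[]|[]|[]|[? [[]|[]|[]]]]; lia. Qed.

Lemma shape_fun_inj i j : i < n -> j < n -> shape_fun i = shape_fun j -> i = j.
Proof.
move=> lt_in lt_jn; case: (shape_funP i) => [[]|[]|[]|[? [[]|[]|[]]]];
  case: (shape_funP j) => [[]|[]|[]|[? [[]|[]|[]]]]; lia.
Qed.

Lemma shape_perm_inj : injective (fun i : 'I_n => Ordinal (shape_fun_lt (ltn_ord i))).
Proof. by move=> i j [/shape_fun_inj e]; apply: val_inj; apply: e. Qed.

Definition shape_perm : 'S_n := perm shape_perm_inj.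

Lemma shape_permE (i : 'I_n) : shape_perm i = shape_fun i :> nat.
Proof. by rewrite permE. Qed.

(** Numbers the three blocks of positions, on each of which [shape_fun] increases; a descent must
    change block. *)
Definition block i := (p <= i) + (p + q <= i).

Lemma shape_descent i j : i < j -> shape_fun j < shape_fun i -> block i < block j.
Proof.
rewrite /block; move=> lt_ij; case: (shape_funP i) => [[]|[]|[]|[? [[]|[]|[]]]];
  case: (shape_funP j) => [[]|[]|[]|[? [[]|[]|[]]]]; lia.
Qed.

(** Here [qM] matters: with [q >= 2] and [M > A + 1], the letters [A], [M + p] and the leftover
    [A + 1] would form a 132. *)
Lemma shape_avoid132 : ~ contains_pattern [:: 1; 3; 2] shape_perm.
Proof.
case/contains132P=> i [j [k [lt_ij lt_jk]]]; rewrite !shape_permE => lt_ik lt_kj.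
have := shape_descent lt_jk lt_kj; rewrite /block.
case: (shape_funP k) lt_ik lt_kj => [[]|[]|[]|[? [[]|[]|[]]]];
  case: (shape_funP i) => [[]|[]|[]|[? [[]|[]|[]]]]; try lia;
  case: (shape_funP j) => [[]|[]|[]|[? [[]|[]|[]]]]; lia.
Qed.

Lemma shape_avoid4321 : ~ contains_pattern [:: 4; 3; 2; 1] shape_perm.
Proof.
case/contains4321P=> i [j [k [l [lt_ij lt_jk lt_kl []]]]]; rewrite !shape_permE.
move=> /(shape_descent lt_kl) b1 /(shape_descent lt_jk) b2 /(shape_descent lt_ij) b3.
have b4 : block l <= 2 by rewrite /block; lia.
by lia.
Qed.

(** The descents force the blocks 0, 1, 1, 2; but a letter of block 1 other than its first exceeds
    all letters of block 0. *)
Lemma shape_avoid4231 : ~ contains_pattern [:: 4; 2; 3; 1] shape_perm.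
Proof.
case/contains4231P=> i [j [k [l [lt_ij lt_jk lt_kl []]]]]; rewrite !shape_permE.
move=> lt_lj lt_jk' lt_ki.
have b1 := shape_descent (ltn_trans lt_jk lt_kl) lt_lj.
have b2 := shape_descent (ltn_trans lt_ij lt_jk) lt_ki.
have b3 := shape_descent lt_ij (ltn_trans lt_jk' lt_ki).
have b4 := shape_descent lt_kl (ltn_trans lt_lj lt_jk').
move: b1 b2 b3 b4 lt_ki; rewrite /block.
by case: (shape_funP k) => [[]|[]|[]|[? _]]; case: (shape_funP i) => [[]|[]|[]|[? _]]; lia.
Qed.

Lemma shape_avoid321 : p = 0 -> ~ contains_pattern [:: 3; 2; 1] shape_perm.
Proof.
move=> p0; case/contains321P=> i [j [k [lt_ij lt_jk]]]; rewrite !shape_permE.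
move=> /(shape_descent lt_jk) b1 /(shape_descent lt_ij); move: b1; rewrite /block; lia.
Qed.

(** The third block starts with a new minimum only if [A > 0], since otherwise the value 0 has
    already occurred. For [p = 0] the first two positions coincide. *)
Lemma shape_minima l : sorted ltn l ->
    (forall i, i \in l = (i < n) && [|| i == 0, i == p | (i == p + q) && (0 < A)]) ->
  lrmin_positions (one_line shape_perm) = l.
Proof.
move=> sl lE; apply: (irr_sorted_eq ltn_trans ltnn) => // [|i]; first exact: pos_sorted.
rewrite lE; case: (ltnP i n) => [lt_in | le_ni] /=; last first.
  by apply/negbTE/negP=> /pos_lt; rewrite ltnNge le_ni.
rewrite [LHS](mem_lrmin shape_perm (Ordinal lt_in)).
apply/forallP/idP=> [H | H j]; last first.
  apply/implyP=> /=; rewrite !shape_permE /= => lt_ji; have := ltn_ord j.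
  case: (shape_funP j) => [[]|[]|[]|[? [[]|[]|[]]]];
    case: (shape_funP i) => [[]|[]|[]|[? [[]|[]|[]]]]; lia.
have lt_pn : p < n by lia.
have := H (Ordinal n_gt0); have := H (Ordinal lt_pn); rewrite !shape_permE /=.
have Hpq : p + q < n -> (p + q < i) ==> (shape_fun i < shape_fun (p + q)).
  by move=> lt_pqn; have := H (Ordinal lt_pqn); rewrite !shape_permE.
have := Hpq.
case: (shape_funP 0) => [[]|[]|[]|[? [[]|[]|[]]]]; try lia;
case: (shape_funP p) => [[]|[]|[]|[? [[]|[]|[]]]]; try lia;
case: (shape_funP (p + q)) => [[]|[]|[]|[? [[]|[]|[]]]]; try lia;
case: (shape_funP i) => [[]|[]|[]|[? [[]|[]|[]]]]; lia.
Qed.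

End Explicit.
End Krattenthaler.

Section ShapeWord.
Local Open Scope nat_scope.
Variables (n p q A M : nat).
Hypotheses (n_gt0 : 0 < n) (q_gt0 : 0 < q) (lt_AM : A < M) (le_n : p + q + M <= n.+1).
Hypothesis qM : (q == 1) || (M == A.+1).
Local Notation s := (shape_perm n_gt0 q_gt0 lt_AM le_n qM).

Lemma nth_shape i : i < n -> nth 0 (one_line s) i = (shape_fun p q A M i).+1.
Proof.
by move=> lt_in; rewrite -[i]/(nat_of_ord (Ordinal lt_in)) nth_one_line shape_permE.
Qed.

Lemma shape_fun_p : shape_fun p q A M p = A.
Proof. by rewrite /shape_fun ltnn eqxx. Qed.

Lemma krattenthaler_shape3 : 0 < p -> 0 < A -> p + q < n ->
  krattenthaler s = expand [:: (n - (p + q), A); (q, M - A); (p, n - M)].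
Proof.
move=> p_gt0 A_gt0 lt_pqn.
have posE : lrmin_positions (one_line s) = [:: 0; p; p + q].
  apply: shape_minima => [|i] /=; first by lia.
  by rewrite !inE; lia.
have v0 : shape_fun p q A M 0 = M by rewrite /shape_fun p_gt0 addn0.
have vpq : shape_fun p q A M (p + q) = 0.
  by case: (shape_funP p q A M (p + q)) => [[]|[]|[]|[? [[]|[]|[]]]]; lia.
rewrite krattenthalerE /runs /run /lrgap /lrmin posE size_one_line /=.
rewrite !nth_shape //; last by lia.
rewrite v0 vpq shape_fun_p.
by congr (expand [:: (_, _); (_, _); (_, _)]); lia.
Qed.

Lemma krattenthaler_shape2 : p = 0 -> 0 < A -> q < n ->
  krattenthaler s = expand [:: (n - q, A); (q, n - A)].
Proof.
move=> p0 A_gt0 lt_qn.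
have posE : lrmin_positions (one_line s) = [:: 0; q].
  apply: shape_minima => [|i] /=; first by lia.
  by rewrite !inE; lia.
have v0 : shape_fun p q A M 0 = A by rewrite /shape_fun p0.
have vq : shape_fun p q A M q = 0.
  by case: (shape_funP p q A M q) => [[]|[]|[]|[? [[]|[]|[]]]]; lia.
rewrite krattenthalerE /runs /run /lrgap /lrmin posE size_one_line /=.
rewrite !nth_shape // v0 vq.
by congr (expand [:: (_, _); (_, _)]); lia.
Qed.

Lemma krattenthaler_shape1 : p = 0 -> A = 0 -> q = n ->
  krattenthaler s = expand [:: (n, n)].
Proof.
move=> p0 A0 qn.
have posE : lrmin_positions (one_line s) = [:: 0].
  apply: shape_minima => [|i] //=.
  by rewrite !inE; lia.
have v0 : shape_fun p q A M 0 = A by rewrite /shape_fun p0.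
rewrite krattenthalerE /runs /run /lrgap /lrmin posE size_one_line /=.
rewrite !nth_shape // v0.
by congr (expand [:: (_, _)]); lia.
Qed.

End ShapeWord.

(** The path lists the runs of the permutation backwards, so the parameters are read off from its
    end: [p = u3], [q = u2], [A = d1], [M = d1 + d2]. With two runs, [p = 0] and [M = A + 1]; with
    one, [A = 0] and [M = 1]. For three runs [shod_runs] gives [qM] and, with the Dyck condition,
    the size bound. *)
Lemma krattenthaler_surj (n : nat) (rs : seq (nat * nat)) : (0 < n)%N ->
    positive_runs rs -> is_dyck n (expand rs) -> shod_runs rs ->
  exists s : 'S_n, [/\ ~ contains_pattern [:: 1; 3; 2] s,
    ~ contains_pattern [:: 4; 3; 2; 1] s, ~ contains_pattern [:: 4; 2; 3; 1] s,
    (size rs <= 2)%N -> ~ contains_pattern [:: 3; 2; 1] s &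
    krattenthaler s = expand rs].
Proof.
move=> n_gt0; rewrite /positive_runs => pos /is_dyckP[].
rewrite count_expand count_expand_true => cU cD e_gt good.
have avoids p q A M (h1 : (0 < q)%N) (h2 : (A < M)%N) h3 h4 :
    let s := @shape_perm n n_gt0 p q A M h1 h2 h3 h4 in
    ((size rs <= 2)%N -> p = 0%N) -> krattenthaler s = expand rs ->
    exists s : 'S_n, [/\ ~ contains_pattern [:: 1; 3; 2] s,
      ~ contains_pattern [:: 4; 3; 2; 1] s, ~ contains_pattern [:: 4; 2; 3; 1] s,
      (size rs <= 2)%N -> ~ contains_pattern [:: 3; 2; 1] s &
      krattenthaler s = expand rs].
  move=> s p0 sE; exists s; split=> //.
  - exact: shape_avoid132.
  - exact: shape_avoid4321.
  - exact: shape_avoid4231.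
  by move=> /p0; apply: shape_avoid321.
case: rs pos cU cD e_gt good avoids => [|[u1 d1] [|[u2 d2] [|[u3 d3] [|r rs]]]] //=.
- by lia.
- move=> pos cU cD _ _ avoids.
  have [h1 h2 h3 h4] : [/\ 0 < n, 0 < 1, 0 + n + 1 <= n.+1 & (n == 1) || (1 == 0.+1)]%N.
    by split=> //; lia.
  apply: (avoids 0%N n 0%N 1%N h1 h2 h3 h4) => //.
  by rewrite krattenthaler_shape1 //; congr (expand [:: (_, _)]); lia.
- move=> pos cU cD e_gt _ avoids; have := e_gt d1.-1; rewrite ups_expand => e1.
  have {}e1 : (d1 <= u1)%N by move: e1; case: ifP; lia.
  have [h1 h2 h3 h4] : [/\ 0 < u2, d1 < d1.+1, 0 + u2 + d1.+1 <= n.+1 &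
      (u2 == 1) || (d1.+1 == d1.+1)]%N by split; lia.
  apply: (avoids 0%N u2 d1 d1.+1 h1 h2 h3 h4) => //.
  by rewrite krattenthaler_shape2 //; [congr (expand [:: (_, _); (_, _)]) |..]; lia.
move=> pos cU cD e_gt good avoids.
have e1 : (d1 <= u1)%N by have := e_gt d1.-1; rewrite ups_expand; case: ifP; lia.
have e2 : (d1 + d2 <= u1 + u2)%N.
  by have := e_gt (d1 + d2).-1; rewrite !ups_expand; do ?case: ifP; lia.
have [h1 h2 h3 h4] : [/\ 0 < u2, d1 < d1 + d2, u3 + u2 + (d1 + d2) <= n.+1 &
    (u2 == 1) || (d1 + d2 == d1.+1)]%N by split; lia.
apply: (avoids u3 u2 d1 (d1 + d2)%N h1 h2 h3 h4) => //.
by rewrite krattenthaler_shape3 //; [congr (expand [:: (_, _); (_, _); (_, _)]) |..]; lia.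
Qed.

Local Open Scope classical_set_scope.

Theorem theorem1p1 (K : fieldType) (n : nat) (hn : (1 <= n)%N) :
  set_bij (avoiding n [:: 1; 3; 2] `&` avoiding n [:: 4; 3; 2; 1]
             `&` avoiding n [:: 4; 2; 3; 1])
          (shod_dyck K n) (@krattenthaler n) /\
  set_bij (avoiding n [:: 1; 3; 2] `&` avoiding n [:: 3; 2; 1])
          (tilted_dyck K n) (@krattenthaler n).
Proof.
have shodE rs : positive_runs rs -> is_dyck n (expand rs) ->
    shod_dyck K n (expand rs) <-> shod_runs rs.
  move=> pos dw; rewrite -(shod_dyckP K hn pos erefl dw).
  by split=> [[_]|].
have tiltE rs : positive_runs rs -> is_dyck n (expand rs) ->
    tilted_dyck K n (expand rs) <-> (size rs <= 2)%N.
  move=> pos dw; rewrite -(tilted_dyckP K hn pos erefl dw).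
  by split=> [[_]|].
have kE (s : 'S_n) : exists rs, [/\ rs = runs s (size (lrmin_positions (one_line s))),
    positive_runs rs, krattenthaler s = expand rs & is_dyck n (expand rs)].
  exists (runs s (size (lrmin_positions (one_line s)))).
  by rewrite -krattenthalerE; split=> //; [apply: runs_positive | apply: krattenthaler_dyck].
split; split.
- move=> s [[av132 av4321] av4231]; have [rs [rsE pos -> dw]] := kE s.
  by apply/shodE => //; rewrite rsE; apply: avoid_shod_runs.
- by move=> s s' /set_mem[[av _] _] /set_mem[[av' _] _]; apply: krattenthaler_inj.
- move=> w [dw [A [nakA shodA]]]; have [rs [pos wE]] := dyck_runs hn dw.
  have shw : shod_dyck K n w by split=> //; exists A.
  rewrite wE in dw shw *; have /(shodE _ pos dw) good := shw.
  by have [s [? ? ? _ <-]] := krattenthaler_surj hn pos dw good; exists s.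
- move=> s [av132 av321]; have [rs [rsE pos -> dw]] := kE s.
  by apply/tiltE => //; rewrite rsE size_runs; apply: avoid321_runs.
- by move=> s s' /set_mem[av _] /set_mem[av' _]; apply: krattenthaler_inj.
move=> w [dw [A [nakA tiltA]]]; have [rs [pos wE]] := dyck_runs hn dw.
have tw : tilted_dyck K n w by split=> //; exists A.
rewrite wE in dw tw *; have /(tiltE _ pos dw) good := tw.
(* Words with at most two runs satisfy [shod_runs], so the preimage comes from the same family, now
   with [p = 0]. *)
have sgood : shod_runs rs by clear - good; case: rs good => [|? [|[u d] [|? ?]]].
have [s [? ? ? av <-]] := krattenthaler_surj hn pos dw sgood.
by exists s => //; split=> //; apply: av.
Qed.
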